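(* Let $y\in\mathbb{C}$. 1) If $0<|y|<1$, then $\mathcal{E}(-1,y)$ is isomorphic to the $C^*$-algebra of all $f\in C(D_y\times\mathbf{T}^2\to M_4(\mathbb{C}))$ satisfying, for all values of the variables, $$f(0,x_2,e^{i\phi_1},e^{i\phi_2})=f(0,x_2,1,e^{i\phi_2}),$$ $$f(x_1,0,e^{i\phi_1},e^{i\phi_2})=f(x_1,0,e^{i\phi_1},1),$$ $$f\bigl(\tfrac{1-|y|}{2},x_2,e^{i\phi_1},e^{i\phi_2}\bigr)=f\bigl(\tfrac{1-|y|}{2},0,e^{i\phi_1},1\bigr)\in M_2(\mathbb{C})\otimes\mathbf{1},$$ $$\nu_2^*(\phi_2)f(x_1,\tfrac12,e^{i\phi_1},e^{i\phi_2})\nu_2(\phi_2)\in M_2(\mathbb{C})\oplus M_2(\mathbb{C}),\quad\forall\phi_2\in[0,2\pi].$$ 2) If $|y|=1$, then $\mathcal{E}(-1,y)$ is isomorphic to $M_2(\mathbb{C})$.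
   Context: For $y\in\mathbb{C}$, $\mathcal{E}(-1,y)$ is the universal (enveloping) $C^*$-algebra generated by $a_1,a_2$ with relations $a_i^*a_i+a_ia_i^*=1$ ($i=1,2$), $a_1^*a_2=-a_2a_1^*$, $a_1a_2+a_2a_1=y1$. $\mathbf{T}=\{z\in\mathbb{C}:|z|=1\}$; $D_y=\{(x_1,x_2): 0\le x_1\le\frac{1-|y|}{2},\ 0\le x_2\le\frac12\}$; points of $D_y\times\mathbf{T}^2$ are written $(x_1,x_2,e^{i\phi_1},e^{i\phi_2})$. $C(X\to M_n(\mathbb{C}))$ is the $C^*$-algebra of continuous $M_n(\mathbb C)$-valued functions on $X$ with pointwise operations. $\nu_2:[0,2\pi]\to U(4)$, $\nu_2(\phi)=T(V(\phi)\otimes\mathbf{1}_2)$, where $T:\mathbb{C}^2\otimes\mathbb{C}^2\to\mathbb{C}^2\otimes\mathbb{C}^2$, $T(x\otimes y)=y\otimes x$, and $V(\phi)=\frac{1}{\sqrt2}\begin{pmatrix} e^{i\phi/2} & -e^{i\phi/2}\\ 1&1\end{pmatrix}$. The identification $\mathbb{C}^2\otimes\mathbb{C}^2=\mathbb{C}^4$ is such that $A\otimes B=(a_{ij}B)$ (Kronecker product), and $M_2(\mathbb{C})\oplus M_2(\mathbb{C})\subset M_4(\mathbb{C})$ denotes block-diagonal matrices with two $2\times2$ blocks. *)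

(* Defs.v *)
From HB Require Import structures.
From mathcomp Require Import all_boot all_order all_algebra.
From mathcomp Require Import all_classical all_reals.
From mathcomp Require Import topology normedtype trigo.
From mathcomp Require Import complex mxtens.

Set Implicit Arguments.
Unset Strict Implicit.
Unset Printing Implicit Defensive.

Import Order.TTheory GRing.Theory Num.Theory.
Import numFieldNormedType.Exports.
Import ComplexField.Normc.

Local Open Scope classical_set_scope.
Local Open Scope ring_scope.
Local Open Scope complex_scope.
Local Open Scope sesquilinear_scope.

(* The topology of C = R[i] is the one of its modulus; it induces the
   topologies of products and matrices over R[i]. *)
HB.instance Definition _ (R : realType) := NormedModule.copy R[i] R[i]^o.

HB.mixin Record Algebra_hasStar (C : numClosedFieldType) A
    of GRing.Algebra C A := {
  star : A -> A;
  starK : involutive star;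
  starD : {morph star : x y / x + y};
  starZ : forall (c : C) x, star (c *: x) = Num.conj c *: star x;
  starM : forall x y, star (x * y) = star y * star x
}.

#[short(type="starAlgType")]
HB.structure Definition StarAlgebra (C : numClosedFieldType) :=
  {A of GRing.Algebra C A & Algebra_hasStar C A}.

(* The library's normed modules cannot be joined with its noncommutative rings
   in the structure hierarchy, hence an explicit real-valued norm. *)
HB.mixin Record StarAlgebra_isCStar (R : realType) A of StarAlgebra R[i] A := {
  cnorm : A -> R;
  cnorm0_eq0 : forall x, cnorm x = 0 -> x = 0;
  cnormD_le : forall x y, cnorm (x + y) <= cnorm x + cnorm y;
  cnormZ : forall (c : R[i]) x, cnorm (c *: x) = normc c * cnorm x;
  cnormM_le : forall x y, cnorm (x * y) <= cnorm x * cnorm y;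
  cnorm_starM : forall x, cnorm (star x * x) = cnorm x ^+ 2;
  cnorm_complete : forall u : nat -> A,
    (forall e : R, 0 < e -> \forall m & n \near \oo, cnorm (u m - u n) < e) ->
    exists l, cnorm (u n - l) @[n --> \oo] --> (0 : R)
}.

#[short(type="cstarAlgType")]
HB.structure Definition CStarAlgebra (R : realType) :=
  {A of StarAlgebra R[i] A & StarAlgebra_isCStar R A}.

Definition star_morphism (C : numClosedFieldType) (A B : starAlgType C)
  (f : A -> B) : Prop := {morph f : x / star x >-> star x}.

(* The norm of a C*-algebra is determined by its *-algebra structure, and a
   *-isomorphism between C*-algebras is automatically isometric. *)
Definition star_isomorphic (C : numClosedFieldType) (A B : starAlgType C) : Prop :=
  exists f : {lrmorphism A -> B}, star_morphism f /\ bijective f.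

Definition enveloping_relations (C : numClosedFieldType) (A : starAlgType C) (y : C)
    (a1 a2 : A) : Prop :=
  [/\ star a1 * a1 + a1 * star a1 = 1,
      star a2 * a2 + a2 * star a2 = 1,
      star a1 * a2 = - (a2 * star a1) &
      a1 * a2 + a2 * a1 = y *: 1].

(* E, with generators a1 and a2, is the universal C*-algebra for the relations.
   Algebras of the library are nonzero; this excludes no condition, since the
   zero algebra receives exactly one morphism from any algebra. *)
Definition is_enveloping (R : realType) (y : R[i]) (E : cstarAlgType R) (a1 a2 : E)
    : Prop :=
  enveloping_relations y a1 a2 /\
  forall (B : cstarAlgType R) (b1 b2 : B), enveloping_relations y b1 b2 ->
    exists f : {lrmorphism E -> B},
      [/\ star_morphism f, f a1 = b1, f a2 = b2 &
          forall g : {lrmorphism E -> B},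
            star_morphism g -> g a1 = b1 -> g a2 = b2 -> g =1 f].

(* The universal C*-algebra, unique up to isomorphism, exists and is isomorphic
   to B. *)
Definition enveloping_isomorphic (R : realType) (y : R[i]) (B : starAlgType R[i]) : Prop :=
  (exists (E : cstarAlgType R) (a1 a2 : E), is_enveloping y a1 a2) /\
  (forall (E : cstarAlgType R) (a1 a2 : E), is_enveloping y a1 a2 -> star_isomorphic E B).

Section matrix_star.
Variables (C : numClosedFieldType) (n : nat).
Implicit Types A B : 'M[C]_n.+1.

Let mx_starK : involutive (fun A : 'M[C]_n.+1 => A ^t*).
Proof. by move=> A; exact: trmxCK. Qed.

Let mx_starD : {morph (fun A : 'M[C]_n.+1 => A ^t*) : A B / A + B}.
Proof. by move=> A B; apply/matrixP => i j; rewrite !mxE rmorphD. Qed.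

Let mx_starZ (c : C) A : (c *: A) ^t* = Num.conj c *: A ^t*.
Proof. by apply/matrixP => i j; rewrite !mxE rmorphM. Qed.

Let mx_starM A B : (A * B) ^t* = B ^t* * A ^t*.
Proof. by rewrite -!mulmxE trmx_mul map_mxM. Qed.

HB.instance Definition _ := Algebra_hasStar.Build C 'M[C]_n.+1
  mx_starK mx_starD mx_starZ mx_starM.
End matrix_star.

Section model.
Variable R : realType.
Implicit Types (y : R[i]) (phi : R).

Definition expi phi : R[i] := cos phi +i* sin phi.

Definition Vmx phi : 'M[R[i]]_2 := (Num.sqrt 2)^-1%:C *:
  (\matrix_(i, j) (if i == 0 then
                     if j == 0 then expi (phi / 2) else - expi (phi / 2)
                   else 1)).

(* The flip e_a (x) e_b |-> e_b (x) e_a, in the Kronecker basis. *)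
Definition flipmx : 'M[R[i]]_4 := \matrix_(k < 2 * 2, l < 2 * 2)
  (mxtens_unindex k == ((mxtens_unindex l).2, (mxtens_unindex l).1))%:R.

Definition nu2 phi : 'M[R[i]]_4 := flipmx *m (Vmx phi *t (1%:M : 'M[R[i]]_2)).

Definition xmax y : R := (1 - normc y) / 2.

(* D_y x T^2 *)
Definition DT y : set (R * R * R[i] * R[i]) :=
  [set p | [/\ 0 <= p.1.1.1 <= xmax y, 0 <= p.1.1.2 <= 1 / 2,
               normc p.1.2 = 1 & normc p.2 = 1]].

(* f (x1, x2, z1, z2); the extension by 0 outside D_y x T^2 is never used. *)
Definition at_pt y (f : DT y -> 'M[R[i]]_4) (x1 x2 : R) (z1 z2 : R[i]) :
  'M[R[i]]_4 := 'valL_0 f (x1, x2, z1, z2).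

Definition boundary_conditions y (f : DT y -> 'M[R[i]]_4) : Prop :=
  [/\ forall x2 phi1 phi2, 0 <= x2 <= 1 / 2 ->
        at_pt f 0 x2 (expi phi1) (expi phi2) = at_pt f 0 x2 1 (expi phi2),
      forall x1 phi1 phi2, 0 <= x1 <= xmax y ->
        at_pt f x1 0 (expi phi1) (expi phi2) = at_pt f x1 0 (expi phi1) 1,
      forall x2 phi1 phi2, 0 <= x2 <= 1 / 2 ->
        at_pt f (xmax y) x2 (expi phi1) (expi phi2)
          = at_pt f (xmax y) 0 (expi phi1) 1 /\
        exists A : 'M[R[i]]_2,
          at_pt f (xmax y) 0 (expi phi1) 1 = A *t (1%:M : 'M[R[i]]_2) &
      forall x1 phi1 phi2, 0 <= x1 <= xmax y -> 0 <= phi2 <= 2 * pi ->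
        exists A B : 'M[R[i]]_2,
          (nu2 phi2) ^t* *m at_pt f x1 (1 / 2) (expi phi1) (expi phi2) *m nu2 phi2
            = block_mx A 0 0 B].

End model.

Lemma mx_star_conj (C : numClosedFieldType) n (U M : 'M[C]_n) :
  U ^t* *m M ^t* *m U = (U ^t* *m M *m U) ^t*.
Proof. by rewrite !trmx_mul !map_mxM trmxCK mulmxA. Qed.

Section model_theory.
Variable R : realType.
Implicit Types (y : R[i]) (phi : R).
Lemma at_pt_op1 y (op : 'M[R[i]]_4 -> 'M[R[i]]_4) (f : DT y -> 'M[R[i]]_4)
    x1 x2 z1 z2 : op 0 = 0 ->
  at_pt (fun p => op (f p)) x1 x2 z1 z2 = op (at_pt f x1 x2 z1 z2).
Proof. by move=> op0; rewrite /at_pt /valL_ /=; case: ('oinv_set_val _). Qed.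

Lemma at_pt_op2 y (op : 'M[R[i]]_4 -> 'M[R[i]]_4 -> 'M[R[i]]_4)
    (f g : DT y -> 'M[R[i]]_4) x1 x2 z1 z2 : op 0 0 = 0 ->
  at_pt (fun p => op (f p) (g p)) x1 x2 z1 z2
    = op (at_pt f x1 x2 z1 z2) (at_pt g x1 x2 z1 z2).
Proof. by move=> op0; rewrite /at_pt /valL_ /=; case: ('oinv_set_val _). Qed.

Lemma at_pt_cst y (M : 'M[R[i]]_4) x1 x2 z1 z2 :
  0 <= x1 <= xmax y -> 0 <= x2 <= 1 / 2 -> normc z1 = 1 -> normc z2 = 1 ->
  at_pt (fun _ : DT y => M) x1 x2 z1 z2 = M.
Proof.
move=> h1 h2 h3 h4; rewrite /at_pt /valL_ /= oinv_set_val insubT //.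
by apply/mem_set.
Qed.

Lemma normc_expi phi : normc (expi phi) = 1.
Proof. by rewrite /= cos2Dsin2 sqrtr1. Qed.

Lemma conj_expi phi : Num.conj (expi phi) * expi phi = 1.
Proof.
have <- := normCKC (expi phi).
have -> : `|expi phi| = (normc (expi phi))%:C by [].
by rewrite normc_expi expr1n.
Qed.

Lemma Vmx_unitary phi : (Vmx phi) ^t* *m Vmx phi = 1%:M.
Proof.
have e1 := conj_expi (phi / 2); set e := expi (phi / 2) in e1.
set s : R[i] := (Num.sqrt 2)^-1%:C.
have s2 : Num.conj s * s = 2^-1.
  have -> : Num.conj s = s.
    by apply/CrealP/complex_realP; exists (Num.sqrt 2)^-1.
  rewrite /s -rmorphM /= -invfM -expr2 sqr_sqrtr //.
  by rewrite (fmorphV (real_complex R)) rmorph_nat.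
have s2e : Num.conj s * s + Num.conj s * s = 1.
  by rewrite s2 -[2^-1]mul1r -splitr.
have cs u v : Num.conj (s * u) * (s * v) = Num.conj s * s * (Num.conj u * v).
  by rewrite rmorphM mulrACA.
apply/matrixP => i j; rewrite !mxE big_ord_recl big_ord1 !mxE /= -/e -/s.
case: i => -[|[|//]] ?; case: j => -[|[|//]] ?; rewrite /= !cs.
- by rewrite e1 rmorph1 !mulr1.
- by rewrite mulrN e1 rmorph1 mulr1 mulrN1 mulr1 addNr.
- by rewrite rmorphN mulNr e1 rmorph1 mulr1 mulrN1 mulr1 addNr.
- by rewrite rmorphN mulrNN e1 rmorph1 !mulr1.
Qed.

Lemma flipmx_unitary : (flipmx R) ^t* *m flipmx R = 1%:M.
Proof.
apply/matrixP => k l; rewrite !mxE.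
set sw := fun k : 'I_(2 * 2) =>
  mxtens_index ((mxtens_unindex k).2, (mxtens_unindex k).1).
rewrite (bigD1 (sw k)) //= big1 => [|m mk]; rewrite !mxE rmorph_nat.
  rewrite mxtens_indexK eqxx mul1r addr0; congr (_%:R); congr nat_of_bool.
  apply/eqP/eqP => [h|->//]; apply: (can_inj (@mxtens_unindexK 2 2)).
  by move: h; case: (@mxtens_unindex 2 2 k) (@mxtens_unindex 2 2 l) => a b [c d] [-> ->].
case: eqP => [h|_]; last by rewrite mul0r.
by case/eqP: mk; rewrite /sw -h mxtens_unindexK.
Qed.

Lemma tens_star (A : 'M[R[i]]_2) :
  (A *t (1%:M : 'M[R[i]]_2)) ^t* = A ^t* *t (1%:M : 'M[R[i]]_2).
Proof.
rewrite trmx_tens trmx1; apply/matrixP => k l; rewrite !mxE rmorphM.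
by rewrite rmorph_nat.
Qed.

Lemma block_star (A B : 'M[R[i]]_2) :
  (block_mx A 0 0 B) ^t* = block_mx (A ^t*) 0 0 (B ^t*).
Proof. by rewrite tr_block_mx map_block_mx !trmx0 !map_mx0. Qed.

Lemma nu2_unitary phi : (nu2 phi) ^t* *m nu2 phi = 1%:M.
Proof.
rewrite /nu2 trmx_mul map_mxM tens_star -mulmxA (mulmxA _ (flipmx R)) flipmx_unitary.
rewrite mul1mx; transitivity
  (((Vmx phi) ^t* *m Vmx phi) *t ((1%:M : 'M[R[i]]_2) *m 1%:M)).
  exact: (@tensmx_mul R[i] 2 2 2 2 2 2).
rewrite Vmx_unitary mulmx1.
apply/matrixP => k l; rewrite !mxE -natrM mulnb; congr (_%:R); congr nat_of_bool.
rewrite -(can_eq (@mxtens_unindexK 2 2)).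
by case: (@mxtens_unindex 2 2 k) (@mxtens_unindex 2 2 l) => a b [c d].
Qed.

Lemma entry_continuous (T : topologicalType) (f : T -> 'M[R[i]]_4) :
  continuous f <-> forall i j, continuous (fun p => f p i j).
Proof.
split=> [cf i j p|cf p].
  by apply: (@continuous_comp _ _ _ f (fun M : 'M[R[i]]_4 => M i j));
    [exact: cf|exact: coord_continuous].
move=> A [P Pnbhs PA].
have : \forall q \near p, forall i j, P i j (f q i j).
  apply: filter_forall => i; apply: filter_forall => j; exact: cf.
by apply: filterS => q Pq; exact: PA.
Qed.

Lemma continuous_mxB (T : topologicalType) (f g : T -> 'M[R[i]]_4) :
  continuous f -> continuous g -> continuous (fun p => f p - g p).
Proof.
move=> cf cg p.
exact: (@cvgB R[i] 'M[R[i]]_4 T (nbhs p) _ f g _ _ (cf p) (cg p)).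
Qed.

Lemma continuous_mxM (T : topologicalType) (f g : T -> 'M[R[i]]_4) :
  continuous f -> continuous g -> continuous (fun p => f p *m g p).
Proof.
move=> /entry_continuous cf /entry_continuous cg; apply/entry_continuous => i j p.
rewrite (_ : (fun _ => _) = fun q => \sum_k f q i k * g q k j); last first.
  by apply/funext => q; rewrite mxE.
apply: (continuous_big add_continuous) => k _ q.
exact: (cvgM (cf i k q) (cg k j q)).
Qed.

Lemma continuous_mxZ (T : topologicalType) (c : R[i]) (f : T -> 'M[R[i]]_4) :
  continuous f -> continuous (fun p => c *: f p).
Proof.
move=> cf p; exact: (@cvgZl_tmp R[i] 'M[R[i]]_4 T (nbhs p) _ c f _ (cf p)).
Qed.

Lemma continuous_mx_star (T : topologicalType) (f : T -> 'M[R[i]]_4) :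
  continuous f -> continuous (fun p => (f p) ^t*).
Proof.
move=> /entry_continuous cf; apply/entry_continuous => i j p.
rewrite (_ : (fun _ => _) = fun q => Num.conj (f q j i)); last first.
  by apply/funext => q; rewrite !mxE.
apply/cvgrPdist_lt => e e0.
have /cvgrPdist_lt/(_ e e0) := cf j i p.
by apply: filterS => q; rewrite -rmorphB norm_conjC.
Qed.

Lemma boundary_op1 y (op : 'M[R[i]]_4 -> 'M[R[i]]_4) (f : DT y -> 'M[R[i]]_4) :
  op 0 = 0 ->
  (forall A : 'M[R[i]]_2, exists B : 'M[R[i]]_2,
    op (A *t (1%:M : 'M[R[i]]_2)) = B *t (1%:M : 'M[R[i]]_2)) ->
  (forall A B : 'M[R[i]]_2, exists A' B' : 'M[R[i]]_2,
    op (block_mx A 0 0 B) = block_mx A' 0 0 B') ->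
  (forall phi M, (nu2 phi) ^t* *m op M *m nu2 phi
     = op ((nu2 phi) ^t* *m M *m nu2 phi)) ->
  boundary_conditions f -> boundary_conditions (fun p => op (f p)).
Proof.
move=> op0 opT opB opU [h1 h2 h3 h4]; split.
- by move=> x2 p1 p2 hx; rewrite !at_pt_op1 // h1.
- by move=> x1 p1 p2 hx; rewrite !at_pt_op1 // h2.
- move=> x2 p1 p2 hx; rewrite !at_pt_op1 //; have [-> [A ->]] := h3 x2 p1 p2 hx.
  by split=> //; exact: opT.
- move=> x1 p1 p2 hx hp; have [A [B e]] := h4 x1 p1 p2 hx hp.
  by rewrite at_pt_op1 // opU e.
Qed.

Lemma boundary_op2 y (op : 'M[R[i]]_4 -> 'M[R[i]]_4 -> 'M[R[i]]_4)
    (f g : DT y -> 'M[R[i]]_4) :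
  op 0 0 = 0 ->
  (forall A B : 'M[R[i]]_2, exists C : 'M[R[i]]_2,
    op (A *t (1%:M : 'M[R[i]]_2)) (B *t (1%:M : 'M[R[i]]_2))
      = C *t (1%:M : 'M[R[i]]_2)) ->
  (forall A B A' B' : 'M[R[i]]_2, exists A'' B'' : 'M[R[i]]_2,
    op (block_mx A 0 0 B) (block_mx A' 0 0 B') = block_mx A'' 0 0 B'') ->
  (forall phi M N, (nu2 phi) ^t* *m op M N *m nu2 phi
     = op ((nu2 phi) ^t* *m M *m nu2 phi) ((nu2 phi) ^t* *m N *m nu2 phi)) ->
  boundary_conditions f -> boundary_conditions g ->
  boundary_conditions (fun p => op (f p) (g p)).
Proof.
move=> op0 opT opB opU [h1 h2 h3 h4] [k1 k2 k3 k4]; split.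
- by move=> x2 p1 p2 hx; rewrite !at_pt_op2 // h1 // k1.
- by move=> x1 p1 p2 hx; rewrite !at_pt_op2 // h2 // k2.
- move=> x2 p1 p2 hx; rewrite !at_pt_op2 //; have [-> [A ->]] := h3 x2 p1 p2 hx.
  have [-> [B ->]] := k3 x2 p1 p2 hx.
  by split=> //; exact: opT.
- move=> x1 p1 p2 hx hp; have [A [B e]] := h4 x1 p1 p2 hx hp.
  have [A' [B' e']] := k4 x1 p1 p2 hx hp.
  by rewrite at_pt_op2 // opU e e'.
Qed.

Lemma boundary1 y : normc y < 1 ->
  boundary_conditions (fun _ : DT y => 1 : 'M[R[i]]_4).
Proof.
move=> y1.
have m0 : 0 <= xmax y by apply: divr_ge0 => //; rewrite subr_ge0 ltW.
have q0 : (0 : R) <= 1 / 2 by exact: divr_ge0.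
have n1 : normc (1 : R[i]) = 1 by exact: normc1.
have h0 : 0 <= (0 : R) <= 1 / 2 by rewrite q0 lexx.
have h2 : 0 <= (1 / 2 : R) <= 1 / 2 by rewrite q0 lexx.
have k0 : 0 <= (0 : R) <= xmax y by rewrite m0 lexx.
have kM : 0 <= xmax y <= xmax y by rewrite lexx m0.
split=> [x2 p1 p2 hx|x1 p1 p2 hx|x2 p1 p2 hx|x1 p1 p2 hx hp];
  rewrite !at_pt_cst ?normc_expi //.
- split=> //; exists 1%:M; apply/matrixP => k l; rewrite !mxE -natrM mulnb.
  congr (_%:R); congr nat_of_bool; rewrite -(can_eq (@mxtens_unindexK 2 2)).
  by case: (@mxtens_unindex 2 2 k) (@mxtens_unindex 2 2 l) => a b [c d].
- exists 1%:M, 1%:M; rewrite -scalar_mx_block -[RHS](nu2_unitary p2).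
  by congr (_ *m _); exact: mulmx1.
Qed.

Definition model_pred y : pred (DT y -> 'M[R[i]]_4) :=
  [pred f | `[< continuous f /\ boundary_conditions f >]].

Lemma model_predP y (f : DT y -> 'M[R[i]]_4) :
  reflect (continuous f /\ boundary_conditions f) (f \in @model_pred y).
Proof. exact: asboolP. Qed.

Lemma mulmx_conjU (U V M N : 'M[R[i]]_4) : V *m U = 1%:M ->
  U *m (M *m N) *m V = (U *m M *m V) *m (U *m N *m V).
Proof. by move=> VU; rewrite -!mulmxA (mulmxA V) VU mul1mx. Qed.

Lemma model_subring y : normc y < 1 -> subring_closed (@model_pred y).
Proof.
move=> y1; split.
- apply/model_predP; split; last exact: boundary1.
  exact: cst_continuous.
- move=> f g /model_predP[cf bf] /model_predP[cg bg].
  apply/(model_predP (fun p => f p - g p)).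
  split.
    apply: continuous_mxB.
    exact: cf.
    exact: cg.
  apply: (boundary_op2 (op := fun M N => M - N)) => //.
  + by rewrite subr0.
  + move=> A B; exists (A - B); apply/matrixP => i j; rewrite !mxE.
    by rewrite mulrBl.
  + move=> A B A' B'; exists (A - A'), (B - B').
    by rewrite (@opp_block_mx _ 2 2 2 2) (@add_block_mx _ 2 2 2 2) !subr0.
  + by move=> phi M N; rewrite mulmxBr mulmxBl.
- move=> f g /model_predP[cf bf] /model_predP[cg bg].
  apply/(model_predP (fun p => f p *m g p)).
  split.
    apply: continuous_mxM.
    exact: cf.
    exact: cg.
  apply: (boundary_op2 (op := fun M N => M *m N) _ _ _ _ bf bg).
  + by rewrite mulmx0.
  + move=> A B; exists (A *m B).
    by rewrite (@tensmx_mul R[i] 2 2 2 2 2 2) mulmx1.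
  + move=> A B A' B'; exists (A *m A'), (B *m B').
    rewrite (@mulmx_block R[i] 2 2 2 2 2 2).
    by rewrite !mul0mx !mulmx0 !addr0 !add0r.
  + by move=> phi M N; apply: mulmx_conjU; exact: mulmx1C (nu2_unitary phi).
Qed.

Lemma model_scale y (c : R[i]) (f : DT y -> 'M[R[i]]_4) :
  f \in @model_pred y -> c *: f \in @model_pred y.
Proof.
move=> /model_predP[cf bf]; apply/(model_predP (fun p => c *: f p)).
split; first exact: continuous_mxZ.
apply: (boundary_op1 (op := fun M => c *: M)) => //.
- by rewrite scaler0.
- by move=> A; exists (c *: A); apply/matrixP => i j; rewrite !mxE mulrA.
- by move=> A B; exists (c *: A), (c *: B); rewrite (@scale_block_mx _ 2 2 2 2) !scaler0.
- by move=> phi M; rewrite -scalemxAr -scalemxAl.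
Qed.

Lemma model_star y (f : DT y -> 'M[R[i]]_4) :
  f \in @model_pred y -> (fun p => star (f p)) \in @model_pred y.
Proof.
move=> /model_predP[cf bf]; apply/(model_predP (fun p => (f p) ^t*)).
split; first exact: continuous_mx_star.
apply: (boundary_op1 (op := fun M => M ^t*)) => //.
- by rewrite trmx0 map_mx0.
- by move=> A; exists (A ^t*); exact: tens_star.
- by move=> A B; exists (A ^t*), (B ^t*); exact: block_star.
- by move=> phi M; exact: mx_star_conj.
Qed.

(* The hypothesis on y makes D_y nonempty, hence the algebra nonzero. *)
Record model y (y01 : 0 < normc y < 1) := Model {
  model_val :> DT y -> 'M[R[i]]_4;
  model_valP : model_val \in @model_pred y
}.

End model_theory.

Section model_algebra.
Variables (R : realType) (y : R[i]) (y01 : 0 < normc y < 1).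
Local Notation M := (model y01).

HB.instance Definition _ := [isSub of M for @model_val R y y01].
HB.instance Definition _ := [Choice of M by <:].

Let y1 : normc y < 1. Proof. by case/andP: y01. Qed.

HB.instance Definition _ :=
  GRing.SubChoice_isSubPzRing.Build _ (@model_pred R y) M (model_subring y1).

Let model_oner_neq0 : (1 : M) != 0.
Proof.
have d0 : DT y (0, 0, 1, 1).
  have n1 : normc (1 : R[i]) = 1 by exact: normc1.
  split=> //=; rewrite lexx divr_ge0 // subr_ge0; exact: ltW.
pose v : DT y := SigSub (mem_set d0).
apply/eqP => /(congr1 (fun f : M => model_val f v)).
by move/eqP; apply/negP; exact: (oner_neq0 'M[R[i]]_4).
Qed.

HB.instance Definition _ := GRing.PzSemiRing_isNonZero.Build M model_oner_neq0.

Let model_scaleM (c : R[i]) (f : M) : M := Model y01 (model_scale c (model_valP f)).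

Let model_scalerA a b (f : M) :
  model_scaleM a (model_scaleM b f) = model_scaleM (a * b) f.
Proof. by apply: val_inj; exact: (scalerA a b (val f)). Qed.

Let model_scale1r : left_id 1 model_scaleM.
Proof. by move=> f; apply: val_inj; exact: (scale1r (val f)). Qed.

Let model_scalerDr : right_distributive model_scaleM +%R.
Proof. by move=> c f g; apply: val_inj; exact: (scalerDr c (val f) (val g)). Qed.

Let model_scalerDl (f : M) : {morph model_scaleM^~ f : a b / a + b}.
Proof. by move=> a b; apply: val_inj; exact: (scalerDl (val f) a b). Qed.

HB.instance Definition _ := GRing.Zmodule_isLmodule.Build R[i] M
  model_scalerA model_scale1r model_scalerDr model_scalerDl.

Let model_scalerAl (c : R[i]) (f g : M) : c *: (f * g) = (c *: f) * g.
Proof.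
by apply: val_inj; apply/funext => p; exact: (scalerAl c (val f p) (val g p)).
Qed.

HB.instance Definition _ := GRing.Lmodule_isLalgebra.Build R[i] M model_scalerAl.

Let model_scalerAr (c : R[i]) (f g : M) : c *: (f * g) = f * (c *: g).
Proof.
by apply: val_inj; apply/funext => p; exact: (scalerAr c (val f p) (val g p)).
Qed.

HB.instance Definition _ := GRing.Lalgebra_isAlgebra.Build R[i] M model_scalerAr.

Definition model_starM (f : M) : M := Model y01 (model_star (model_valP f)).

Let model_starK : involutive model_starM.
Proof.
by move=> f; apply: val_inj; apply/funext => p; exact: (starK (val f p)).
Qed.

Let model_starD : {morph model_starM : f g / f + g}.
Proof.
move=> f g; apply: val_inj; apply/funext => p.
exact: (starD (val f p) (val g p)).
Qed.

Let model_starZ (c : R[i]) f : model_starM (c *: f) = Num.conj c *: model_starM f.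
Proof.
by apply: val_inj; apply/funext => p; exact: (starZ c (val f p)).
Qed.

Let model_starMr f g : model_starM (f * g) = model_starM g * model_starM f.
Proof.
by apply: val_inj; apply/funext => p; exact: (starM (val f p) (val g p)).
Qed.

HB.instance Definition _ := Algebra_hasStar.Build R[i] M
  model_starK model_starD model_starZ model_starMr.

Lemma model_oneE p : (1 : M) p = 1.
Proof. by []. Qed.

Lemma model_addE (f g : M) p : (f + g) p = f p + g p.
Proof. by []. Qed.

Lemma model_mulE (f g : M) p : (f * g) p = f p * g p.
Proof. by []. Qed.

Lemma model_scaleE (c : R[i]) (f : M) p : (c *: f) p = c *: f p.
Proof. by []. Qed.

Lemma model_starE (f : M) p : star f p = (f p) ^t*.
Proof. by []. Qed.

End model_algebra.

(* Main.v *)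
Require Import Defs.
From HB Require Import structures.
From mathcomp Require Import all_boot all_order all_algebra finmap generic_quotient.
From mathcomp Require Import all_classical all_reals.
From mathcomp Require Import topology normedtype sequences derive realfun trigo.
From mathcomp Require Import complex mxtens.
From mathcomp Require Import ring lra.

(** The quotients by C*-seminorms need not be complete. Only two facts are carried over to them: a
    self-adjoint element with square 0 vanishes, and a real scalar that is the square of a
    self-adjoint element is nonnegative. These facts produce the parameters. If w^2 = c and {w, w^*}
    = k, a rotated real part of w has square k - 2|c|. Hence |c| <= k/2, and for k = 1 one can write
    |c| = sqrt(x(1-x)) with x in [0, 1/2]; at x = 1/2 the element w is a multiple of a unitary. The
    anticommuting remainder of b2 has {bt, bt^*} = 1 - |y|^2/(1-2 x1)^2, and its nonnegativity is
    the bound x1 <= (1-|y|)/2 that defines D_y. On the faces x1 = (1-|y|)/2 and x2 = 1/2 the second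
    factor degenerates, so the fibre map is multiplicative only on the admissible boundary values
    and extends to M_4 merely linearly. It is therefore first bounded by an unknown constant, which
    is then removed by passing to powers of f^* f. No free *-algebra is formed: a *-polynomial is
    handled as a pair of its values in two algebras. *)

(* The squares of the generators are central.  In any C*-algebra with the
   relations, the norm of an element is attained at some joint value of the two
   squares, that is, in a quotient by a C*-seminorm where both squares are
   scalars.  There b1, and the part of b2 that anticommutes with b1 and b1^*,
   are up to scaling two anticommuting weighted fermions, so b1 and b2 are the
   images of
     a1 = alpha(x1, z1) (x) 1,
     a2 = (r alpha + s alpha^* )(x1, z1) (x) 1 + kappa sigma_z (x) alpha(x2, z2)^T
   for some point of D_y x T^2.  Hence a *-polynomial in b1, b2 has norm at most
   the sup norm of the corresponding element of the model.  The values of the two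
   squares separate D_y x T^2 exactly up to the identifications made by the
   boundary conditions, so a partition of unity in them shows that the
   *-polynomials are dense in the model, which is therefore universal.

   If |y| = 1, then v = a1 - y a2^* satisfies v^* v + v v^* = 0, so v = 0 and a2
   is a fermion, which generates a copy of M_2. *)

Set Implicit Arguments.
Unset Strict Implicit.
Unset Printing Implicit Defensive.

Import Order.TTheory GRing.Theory Num.Theory.
Import numFieldNormedType.Exports.
Import ComplexField.Normc.

Local Open Scope quotient_scope.
Local Open Scope classical_set_scope.
Local Open Scope ring_scope.
Local Open Scope complex_scope.
Local Open Scope sesquilinear_scope.

(** * Elementary theory of C*-algebras *)

Lemma normc_real (R : realType) (r : R) : normc r%:C = `|r|.
Proof. by rewrite /= expr0n addr0 sqrtr_sqr. Qed.

Lemma normc_conj (R : realType) (c : R[i]) : normc (Num.conj c) = normc c.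
Proof. by apply: complexI; exact: norm_conjC. Qed.

Lemma conj_real (R : realType) (r : R) : Num.conj (r%:C : R[i]) = r%:C.
Proof. by apply/CrealP/complex_realP; exists r. Qed.

Lemma normc_ge0 (R : realType) (c : R[i]) : 0 <= normc c.
Proof. by case: c => a b; exact: sqrtr_ge0. Qed.

Section star_theory.
Variables (C : numClosedFieldType) (A : starAlgType C).
Implicit Types a b : A.

Lemma star0 : star (0 : A) = 0.
Proof. by apply: (addrI (star 0)); rewrite -starD !addr0. Qed.

Lemma starN a : star (- a) = - star a.
Proof. by apply: (addrI (star a)); rewrite -starD !subrr star0. Qed.

Lemma starB a b : star (a - b) = star a - star b.
Proof. by rewrite starD starN. Qed.

Lemma star1 : star (1 : A) = 1.
Proof. by rewrite -[star 1]mulr1 -{2}[1 : A]starK -starM mulr1 starK. Qed.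

Lemma starX a n : star (a ^+ n) = star a ^+ n.
Proof.
by elim: n => [|n IH]; rewrite ?expr0 ?star1 // exprS starM IH -exprSr.
Qed.

Lemma commr_alg a (c : C) : GRing.comm a c%:A.
Proof. exact: commr_sym (comm_alg c a). Qed.

End star_theory.

Section cstar_theory.
Variables (R : realType) (A : cstarAlgType R).
Implicit Types (a b h k : A) (r s t : R).

Lemma cnorm0 : cnorm (0 : A) = 0.
Proof. by rewrite -(scale0r (0 : A)) cnormZ normc0 mul0r. Qed.

Lemma cnormZr r a : cnorm (r%:C *: a) = `|r| * cnorm a.
Proof. by rewrite cnormZ normc_real. Qed.

Lemma cnormN a : cnorm (- a) = cnorm a.
Proof.
have -> : - a = (- 1 : R)%:C *: a by rewrite rmorphN rmorph1 scaleN1r.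
by rewrite cnormZr normrN1 mul1r.
Qed.

Lemma cnorm_ge0 a : 0 <= cnorm a.
Proof. by have := cnormD_le a (- a); rewrite subrr cnorm0 cnormN; lra. Qed.

Lemma cnormBC a b : cnorm (a - b) = cnorm (b - a).
Proof. by rewrite -cnormN opprB. Qed.

Lemma cnormB_le a b : cnorm (a - b) <= cnorm a + cnorm b.
Proof. by rewrite -(cnormN b); exact: cnormD_le. Qed.

Lemma cnorm_star_le a : cnorm a <= cnorm (star a).
Proof.
have [|a0] := leP (cnorm a) 0; first by move=> /le_trans; apply; exact: cnorm_ge0.
by rewrite -(ler_pM2r a0) -expr2 -cnorm_starM; exact: cnormM_le.
Qed.

Lemma cnorm_star a : cnorm (star a) = cnorm a.
Proof. by apply/le_anti; rewrite cnorm_star_le -{2}[a]starK cnorm_star_le. Qed.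

Lemma cnorm1 : cnorm (1 : A) = 1.
Proof.
have := cnorm_starM (1 : A); rewrite star1 mulr1 expr2.
have [/cnorm0_eq0/eqP|n0] := eqVneq (cnorm (1 : A)) 0; first by rewrite oner_eq0.
by move=> h; apply: (mulfI n0); rewrite -h mulr1.
Qed.

Lemma cnormX a n : cnorm (a ^+ n) <= cnorm a ^+ n.
Proof.
elim: n => [|n IH]; first by rewrite !expr0 cnorm1.
rewrite !exprS; apply: le_trans (cnormM_le _ _) _.
by rewrite ler_wpM2l // cnorm_ge0.
Qed.

Lemma cnorm_sqr h : star h = h -> cnorm (h ^+ 2) = cnorm h ^+ 2.
Proof. by move=> sh; rewrite -cnorm_starM sh -expr2. Qed.

(** Convergence is spelled out with real epsilons because [cnorm] is a bare function with no
    topology attached to the algebra. *)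
Definition clim (u : nat -> A) l :=
  forall e : R, 0 < e -> exists N, forall n, (N <= n)%N -> cnorm (u n - l) < e.

Lemma cauchy_clim (u : nat -> A) :
  (forall e : R, 0 < e -> exists N, forall m n, (N <= m)%N -> (N <= n)%N ->
     cnorm (u m - u n) < e) -> exists l, clim u l.
Proof.
move=> cu; have [|l /cvgrPdist_lt ul] := @cnorm_complete R A u.
  move=> e /cu[N hN]; exists ([set m | (N <= m)%N], [set m | (N <= m)%N]).
    by split; exists N.
  by move=> [m n] [/= hm hn]; exact: hN.
exists l => e /ul[N _ hN]; exists N => n /hN /=.
by rewrite sub0r normrN ger0_norm ?cnorm_ge0.
Qed.

Lemma clim_unique u l l' : clim u l -> clim u l' -> l = l'.
Proof.
move=> ul ul'; apply/eqP; rewrite -subr_eq0; apply/eqP/cnorm0_eq0/le_anti.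
rewrite cnorm_ge0 andbT; apply/ler_addgt0Pl => e e0; rewrite addr0.
have e2 : 0 < e / 2 by lra.
have [N hN] := ul _ e2; have [N' hN'] := ul' _ e2.
have := hN _ (leq_maxl N N'); have := hN' _ (leq_maxr N N').
set n := maxn N N'; rewrite [cnorm (u n - l)]cnormBC => h1 h2.
rewrite -(subrKA (u n)); apply: le_trans (cnormD_le _ _) _; lra.
Qed.

Lemma clim_cst l : clim (fun=> l) l.
Proof. by move=> e e0; exists 0%N => n _; rewrite subrr cnorm0. Qed.

Lemma climD u v l m : clim u l -> clim v m -> clim (fun n => u n + v n) (l + m).
Proof.
move=> ul vm e e0; have e2 : 0 < e / 2 by lra.
have [N hN] := ul _ e2; have [N' hN'] := vm _ e2.
exists (maxn N N') => n; rewrite geq_max => /andP[/hN h1 /hN' h2].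
rewrite opprD addrACA; apply: le_lt_trans (cnormD_le _ _) _; lra.
Qed.

(** The common source of the continuity of the operations below: each of them is Lipschitz along the
    sequence. The constant may have any sign, since [|K| + 1] is used. *)
Lemma clim_lip u v l m (K : R) : (forall n, cnorm (v n - m) <= K * cnorm (u n - l)) ->
  clim u l -> clim v m.
Proof.
move=> uv ul e e0; have K0 : 0 < `|K| + 1 by rewrite ltr_wpDl.
have [N hN] := ul _ (divr_gt0 e0 K0); exists N => n /hN.
rewrite ltr_pdivlMr // => h; apply: le_lt_trans h; apply: le_trans (uv n) _.
rewrite mulrC ler_wpM2l ?cnorm_ge0 //; have := ler_norm K; lra.
Qed.

Lemma clim_star u l : clim u l -> clim (fun n => star (u n)) (star l).
Proof.
by apply: (@clim_lip _ _ _ _ 1) => n; rewrite -starB cnorm_star mul1r.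
Qed.

Lemma climZ c u l : clim u l -> clim (fun n => c *: u n) (c *: l).
Proof.
by apply: (@clim_lip _ _ _ _ (normc c)) => n; rewrite -scalerBr cnormZ.
Qed.

Lemma climMl a u l : clim u l -> clim (fun n => a * u n) (a * l).
Proof.
by apply: (@clim_lip _ _ _ _ (cnorm a)) => n; rewrite -mulrBr cnormM_le.
Qed.

Lemma climMr a u l : clim u l -> clim (fun n => u n * a) (l * a).
Proof.
by apply: (@clim_lip _ _ _ _ (cnorm a)) => n; rewrite -mulrBl [X in _ <= X]mulrC cnormM_le.
Qed.

Lemma climN u l : clim u l -> clim (fun n => - u n) (- l).
Proof.
by apply: (@clim_lip _ _ _ _ 1) => n; rewrite -opprD cnormN mul1r.
Qed.

Lemma clim_sqr u l (K : R) : (forall n, cnorm (u n) <= K) -> clim u l ->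
  clim (fun n => u n ^+ 2) (l ^+ 2).
Proof.
move=> uK; apply: (@clim_lip _ _ _ _ (K + cnorm l)) => n.
have -> : u n ^+ 2 - l ^+ 2 = u n * (u n - l) + (u n - l) * l.
  by rewrite mulrBr mulrBl !expr2 addrA subrK.
apply: le_trans (cnormD_le _ _) _; rewrite [leRHS]mulrDl lerD //.
  by apply: le_trans (cnormM_le _ _) _; rewrite ler_wpM2r // cnorm_ge0.
by apply: le_trans (cnormM_le _ _) _; rewrite [leLHS]mulrC.
Qed.

Lemma clim_shift u l : clim u l -> clim (fun n => u n.+1) l.
Proof. by move=> ul e /ul[N hN]; exists N => n h; apply: hN; exact: leqW. Qed.

Lemma clim_le u l (K : R) : (forall n, cnorm (u n) <= K) -> clim u l -> cnorm l <= K.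
Proof.
move=> uK ul; apply/ler_addgt0Pl => e /ul[N /(_ _ (leqnn N))].
rewrite cnormBC => h; rewrite -[l](subrK (u N)).
by apply: le_trans (cnormD_le _ _) _; rewrite lerD // ltW.
Qed.

Lemma expr_lt_eps (K r e : R) : 0 <= r < 1 -> 0 < e -> exists N, K * r ^+ N < e.
Proof.
move=> /andP[r0 r1] e0.
have : K * r ^+ n @[n --> \oo] --> K * 0.
  by apply: cvgM; [exact: cvg_cst|apply: cvg_expr; rewrite ger0_norm].
rewrite mulr0 => /cvgrPdist_lt/(_ _ e0)[N _ /(_ N (leqnn N))] /=.
by rewrite sub0r normrN => h; exists N; apply: le_lt_trans h; exact: ler_norm.
Qed.

Lemma clim_geom (u : nat -> A) (r K : R) : 0 <= r < 1 ->
  (forall n, cnorm (u n.+1 - u n) <= K * r ^+ n) -> exists l, clim u l.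
Proof.
move=> /andP[r0 r1] uK; have r1' : 0 < 1 - r by lra.
have K0 : 0 <= K by have := uK 0%N; rewrite expr0 mulr1; apply: le_trans; exact: cnorm_ge0.
have key m j : cnorm (u (m + j)%N - u m) <= K / (1 - r) * (r ^+ m - r ^+ (m + j)).
  elim: j => [|j IH]; first by rewrite addn0 !subrr cnorm0 mulr0.
  rewrite addnS -(subrKA (u (m + j)%N)); apply: le_trans (cnormD_le _ _) _.
  apply: le_trans (lerD (uK _) IH) _.
  rewrite exprS; set a := r ^+ (m + j); set b := r ^+ m.
  rewrite le_eqVlt; apply/orP; left; apply/eqP; field; lra.
apply: cauchy_clim => e e0.
have e2 : 0 < e / 2 by lra.
have [N hN] := expr_lt_eps (K / (1 - r)) (introT andP (conj r0 r1)) e2.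
have close n : (N <= n)%N -> cnorm (u n - u N) < e / 2.
  move=> /subnKC <-; apply: le_lt_trans (key _ _) _; apply: le_lt_trans hN.
  apply: ler_wpM2l; first by apply: divr_ge0 => //; exact: ltW.
  by rewrite lerBlDr lerDl exprn_ge0.
exists N => m n /close hm /close hn; rewrite -(subrKA (u N)).
by apply: le_lt_trans (cnormD_le _ _) _; rewrite [cnorm (u N - _)]cnormBC; lra.
Qed.

Definition cinvertible a := exists g, a * g = 1 /\ g * a = 1.

(** The inverse is the limit of the partial sums of the geometric series, generated here by
    iterating w |-> 1 + a w from 0; the limit is a fixed point of this map. *)
Lemma neumann a : cnorm a < 1 -> cinvertible (1 - a).
Proof.
move=> a1; pose u n := iter n (fun w => 1 + a * w) 0.
have uS n : u n.+1 = 1 + a * u n by [].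
have [l ul] : exists l, clim u l.
  apply: (@clim_geom u (cnorm a) 1); first by rewrite cnorm_ge0.
  move=> n; rewrite mul1r; elim: n => [|n IH].
    by rewrite uS /u /= mulr0 addr0 subr0 cnorm1.
  rewrite [u n.+2]uS {2}uS opprD addrACA subrr add0r -mulrBr exprS.
  by apply: le_trans (cnormM_le _ _) _; rewrite ler_wpM2l // cnorm_ge0.
have comm n : a * u n = u n * a.
  by elim: n => [|n IH]; rewrite ?mulr0 ?mul0r // uS mulrDr mulrDl IH mulr1 mul1r mulrA IH.
have lE : l = 1 + a * l.
  apply: (clim_unique (clim_shift ul)).
  exact: climD (clim_cst 1) (climMl a ul).
have la : a * l = l * a.
  have h := climMr a ul; apply: (clim_unique (climMl a ul)).
  by move=> e /h[N hN]; exists N => n /hN; rewrite comm.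
exists l; split; first by rewrite mulrBl mul1r {1}lE addrK.
by rewrite mulrBr mulr1 -la {1}lE addrK.
Qed.

(** A fixed point l of w |-> (h + w^2)/2 satisfies (1 - l)^2 = 1 - h. The iterates from 0 are
    polynomials in h with real coefficients, so the root is self-adjoint and commutes with whatever
    commutes with h. *)
Lemma csqrt h : star h = h -> cnorm h < 1 ->
  exists k, [/\ star k = k, k ^+ 2 = 1 - h &
    forall b, GRing.comm b h -> GRing.comm b k].
Proof.
move=> sh h1; pose hf : R := 2^-1.
pose u n := iter n (fun w => hf%:C *: (h + w ^+ 2)) 0.
have uS n : u n.+1 = hf%:C *: (h + u n ^+ 2) by [].
(* The smaller root of r = (|h| + r^2)/2. It bounds all iterates, and being below 1 it is also the
   contraction ratio of their increments. *)
pose r := 1 - Num.sqrt (1 - cnorm h).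
have nh0 := cnorm_ge0 h.
have [s0 s1 r2] : [/\ 0 < Num.sqrt (1 - cnorm h), Num.sqrt (1 - cnorm h) <= 1 &
    cnorm h + r ^+ 2 = 2 * r].
  split; first by rewrite sqrtr_gt0 subr_gt0.
    by rewrite -[X in _ <= X]sqrtr1 ler_sqrt //; lra.
  have := @sqr_sqrtr _ (1 - cnorm h); rewrite subr_ge0 => /(_ (ltW h1)).
  rewrite /r !expr2; nra.
have r0 : 0 <= r by rewrite /r; lra.
have r1 : r < 1 by rewrite /r; lra.
have ur n : cnorm (u n) <= r.
  elim: n => [|n IH]; first by rewrite cnorm0.
  rewrite uS cnormZr; apply: le_trans (ler_wpM2l _ (cnormD_le _ _)) _ => //.
  have : cnorm (u n ^+ 2) <= r ^+ 2.
    by apply: le_trans (cnormX _ _) _; rewrite lerXn2r ?nnegrE ?cnorm_ge0.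
  rewrite /hf ger0_norm; lra.
have [l ul] : exists l, clim u l.
  apply: (@clim_geom u r 1); first by rewrite r0.
  move=> n; rewrite mul1r; elim: n => [|n IH].
    by rewrite expr0 subr0; exact: le_trans (ur 1%N) (ltW r1).
  rewrite [u n.+2]uS {2}uS -scalerBr opprD addrACA subrr add0r cnormZr.
  have -> : u n.+1 ^+ 2 - u n ^+ 2 = u n.+1 * (u n.+1 - u n) + (u n.+1 - u n) * u n.
    by rewrite mulrBr mulrBl !expr2 addrA subrK.
  apply: le_trans (ler_wpM2l _ (cnormD_le _ _)) _ => //.
  have h2 := cnormM_le (u n.+1) (u n.+1 - u n).
  have h3 := cnormM_le (u n.+1 - u n) (u n).
  have := ler_pM (cnorm_ge0 _) (cnorm_ge0 _) (ur n.+1) IH.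
  have := ler_pM (cnorm_ge0 _) (cnorm_ge0 _) IH (ur n).
  rewrite exprS /hf ger0_norm //; lra.
have uE : l = hf%:C *: (h + l ^+ 2).
  apply: (clim_unique (clim_shift ul)).
  by apply: climZ; apply: climD; [exact: clim_cst|exact: clim_sqr ur ul].
have su n : star (u n) = u n.
  elim: n => [|n IH]; first exact: star0.
  by rewrite uS starZ conj_real starD sh starX IH.
exists (1 - l); split.
- rewrite starB star1; congr (_ - _); have h2 := clim_star ul.
  apply: (clim_unique _ ul) => e /h2[N hN]; exists N => n /hN; by rewrite su.
- have -> : (1 - l) ^+ 2 = 1 - 2%:R *: l + l ^+ 2.
    by rewrite expr2 mulrBl mul1r mulrBr mulr1 -expr2 scaler_nat mulr2n opprB opprD !addrA addrAC.
  rewrite {1}uE scalerA.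
  have -> : 2%:R * hf%:C = 1 :> R[i].
    by rewrite /hf fmorphV rmorph_nat divff // pnatr_eq0.
  by rewrite scale1r opprD addrA subrK.
- move=> b bh; apply: commrB; first exact: commr1.
  have comm n : b * u n = u n * b.
    elim: n => [|n IH]; first by rewrite mulr0 mul0r.
    by rewrite uS -scalerAr -scalerAl; congr (_ *: _); apply: commrD => //; apply: commrX.
  have h2 := climMr b ul; apply: (clim_unique (climMl b ul)).
  by move=> e /h2[N hN]; exists N => n /hN; rewrite comm.
Qed.

End cstar_theory.

(** * Positive elements and the spectral bound *)

Section cstar_order.
Variables (R : realType) (A : cstarAlgType R).
Implicit Types (a b h k : A) (r s t : R).

Lemma cinvertible1 : cinvertible (1 : A).
Proof. by exists 1; rewrite mulr1. Qed.

Lemma cinvertibleM a b : cinvertible a -> cinvertible b -> cinvertible (a * b).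
Proof.
move=> [g [ag ga]] [h [bh hb]]; exists (h * g).
by rewrite mulrA -(mulrA a) bh mulr1 ag -mulrA (mulrA g) ga mul1r hb.
Qed.

Lemma cinvertibleZ (c : R[i]) a : c != 0 -> cinvertible a -> cinvertible (c *: a).
Proof.
move=> c0 [g [ag ga]]; exists (c^-1 *: g).
by rewrite -!scalerAl -!scalerAr !scalerA ag ga mulfV // mulVf // scale1r.
Qed.

Lemma cinvertible_comm a b : GRing.comm a b -> cinvertible (a * b) -> cinvertible a.
Proof.
move=> ab [g [h1 h2]].
have ra : a * (b * g) = 1 by rewrite mulrA.
have la : g * b * a = 1 by rewrite -mulrA -ab.
exists (b * g); split => //.
by rewrite -[b * g]mul1r -la -(mulrA (g * b)) ra mulr1.
Qed.

(** The element u = h + i k is normal with u^* u = r, so its norm is known from the C*-identity, and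
    h is its real part. This is the device that replaces the spectrum in the norm estimates
    below. *)
Lemma unit_pair h k r : star h = h -> star k = k -> GRing.comm h k ->
  h ^+ 2 + k ^+ 2 = r%:C%:A -> cnorm h ^+ 2 <= `|r|.
Proof.
move=> sh sk hk e; pose u := h + 'i *: k.
have su : star u = h - 'i *: k by rewrite starD starZ sh sk conjCi scaleNr.
have uu : star u * u = r%:C%:A.
  rewrite su /u mulrDr !mulrBl -!scalerAr -!scalerAl scalerA -[_ * 'i]expr2 sqrCi.
  by rewrite hk scaleN1r -!expr2 -e addrA opprK subrK.
have nu : cnorm u ^+ 2 = `|r| by rewrite -cnorm_starM uu cnormZr cnorm1 mulr1.
have : cnorm h <= cnorm u.
  have -> : h = (2^-1 : R)%:C *: (u + star u).
    rewrite su addrACA subrr addr0 -mulr2n -[h *+ 2]scaler_nat scalerA.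
    by rewrite fmorphV rmorph_nat mulVf ?pnatr_eq0 // scale1r.
  rewrite cnormZr ger0_norm //; have := cnormD_le u (star u); rewrite cnorm_star; lra.
by move=> hu; rewrite -nu; apply: lerXn2r; rewrite ?nnegrE ?cnorm_ge0.
Qed.

Lemma cnorm_subsqr h t : star h = h -> cnorm h ^+ 2 <= t ->
  cnorm (t%:C%:A - h ^+ 2) <= t.
Proof.
(* The square root of T - h^2 exists only under a strict inequality, hence the detour through T > t.
   That root and h then form a pair for [unit_pair], with the root in the first place. *)
move=> sh; suff key T : cnorm h ^+ 2 < T -> cnorm (T%:C%:A - h ^+ 2) <= T.
  move=> ht; apply/ler_addgt0Pl => e e0; have e2 : 0 < e / 2 by lra.
  have := key (t + e / 2); rewrite ltr_pwDr // => /(_ isT) h1.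
  have -> : t%:C%:A - h ^+ 2 = ((t + e / 2)%:C%:A - h ^+ 2) - (e / 2)%:C%:A.
    by rewrite rmorphD scalerDl [RHS]addrAC addrK.
  apply: le_trans (cnormB_le _ _) _; rewrite cnormZr cnorm1 ger0_norm; lra.
move=> hT; have T0 : 0 < T by apply: le_lt_trans hT; exact: sqr_ge0.
have cT : T%:C != 0 :> R[i] by rewrite fmorph_eq0 gt_eqF.
have [||k [sk k2 ck]] := @csqrt _ _ (T^-1%:C *: h ^+ 2).
- by rewrite starZ conj_real starX sh.
- rewrite cnormZr cnorm_sqr // ger0_norm ?invr_ge0 ?ltW //.
  by rewrite mulrC ltr_pdivrMr // mul1r.
have hk : GRing.comm h k.
  apply: ck; rewrite /GRing.comm -scalerAr -scalerAl -exprS -exprSr //.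
have e : (h ^+ 2) + ((Num.sqrt T)%:C *: k) ^+ 2 = T%:C%:A.
  rewrite exprZn k2 -rmorphXn /= sqr_sqrtr ?ltW // scalerBr scalerA -rmorphM /=.
  by rewrite divff ?gt_eqF // scale1r addrC subrK.
have s' : star ((Num.sqrt T)%:C *: k) = (Num.sqrt T)%:C *: k.
  by rewrite starZ conj_real sk.
rewrite -e addrAC subrr add0r cnorm_sqr // -[leRHS](gtr0_norm T0).
apply: (@unit_pair _ h) => //; last by rewrite addrC.
by rewrite /GRing.comm -scalerAr -scalerAl hk.
Qed.

(** For a self-adjoint element the inequality says that the spectrum lies in [0, 2t]. In this form
    sums are handled by the triangle inequality. *)
Definition cpos a := star a = a /\ exists t, cnorm (t%:C%:A - a) <= t.

Lemma cposD a b : cpos a -> cpos b -> cpos (a + b).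
Proof.
move=> [sa [t ta]] [sb [s hs]]; split; first by rewrite starD sa sb.
exists (t + s); rewrite rmorphD scalerDl opprD addrACA.
by apply: le_trans (cnormD_le _ _) _; rewrite lerD.
Qed.

Lemma cposZ a r : 0 <= r -> cpos a -> cpos (r%:C *: a).
Proof.
move=> r0 [sa [t ta]]; split; first by rewrite starZ conj_real sa.
exists (r * t); rewrite rmorphM -scalerA -scalerBr cnormZr ger0_norm //.
by rewrite ler_wpM2l.
Qed.

Lemma cpos_sqr h : star h = h -> cpos (h ^+ 2).
Proof.
move=> sh; split; first by rewrite starX sh.
by exists (cnorm h ^+ 2); apply: cnorm_subsqr.
Qed.

Lemma cpos1 : cpos (1 : A).
Proof. by rewrite -[1](expr1n _ 2); apply: cpos_sqr; rewrite star1. Qed.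

(** Adding r makes (t - a)/(t + r) a strict contraction, as [csqrt] demands; its root is rescaled by
    sqrt(t + r). *)
Lemma cpos_sqrt a r : cpos a -> 0 < r -> exists k, [/\ star k = k,
  k ^+ 2 = a + r%:C%:A & forall b, GRing.comm b a -> GRing.comm b k].
Proof.
move=> [sa [t ta]] r0; have t0 := le_trans (cnorm_ge0 _) ta.
have tr : 0 < t + r by lra.
have [||k [sk k2 ck]] := @csqrt _ _ ((t + r)^-1%:C *: (t%:C%:A - a)).
- by rewrite starZ starB starZ !conj_real sa star1.
- rewrite cnormZr ger0_norm ?invr_ge0 ?ltW //.
  by rewrite mulrC ltr_pdivrMr //; lra.
exists ((Num.sqrt (t + r))%:C *: k); split.
- by rewrite starZ conj_real sk.
- rewrite exprZn k2 -rmorphXn /= sqr_sqrtr ?ltW // scalerBr scalerA -rmorphM /=.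
  rewrite divff ?gt_eqF // scale1r rmorphD scalerDl opprB addrCA; congr (_ + _).
  by rewrite addrAC subrr add0r.
- move=> b ba; rewrite /GRing.comm -scalerAr -scalerAl; congr (_ *: _); apply: ck.
  rewrite /GRing.comm -scalerAr -scalerAl mulrBl mulrBr; congr (_ *: (_ - _)) => //.
  by rewrite -scalerAr -scalerAl mulr1 mul1r.
Qed.

(** The witness in [cpos] can thus be any bound of the norm. Up to e > 0 the element is a square
    k^2, to which [cnorm_subsqr] applies. *)
Lemma cpos_cnorm a t : cpos a -> cnorm a <= t -> cnorm (t%:C%:A - a) <= t.
Proof.
move=> pa at_; apply/ler_addgt0Pl => e e0.
have [k [sk k2 _]] := cpos_sqrt pa e0.
have : cnorm ((e + t)%:C%:A - k ^+ 2) <= e + t.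
  apply: cnorm_subsqr => //; rewrite -cnorm_sqr // k2.
  apply: le_trans (cnormD_le _ _) _; rewrite cnormZr cnorm1 ger0_norm; lra.
by rewrite k2 rmorphD scalerDl [e%:C%:A + _]addrC [a + _]addrC opprD addrA addrK.
Qed.

(** The shifted product (a + r)(b + r) is the square of the product of two commuting roots, hence
    positive; then r tends to 0. *)
Lemma cposM a b : cpos a -> cpos b -> GRing.comm a b -> cpos (a * b).
Proof.
move=> pa pb ab; split; first by rewrite starM pa.1 pb.1.
(* Bounds the shifted product for every r <= 1, so one witness serves during the whole limit. *)
pose T := (cnorm a + 1) * (cnorm b + 1).
have na := cnorm_ge0 a; have nb := cnorm_ge0 b.
exists T; apply/ler_addgt0Pl => e e0; pose K := cnorm a + cnorm b + 1.
have K0 : 0 < K by rewrite /K; lra.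
pose r := Num.min 1 (e / K); have r1 : r <= 1 by rewrite ge_min lexx.
have r0 : 0 < r by rewrite lt_min ltr01 divr_gt0.
have rK : r * K <= e by rewrite -ler_pdivlMr // ge_min lexx orbT.
have [k [sk k2 ck]] := cpos_sqrt pa r0.
have [l [sl l2 cl]] := cpos_sqrt pb r0.
have kl : GRing.comm k l.
  by apply: cl; apply: commr_sym; apply: ck; apply: commr_sym.
have E : (k * l) ^+ 2 = (a + r%:C%:A) * (b + r%:C%:A).
  by rewrite exprMn_comm // k2 l2.
have nr : cnorm (r%:C%:A : A) = r by rewrite cnormZr cnorm1 mulr1 gtr0_norm.
have pT : cnorm (T%:C%:A - (k * l) ^+ 2) <= T.
  apply: cpos_cnorm; first by apply: cpos_sqr; rewrite starM sk sl.
  rewrite E; apply: le_trans (cnormM_le _ _) _; apply: ler_pM; rewrite ?cnorm_ge0 //.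
    by apply: le_trans (cnormD_le _ _) _; rewrite nr lerD2l.
  by apply: le_trans (cnormD_le _ _) _; rewrite nr lerD2l.
have -> : T%:C%:A - a * b = (T%:C%:A - (k * l) ^+ 2) + ((k * l) ^+ 2 - a * b).
  by rewrite addrA subrK.
apply: le_trans (cnormD_le _ _) _; rewrite addrC lerD //; apply: le_trans rK.
have -> : (k * l) ^+ 2 - a * b = r%:C *: (a + b + r%:C%:A).
  rewrite E mulrDl !mulrDr -!scalerAl -!scalerAr !mulr1 !mul1r !scalerDr.
  by rewrite addrAC [a * b + _]addrC addrK addrA.
rewrite cnormZr gtr0_norm //; apply: ler_wpM2l; first exact: ltW.
apply: le_trans (cnormD_le _ _) _; rewrite nr.
by have := cnormD_le a b; rewrite /K; lra.
Qed.

Lemma cposX a n : cpos a -> cpos (a ^+ n).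
Proof.
move=> pa; elim: n => [|n IH]; first by rewrite expr0; exact: cpos1.
by rewrite exprS; apply: cposM => //; exact: commrX.
Qed.

(** The product (r - h)(r + h) = r^2 - h^2 is positive, so up to e it is a square k^2 and h^2 + k^2
    = r^2 + e; [unit_pair] concludes. *)
Lemma cpos_cnorm_le h r : 0 <= r -> star h = h ->
  cpos (r%:C%:A - h) -> cpos (r%:C%:A + h) -> cnorm h <= r.
Proof.
move=> r0 sh p1 p2.
have c1 : GRing.comm h (r%:C%:A) := commr_alg h _.
have pM : cpos ((r ^+ 2)%:C%:A - h ^+ 2).
  have -> : (r ^+ 2)%:C%:A - h ^+ 2 = (r%:C%:A - h) * (r%:C%:A + h).
    rewrite mulrDr !mulrBl -!scalerAl -!scalerAr !mul1r mulr1 scalerA expr2 rmorphM.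
    by rewrite addrA subrK expr2.
  apply: cposM => //; apply: commrD; apply: commr_sym; apply: commrB => //;
    first [exact: c1|exact: (commr_sym c1)|exact: commr_refl].
rewrite -(ler_pXn2r (ltn0Sn 1)) ?nnegrE ?cnorm_ge0 //.
apply/ler_addgt0Pl => e e0.
have [k [sk k2 ck]] := cpos_sqrt pM e0.
rewrite -[leRHS]ger0_norm; last by rewrite addr_ge0 ?sqr_ge0 ?ltW.
apply: (@unit_pair _ k) => //.
  by apply: ck; apply: commrB; [exact: commr_alg|apply: commrX].
by rewrite k2 addrA addrCA subrr addr0 rmorphD scalerDl addrC.
Qed.

(** Operator form of (1 + n k)(1 - k)^n <= 1. Passing from n to n + 1 adds the positive term (n + 1)
    k^2 (1 - k)^n. *)
Lemma cpos_bernoulli k n : cpos k -> cpos (1 - k) ->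
  cpos (1 - (1 + k *+ n) * (1 - k) ^+ n).
Proof.
move=> pk pk1; have ck : GRing.comm k (1 - k).
  by apply: commrB; [exact: commr1|].
elim: n => [|n IH].
  rewrite mulr0n addr0 expr0 mulr1 subrr; split; first exact: star0.
  by exists 0; rewrite scale0r subr0 cnorm0.
have -> : 1 - (1 + k *+ n.+1) * (1 - k) ^+ n.+1 =
    (1 - (1 + k *+ n) * (1 - k) ^+ n) + (n.+1%:R : R)%:C *: (k ^+ 2 * (1 - k) ^+ n).
  have -> : (1 + k *+ n.+1) * (1 - k) ^+ n.+1 =
      (1 + k *+ n - k ^+ 2 *+ n.+1) * (1 - k) ^+ n.
    rewrite exprS mulrA; congr (_ * _).
    by rewrite mulrDl mul1r mulrBr mulr1 mulrnAl -expr2 {1}[k *+ _]mulrS !addrA subrK.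
  rewrite rmorph_nat scaler_nat mulrBl mulrnAl.
  by rewrite opprB addrCA addrC.
apply: cposD => //; apply: cposZ; first exact: ler0n.
apply: cposM; [exact: cposX|exact: cposX|].
by apply: commr_sym; apply: commrX; apply: commr_sym; apply: commrX.
Qed.

(** The decay 1/n of k (1 - k)^n is what makes the spectral bound work and what forces [1 - e] to
    vanish after localization at [e]. *)
Lemma cpos_mulX_le k n : cpos k -> cpos (1 - k) ->
  cnorm (k * (1 - k) ^+ n) * n%:R <= 1.
Proof.
move=> pk pk1; have ck : GRing.comm k (1 - k).
  by apply: commrB; [exact: commr1|].
have pX := cposX n pk1.
have pM : cpos ((n%:R : R)%:C *: (k * (1 - k) ^+ n)).
  by apply: cposZ (ler0n _ _) _; apply: cposM => //; exact: commrX.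
rewrite mulrC -[n%:R](normr_nat R n) -cnormZr; apply: cpos_cnorm_le => //; first by case: pM.
- have -> : (1 : R)%:C%:A - (n%:R : R)%:C *: (k * (1 - k) ^+ n) =
      (1 - (1 + k *+ n) * (1 - k) ^+ n) + (1 - k) ^+ n.
    rewrite rmorph1 scale1r rmorph_nat scaler_nat -mulrnAl mulrDl mul1r.
    by rewrite opprD addrA addrAC subrK.
  by apply: cposD => //; exact: cpos_bernoulli.
- by rewrite rmorph1 scale1r; apply: cposD => //; exact: cpos1.
Qed.

Lemma cinvertible_sqrD h r : star h = h -> 0 < r -> cinvertible (h ^+ 2 + r%:C%:A).
Proof.
move=> sh r0; pose t := cnorm h ^+ 2; have t0 : 0 <= t by exact: sqr_ge0.
have tr : 0 < t + r by lra.
have -> : h ^+ 2 + r%:C%:A =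
    (t + r)%:C *: (1 - (t + r)^-1%:C *: (t%:C%:A - h ^+ 2)).
  rewrite scalerBr scalerA -rmorphM divff ?gt_eqF // scale1r rmorphD scalerDl.
  by rewrite opprB addrCA addrAC subrr add0r.
apply: cinvertibleZ; first by rewrite fmorph_eq0 gt_eqF.
apply: neumann; rewrite cnormZr ger0_norm ?invr_ge0 ?ltW // mulrC ltr_pdivrMr // mul1r.
by apply: le_lt_trans (cnorm_subsqr sh (lexx _)) _; rewrite ltrDl.
Qed.

Lemma cnorm_exp2 h n : star h = h -> cnorm (h ^+ (2 ^ n)) = cnorm h ^+ (2 ^ n).
Proof.
move=> sh; elim: n => [|n IH]; first by rewrite expr1.
by rewrite expnS mulnC !exprM cnorm_sqr ?IH // starX sh.
Qed.

(* If |h| > s, scale h to norm 1: an inverse of k = 1 - h^2 bounds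
   1 = |h^(2n)| by a multiple of |k (1 - k)^n| <= 1 / n, for n = 2^m. *)
Lemma cnorm_le_spectral h s : star h = h -> 0 <= s ->
  (forall r, s < r -> cinvertible ((r ^+ 2)%:C%:A - h ^+ 2)) -> cnorm h <= s.
Proof.
move=> sh s0 inv; rewrite leNgt; apply/negP => sm.
have m0 : 0 < cnorm h by exact: le_lt_trans sm.
have [g [_ gk]] := inv _ sm.
pose h1 := (cnorm h)^-1%:C *: h.
have sh1 : star h1 = h1 by rewrite starZ conj_real sh.
have nh1 : cnorm h1 = 1.
  by rewrite cnormZr ger0_norm ?invr_ge0 ?ltW // mulVf ?gt_eqF.
have pk1 : cpos (h1 ^+ 2) by exact: cpos_sqr.
have pk : cpos (1 - h1 ^+ 2).
  split; first by rewrite starB star1 starX sh1.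
  exists 1; rewrite rmorph1 scale1r opprB addrCA subrr addr0 cnorm_sqr // nh1 expr1n //.
have bnd n : 2 ^+ n <= cnorm ((cnorm h ^+ 2)%:C *: g).
  have := @cpos_mulX_le (1 - h1 ^+ 2) (2 ^ n) pk; rewrite opprB addrCA subrr addr0.
  move=> /(_ pk1) le1.
  have e : h1 ^+ 2 ^+ (2 ^ n) = ((cnorm h ^+ 2)%:C *: g) * ((1 - h1 ^+ 2) * h1 ^+ 2 ^+ (2 ^ n)).
    rewrite mulrA -scalerAl scalerAr scalerBr /h1 exprZn scalerA -rmorphXn -rmorphM /=.
    by rewrite exprVn divff ?scale1r ?gk ?mul1r // expf_neq0 // gt_eqF.
  have n1 : cnorm (h1 ^+ 2 ^+ (2 ^ n)) = 1.
    by rewrite -exprM -expnS cnorm_exp2 // nh1 expr1n.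
  have := cnormM_le ((cnorm h ^+ 2)%:C *: g) ((1 - h1 ^+ 2) * h1 ^+ 2 ^+ (2 ^ n)).
  rewrite -e n1 natrX in le1 *.
  have p2 : 0 < (2 : R) ^+ n by exact: exprn_gt0.
  have := cnorm_ge0 ((1 - h1 ^+ 2) * h1 ^+ 2 ^+ (2 ^ n)).
  have := cnorm_ge0 ((cnorm h ^+ 2)%:C *: g); nra.
have lt1 : 0 <= (2^-1 : R) < 1 by lra.
have [N] := @expr_lt_eps R (cnorm ((cnorm h ^+ 2)%:C *: g)) _ _ lt1 ltr01.
have p2 : 0 < (2 : R) ^+ N by exact: exprn_gt0.
rewrite exprVn ltr_pdivrMr // mul1r ltNge bnd //.
Qed.

End cstar_order.

(** If |h| < 1, the root k of 1 - h^2 satisfies f(h)^2 + f(k)^2 = 1, so |f(h)| <= 1 by [unit_pair].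
    The general case follows from scaling and the C*-identity. *)
Lemma cnorm_star_morphism (R : realType) (A B : cstarAlgType R)
    (f : {lrmorphism A -> B}) a :
  star_morphism f -> cnorm (f a) <= cnorm a.
Proof.
move=> sf.
have key h : star h = h -> cnorm h < 1 -> cnorm (f h) <= 1.
  move=> sh h1.
  have [||k [sk k2 ck]] := @csqrt _ _ (h ^+ 2).
  - by rewrite starX sh.
  - by rewrite cnorm_sqr // expr_lt1 ?cnorm_ge0.
  have hk : GRing.comm h k by apply: ck; exact: commrX.
  rewrite -(ler_pXn2r (ltn0Sn 1)) ?nnegrE ?cnorm_ge0 // expr1n -[leRHS]normr1.
  apply: (@unit_pair _ _ _ (f k)); rewrite -?sf ?sh ?sk //.
    by rewrite /GRing.comm -!rmorphM hk.
  by rewrite -!rmorphXn -rmorphD k2 addrCA subrr addr0 rmorph1 scale1r.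
have key2 h : star h = h -> cnorm (f h) <= cnorm h.
  move=> sh; apply/ler_addgt0Pl => e e0; have t0 : 0 < e + cnorm h.
    by have := cnorm_ge0 h; lra.
  have := key ((e + cnorm h)^-1%:C *: h).
  rewrite starZ conj_real sh linearZ /= !cnormZr gtr0_norm ?invr_gt0 //.
  rewrite mulrC ltr_pdivrMr // mul1r ltrDr mulrC ler_pdivrMr // mul1r.
  by apply.
rewrite -(ler_pXn2r (ltn0Sn 1)) ?nnegrE ?cnorm_ge0 // -!cnorm_starM -sf -rmorphM.
by apply: key2; rewrite starM starK.
Qed.

(** * Polynomials in a self-adjoint element *)

Section poly_calculus.
Variables (R : realType) (A : cstarAlgType R) (x : A) (L : R).
Hypotheses (sx : star x = x) (xL : cnorm x <= L).

(** The polynomial splits into linear factors. A real root lies outside [-L, L] and its factor is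
    inverted by a geometric series; for a root a + ib with b != 0 the factor divides the invertible
    element (x - a)^2 + b^2. *)
Lemma horner_alg_cinvertible (p : {poly R[i]}) :
  (forall t : R, - L <= t <= L -> p.[t%:C] != 0) -> cinvertible (horner_alg x p).
Proof.
move=> p0; have L0 : 0 <= L := le_trans (cnorm_ge0 x) xL.
have [r pr] := closed_field_poly_normal p.
have lp : lead_coef p != 0.
  rewrite lead_coef_eq0; apply: contra_neq (p0 0 _) => [->|]; last by lra.
  by rewrite horner0.
have rt z : z \in r -> root p z.
  by move=> zr; rewrite pr rootZ // root_prod_XsubC.
rewrite pr linearZ /= mulr_algl; apply: cinvertibleZ => //; rewrite rmorph_prod /= big_seq.
apply: (big_ind (@cinvertible _ A)); [exact: cinvertible1|exact: cinvertibleM|].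
move=> z /rt pz; rewrite rmorphB /= horner_algX horner_algC.
case: z pz => a b pz; have [b0|b0] := eqVneq b 0.
  have aL : L < `|a|.
    rewrite ltNge; apply/negP; rewrite ler_norml => /p0; rewrite -[a%:C]/(a +i* 0).
    by rewrite -b0 (rootP pz) eqxx.
  have a0 : a != 0 by rewrite -normr_gt0; exact: le_lt_trans aL.
  have -> : x - (a +i* b)%:A = (- a)%:C *: (1 - a^-1%:C *: x).
    have e : (- a)%:C * a^-1%:C = - 1 :> R[i].
      by rewrite rmorphN fmorphV mulNr divff // fmorph_eq0.
    by rewrite scalerBr scalerA e scaleN1r opprK addrC b0 rmorphN scaleNr.
  apply: cinvertibleZ; first by rewrite fmorph_eq0 oppr_eq0.
  apply: neumann; rewrite cnormZr normfV mulrC ltr_pdivrMr ?normr_gt0 // mul1r.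
  exact: le_lt_trans aL.
have e1 : (x - a%:C%:A) ^+ 2 + (b ^+ 2)%:C%:A = (x - (a +i* b)%:A) * (x - (a -i* b)%:A).
  (* Everything is expressed through c = a and d = a - ib, so that the factorization becomes a
     polynomial identity in commuting variables. *)
  have eD : (a +i* b) = 2 * a%:C - (a -i* b) :> R[i].
    by apply/eqP; rewrite eq_complex /=; apply/andP; split; apply/eqP; ring.
  have eM : (a ^+ 2 + b ^+ 2)%:C = (2 * a%:C - (a -i* b)) * (a -i* b) :> R[i].
    by apply/eqP; rewrite eq_complex /=; apply/andP; split; apply/eqP; ring.
  have -> : (b ^+ 2)%:C = (2 * a%:C - (a -i* b)) * (a -i* b) - a%:C ^+ 2 :> R[i].
    by rewrite -eM -rmorphXn -rmorphB; congr (_%:C); ring.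
  rewrite eD; move: (a%:C) (a -i* b) => c d.
  transitivity (horner_alg x (('X - c%:P) ^+ 2 + ((2 * c - d) * d - c ^+ 2)%:P)).
    by rewrite rmorphD rmorphXn rmorphB /= horner_algX !horner_algC.
  transitivity (horner_alg x (('X - (2 * c - d)%:P) * ('X - d%:P))); last first.
    rewrite rmorphM [X in X * _]rmorphB [X in _ * X]rmorphB /=.
    by rewrite horner_algX !horner_algC.
  congr (horner_alg x _).
  by rewrite !(rmorphM, rmorphB, rmorphXn, rmorph_nat) /=; ring.
apply: (@cinvertible_comm _ _ _ (x - (a -i* b)%:A)).
  apply: commrB; last exact: commr_alg.
  by apply: commr_sym; apply: commrB; [exact: commr_refl|exact: commr_alg].
rewrite -e1; apply: cinvertible_sqrD; last by rewrite exprn_even_gt0.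
by rewrite starB sx starZ conj_real star1.
Qed.

Definition phorner (p : {poly R}) : A := horner_alg x (map_poly (real_complex R) p).

Lemma phornerM p q : phorner (p * q) = phorner p * phorner q.
Proof. by rewrite /phorner !rmorphM. Qed.
Lemma phornerXn p n : phorner (p ^+ n) = phorner p ^+ n.
Proof. by rewrite /phorner !rmorphXn. Qed.
Lemma phornerB p q : phorner (p - q) = phorner p - phorner q.
Proof. by rewrite /phorner !rmorphB. Qed.
Lemma phornerC c : phorner c%:P = c%:C%:A.
Proof. by rewrite /phorner map_polyC horner_algC. Qed.
Lemma phornerZ c p : phorner (c *: p) = c%:C *: phorner p.
Proof. by rewrite /phorner map_polyZ linearZ /= mulr_algl. Qed.
Lemma phornerX : phorner 'X = x.
Proof. by rewrite /phorner map_polyX horner_algX. Qed.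
Lemma phorner_sum I r (P : pred I) (F : I -> {poly R}) :
  phorner (\sum_(i <- r | P i) F i) = \sum_(i <- r | P i) phorner (F i).
Proof. by rewrite /phorner !rmorph_sum. Qed.

Lemma phorner_star p : star (phorner p) = phorner p.
Proof.
elim/poly_ind: p => [|p c IH]; first by rewrite /phorner !rmorph0 star0.
have -> : phorner (p * 'X + c%:P) = phorner p * x + c%:C%:A.
  by rewrite -(phornerX) -phornerC /phorner !(rmorphD, rmorphM).
rewrite starD starM IH sx starZ conj_real star1; congr (_ + _).
by rewrite -phornerX -!phornerM mulrC.
Qed.

(** For r > 1 one has r^2 - g^2 = g^2 (r^2 p^2 - 1), and the last polynomial is positive on [-L, L];
    so all these elements are invertible and the spectral bound gives |g| <= 1. *)
Lemma phorner_inv p : (forall t, - L <= t <= L -> 1 <= p.[t]) ->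
  exists g, g * phorner p = 1 /\ cnorm g <= 1.
Proof.
move=> p1; have inv q : (forall t, - L <= t <= L -> 0 < q.[t]) -> cinvertible (phorner q).
  move=> q0; apply: horner_alg_cinvertible => t /q0 qt.
  by rewrite horner_map /= fmorph_eq0 gt_eqF.
have [|g [pg gp]] := inv p; first by move=> t /p1; lra.
have sg : star g = g.
  have : star g * phorner p = 1 by rewrite -phorner_star -starM pg star1.
  by move/(congr1 (fun u => u * g)); rewrite -mulrA pg mulr1 mul1r.
exists g; split => //; apply: cnorm_le_spectral => // r r1.
have -> : (r ^+ 2)%:C%:A - g ^+ 2 = g ^+ 2 * phorner (r ^+ 2 *: p ^+ 2 - 1).
  have cg : GRing.comm g (phorner p) by rewrite /GRing.comm gp pg.
  rewrite phornerB phornerZ phornerXn mulrBr -scalerAr -exprMn_comm // gp expr1n.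
  by congr (_ - _); rewrite -[X in phorner X]/(1%:P) phornerC rmorph1 scale1r mulr1.
have ig : cinvertible g by exists (phorner p).
rewrite expr2; apply: cinvertibleM; first exact: cinvertibleM.
apply: inv => t /p1 pt; rewrite hornerD hornerN hornerC hornerZ horner_exp subr_gt0.
rewrite -exprMn exprn_egt1 //; apply: (lt_le_trans r1).
by rewrite ler_peMr // ltW // (lt_trans ltr01).
Qed.

End poly_calculus.

(** * Localization of C*-seminorms at central elements *)

Record cseminorm (R : realType) (A : cstarAlgType R) (q : A -> R) : Prop := {
  csD : forall a b, q (a + b) <= q a + q b;
  csZ : forall c a, q (c *: a) = normc c * q a;
  csM : forall a b, q (a * b) <= q a * q b;
  csS : forall a, q (star a * a) = q a ^+ 2;
  csN : forall a, q a <= cnorm a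
}.

Lemma cseminorm_cnorm (R : realType) (A : cstarAlgType R) : cseminorm (@cnorm R A).
Proof.
split; [exact: cnormD_le|exact: cnormZ|exact: cnormM_le|exact: cnorm_starM|by []].
Qed.

Section cseminorm_theory.
Variables (R : realType) (A : cstarAlgType R) (q : A -> R).
Hypothesis (cq : cseminorm q).
Implicit Types (a b h : A).

Lemma cs0 : q 0 = 0.
Proof. by rewrite -(scale0r (0 : A)) (csZ cq) normc0 mul0r. Qed.

Lemma csOpp a : q (- a) = q a.
Proof.
have -> : - a = (- 1 : R)%:C *: a by rewrite rmorphN rmorph1 scaleN1r.
by rewrite (csZ cq) normc_real normrN1 mul1r.
Qed.

Lemma cs_ge0 a : 0 <= q a.
Proof. by have := csD cq a (- a); rewrite subrr cs0 csOpp; lra. Qed.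

Lemma cs_star a : q (star a) = q a.
Proof.
have le b : q b <= q (star b).
  have [|b0] := leP (q b) 0; first by move=> /le_trans; apply; exact: cs_ge0.
  by rewrite -(ler_pM2r b0) -expr2 -(csS cq); exact: csM.
by apply/le_anti; rewrite le -{2}[a]starK le.
Qed.

Lemma cs_sqr h : star h = h -> q (h ^+ 2) = q h ^+ 2.
Proof. by move=> sh; rewrite -(csS cq) sh -expr2. Qed.

Lemma cs_exp2 h n : star h = h -> q (h ^+ (2 ^ n)) = q h ^+ (2 ^ n).
Proof.
move=> sh; elim: n => [|n IH]; first by rewrite expr1.
by rewrite expnS mulnC !exprM cs_sqr ?IH // starX sh.
Qed.

Lemma csX a n : q (a ^+ n.+1) <= q a ^+ n.+1.
Proof.
elim: n => [|n IH]; first by rewrite !expr1.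
rewrite exprS [leRHS]exprS; apply: le_trans (csM cq _ _) _.
by rewrite ler_wpM2l // cs_ge0.
Qed.

Lemma cs_sum (I : Type) (r : seq I) (F : I -> A) :
  q (\sum_(i <- r) F i) <= \sum_(i <- r) q (F i).
Proof.
elim: r => [|i r IH]; first by rewrite !big_nil cs0.
by rewrite !big_cons; apply: le_trans (csD cq _ _) _; rewrite lerD2l.
Qed.

Lemma cs_eqB a b : q (a - b) = 0 -> q a = q b.
Proof.
move=> e; have h1 := csD cq (a - b) b; have h2 := csD cq (b - a) a.
move: h1 h2; rewrite !subrK -(csOpp (b - a)) opprB e !add0r => h1 h2.
by apply/le_anti; rewrite h1 h2.
Qed.

Section localization.
Variable e : A.
Hypotheses (ce : forall a, GRing.comm a e) (pe : cpos e) (pe1 : cpos (1 - e)).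

Let e1 : cnorm e <= 1.
Proof.
apply: cpos_cnorm_le => //; [by case: pe|by rewrite rmorph1 scale1r|].
by rewrite rmorph1 scale1r; apply: cposD => //; exact: cpos1.
Qed.

Let eX n a : q (e ^+ n * a) <= q a.
Proof.
apply: le_trans (csM cq _ _) _; rewrite ler_piMl ?cs_ge0 //.
by apply: le_trans (csN cq _) _; apply: le_trans (cnormX _ _) _; rewrite exprn_ile1 ?cnorm_ge0.
Qed.

(* [e] is a bump in a central variable: its powers leave only the part of the
   algebra where [e = 1]. *)
Definition cs_loc a : R := inf [set q (e ^+ n * a) | n in setT].

Lemma cs_loc_le a n : cs_loc a <= q (e ^+ n * a).
Proof.
apply: ge_inf; last by exists n.
by exists 0 => _ [m _ <-]; exact: cs_ge0.
Qed.

(** Multiplication by [e] does not increase [q], so the values decrease with the exponent and a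
    bound reached once persists. *)
Lemma cs_loc_approx a (r : R) : cs_loc a < r ->
  exists n, forall m, (n <= m)%N -> q (e ^+ m * a) < r.
Proof.
rewrite -subr_gt0 => /(@inf_adherent _ [set q (e ^+ n * a) | n in setT]) [].
  split; first by exists (q (e ^+ 0 * a)); exists 0%N.
  by exists 0 => _ [m _ <-]; exact: cs_ge0.
move=> _ [n _ <-]; rewrite addrCA subrr addr0 => nr; exists n => m /subnK <-.
apply: le_lt_trans nr; rewrite exprD -mulrA; exact: eX.
Qed.

Lemma cs_loc_le_q a : cs_loc a <= q a.
Proof. by have := cs_loc_le a 0; rewrite expr0 mul1r. Qed.

Lemma cs_loc_ge0 a : 0 <= cs_loc a.
Proof.
apply: lb_le_inf; first by exists (q (e ^+ 0 * a)); exists 0%N.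
by move=> _ [m _ <-]; exact: cs_ge0.
Qed.

Let cX n a : GRing.comm a (e ^+ n).
Proof. exact: commrX. Qed.

Let se n : star (e ^+ n) = e ^+ n.
Proof. by rewrite starX; case: pe => ->. Qed.

(** Centrality lets an exponent n + m be shared between the two factors of a product, and e^(2n) a^*
    a = (e^n a)^* (e^n a) gives the C*-identity. *)
Lemma cseminorm_loc : cseminorm cs_loc.
Proof.
split.
- move=> a b; apply/ler_addgt0Pl => r r0; have r2 : 0 < r / 2 by lra.
  have [|n hn] := @cs_loc_approx a (cs_loc a + r / 2); first by rewrite ltrDl.
  have [|m hm] := @cs_loc_approx b (cs_loc b + r / 2); first by rewrite ltrDl.
  apply: le_trans (cs_loc_le _ (maxn n m)) _; rewrite mulrDr.
  apply: le_trans (csD cq _ _) _.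
  by have := hn _ (leq_maxl n m); have := hm _ (leq_maxr n m); lra.
- move=> c a; apply/le_anti/andP; split.
    have [c0|c0] := eqVneq c 0.
      rewrite c0 scale0r normc0 mul0r; apply: le_trans (cs_loc_le_q _) _.
      by rewrite cs0.
    have nc : 0 < normc c.
      rewrite lt_neqAle normc_ge0 andbT eq_sym; apply: contra_neq c0.
      exact: eq0_normc.
    rewrite mulrC -ler_pdivrMr //; apply: lb_le_inf.
      by exists (q (e ^+ 0 * a)); exists 0%N.
    move=> _ [m _ <-]; rewrite ler_pdivrMr // mulrC -(csZ cq) scalerAr.
    exact: cs_loc_le.
  apply: lb_le_inf; first by exists (q (e ^+ 0 * (c *: a))); exists 0%N.
  move=> _ [m _ <-]; rewrite -scalerAr (csZ cq) ler_wpM2l ?normc_ge0 //.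
  exact: cs_loc_le.
- move=> a b; apply/ler_addgt0Pl => r r0.
  set x := cs_loc a; set y := cs_loc b.
  have x0 : 0 <= x by exact: cs_loc_ge0.
  have y0 : 0 <= y by exact: cs_loc_ge0.
  (* Chosen so that (x + d)(y + d) <= x y + r. *)
  pose d := Num.min 1 (r / (x + y + 1)).
  have xy : 0 < x + y + 1 by lra.
  have d1 : d <= 1 by rewrite ge_min lexx.
  have d0 : 0 < d by rewrite lt_min ltr01 divr_gt0.
  have dK : d * (x + y + 1) <= r by rewrite -ler_pdivlMr // ge_min lexx orbT.
  have [|n hn] := @cs_loc_approx a (x + d); first by rewrite ltrDl.
  have [|m hm] := @cs_loc_approx b (y + d); first by rewrite ltrDl.
  apply: le_trans (cs_loc_le _ (n + m)) _.
  have -> : e ^+ (n + m) * (a * b) = (e ^+ n * a) * (e ^+ m * b).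
    by rewrite exprD !mulrA; congr (_ * b); rewrite -!mulrA (cX m a).
  apply: le_trans (csM cq _ _) _.
  have := ler_pM (cs_ge0 _) (cs_ge0 _) (ltW (hn _ (leqnn n))) (ltW (hm _ (leqnn m))).
  move/le_trans; apply; nra.
- move=> a; have key n : q (e ^+ (n + n) * (star a * a)) = q (e ^+ n * a) ^+ 2.
    rewrite -(csS cq) starM se exprD -!mulrA; congr q.
    rewrite !mulrA; congr (_ * a).
    by rewrite -!mulrA -(cX n (star a)) !mulrA -(cX n (star a)).
  apply/le_anti/andP; split.
    apply/ler_addgt0Pl => r r0; set x := cs_loc a.
    have x0 : 0 <= x by exact: cs_loc_ge0.
    pose d := Num.min 1 (r / (x + x + 1)).
    have xy : 0 < x + x + 1 by lra.
    have d1 : d <= 1 by rewrite ge_min lexx.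
    have d0 : 0 < d by rewrite lt_min ltr01 divr_gt0.
    have dK : d * (x + x + 1) <= r by rewrite -ler_pdivlMr // ge_min lexx orbT.
    have [|n hn] := @cs_loc_approx a (x + d); first by rewrite ltrDl.
    apply: le_trans (cs_loc_le _ (n + n)) _; rewrite key.
    have := hn _ (leqnn n); have := cs_ge0 (e ^+ n * a); rewrite !expr2; nra.
  apply: lb_le_inf; first by exists (q (e ^+ 0 * (star a * a))); exists 0%N.
  move=> _ [m _ <-]; apply: (@le_trans _ _ (q (e ^+ (m + m) * (star a * a)))).
    rewrite key; apply: lerXn2r; rewrite ?nnegrE ?cs_loc_ge0 ?cs_ge0 //.
    exact: cs_loc_le.
  by rewrite exprD -mulrA.
- by move=> a; apply: le_trans (cs_loc_le_q _) (csN cq _).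
Qed.

Lemma cs_loc_eq0 : cs_loc (1 - e) = 0.
Proof.
apply/le_anti; rewrite cs_loc_ge0 andbT; apply/ler_addgt0Pl => r r0; rewrite addr0.
have [N rN] : exists N, 1 / r < N.+1%:R.
  by exists (Num.trunc (1 / r)); exact: truncnS_gt.
have N0 : 0 < N.+1%:R :> R by rewrite ltr0n.
apply: le_trans (cs_loc_le _ N.+1) _; apply: le_trans (csN cq _) _.
have := @cpos_mulX_le _ _ (1 - e) N.+1; rewrite opprB addrCA subrr addr0.
move=> /(_ pe1 pe); rewrite (cX N.+1 (1 - e)) -ler_pdivlMr // => /le_trans; apply.
by rewrite ler_pdivrMr // mulrC -ler_pdivrMr // ltW.
Qed.

End localization.

End cseminorm_theory.

Lemma seq_bound_lt1 (R : realType) (T : eqType) (s : seq T) (f : T -> R) :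
  (forall l, l \in s -> f l < 1) -> exists2 k : R, 0 <= k < 1 & forall l, l \in s -> f l <= k.
Proof.
elim: s => [|l s IH] f1; first by exists 0; rewrite ?lexx ?ltr01.
have [|k /andP[k0 k1] fk] := IH; first by move=> m ms; apply: f1; rewrite in_cons ms orbT.
exists (Num.max k (f l)); first by rewrite le_max k0 gt_max k1 f1 // mem_head.
move=> m; rewrite in_cons => /predU1P[->|/fk]; first by rewrite le_max lexx orbT.
by rewrite le_max => ->.
Qed.

(** * Attaining a C*-seminorm at one value of a central self-adjoint element *)

Section spectral_point.
Variables (R : realType) (A : cstarAlgType R) (q : A -> R).
Hypothesis cq : cseminorm q.
Variables (x : A) (L : R).
Hypotheses (sx : star x = x) (cx : forall a, GRing.comm a x) (L0 : 0 < L)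
  (xL : cnorm x <= L).
Implicit Types (a b h : A) (l t : R).

(** A parabola equal to 1 only at [l]; the scale 2L keeps its values in [0, 1] when both points lie
    in [-L, L]. *)
Definition bump l : {poly R} := 1 - ((2 * L)^-1 *: ('X - l%:P)) ^+ 2.

Let y l := (2 * L)^-1%:C *: (x - l%:C%:A).

Let bumpE l : phorner x (bump l) = 1 - y l ^+ 2.
Proof.
rewrite /bump phornerB phornerXn phornerZ phornerB phornerX phornerC.
by rewrite -[X in phorner _ X - _]/(1%:P) phornerC rmorph1 scale1r.
Qed.

Let sy l : star (y l) = y l.
Proof. by rewrite /y starZ starB starZ !conj_real star1 sx. Qed.

Let ny l : - L <= l <= L -> cnorm (y l) <= 1.
Proof.
move=> lL; have L2 : 0 < 2 * L by rewrite mulr_gt0.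
rewrite /y cnormZr gtr0_norm ?invr_gt0 // mulrC ler_pdivrMr // mul1r.
apply: le_trans (cnormB_le _ _) _; rewrite cnormZr cnorm1 mulr1.
have : `|l| <= L by rewrite ler_norml.
move: xL (cnorm_ge0 x); lra.
Qed.

Let bump_comm l a : GRing.comm a (phorner x (bump l)).
Proof.
rewrite bumpE; apply: commrB; first exact: commr1.
apply: commrX; rewrite /y /GRing.comm -scalerAr -scalerAl; congr (_ *: _).
by apply: commrB; [exact: cx|exact: commr_alg].
Qed.

Let bump_pos1 l : cpos (1 - phorner x (bump l)).
Proof. by rewrite bumpE opprB addrCA subrr addr0; exact: cpos_sqr. Qed.

Let bump_pos l : - L <= l <= L -> cpos (phorner x (bump l)).
Proof.
move=> lL; split; first by rewrite bumpE starB star1 starX sy.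
exists 1; rewrite rmorph1 scale1r bumpE opprB addrCA subrr addr0 cnorm_sqr //.
by rewrite expr_le1 // ?ny // cnorm_ge0.
Qed.

Let bump_ge0 l t : - L <= l <= L -> - L <= t <= L -> 0 <= (bump l).[t].
Proof.
move=> lL tL; rewrite /bump hornerD hornerN horner_exp hornerZ hornerXsubC hornerC.
have L2 : 0 < 2 * L by rewrite mulr_gt0.
rewrite subr_ge0 -real_normK ?num_real // expr_le1 // normrM normfV (gtr0_norm L2).
rewrite mulrC ler_pdivrMr // mul1r ler_norml; move: lL tL; lra.
Qed.

(** Otherwise every [l] has a bump power E_l with q(E_l h) < q(h), where h = a^* a. By compactness a
    finite sum p of powers of the E_l/u_l is at least 1 on [-L, L], so p(x) has an inverse of norm
    at most 1. Then q(h)^m <= q(p(x) h^m), while every summand on the right is below k^m q(h)^m with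
    k < 1: impossible for large m. *)
Lemma spectral_point a : exists2 l, - L <= l <= L &
  cs_loc q (phorner x (bump l)) a = q a.
Proof.
apply: contrapT => noL; pose h := star a * a.
have sh : star h = h by rewrite /h starM starK.
have lt l : - L <= l <= L -> exists n, q (phorner x (bump l) ^+ n * h) < q h.
  move=> lL; have cl := cseminorm_loc cq (bump_comm l) (bump_pos lL) (bump_pos1 l).
  have [|n /(_ n (leqnn n)) hn] := @cs_loc_approx _ _ _ cq _ (bump_pos lL) (bump_pos1 l) h (q h).
    rewrite (csS cl) (csS cq) ltr_pXn2r ?nnegrE //; [|exact: cs_ge0 cl _|exact: cs_ge0 cq _].
    rewrite lt_neqAle cs_loc_le_q // andbT; apply/eqP => e; apply: noL.
    by exists l.
  by exists n.
have qh0 : 0 < q h.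
  have LL : - L <= 0 <= L by move: L0; lra.
  have [n] := lt 0 LL; apply: le_lt_trans; exact: cs_ge0.
have /choice [n hn] : forall l, exists n, - L <= l <= L -> q (phorner x (bump l) ^+ n * h) < q h.
  by move=> l; have [/lt[n ?]|_] := boolP (- L <= l <= L); [exists n|exists 0%N].
pose E l := bump l ^+ n l.
pose s l := q (phorner x (E l) * h) / q h.
have s0 l : 0 <= s l by rewrite divr_ge0 // ?cs_ge0 // ltW.
have s1 l : - L <= l <= L -> s l < 1.
  by move=> lL; rewrite ltr_pdivrMr // mul1r /E phornerXn hn.
(* The midpoint between s_l < 1 and E_l(l) = 1: the set where E_l exceeds it contains l, and s_l/u_l
   is still below 1. *)
pose u l := (s l + 1) / 2.
have u0 l : 0 < u l by rewrite /u; have := s0 l; lra.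
have : compact (`[- L, L] : set R) by exact: segment_compact.
rewrite compact_cover => /(_ R [set` `[- L, L]] (fun l => [set t | u l < (E l).[t]])) [].
- move=> l _; apply: (@open_comp _ _ (horner (E l)) [set t | u l < t]).
    by move=> t _; exact: continuous_horner.
  exact: open_gt.
- move=> l lL; exists l => //=; have ll : - L <= l <= L by move: lL; rewrite /= in_itv.
  have -> : (E l).[l] = 1.
    rewrite /E /bump !horner_exp hornerD hornerN horner_exp hornerZ hornerXsubC hornerC.
    by rewrite subrr mulr0 expr0n subr0 expr1n.
  by rewrite /u; have := s1 l ll; lra.
move=> D DL cov.
have DL' l : l \in D -> - L <= l <= L.
  by move=> /DL; rewrite inE /= in_itv.
have [k k01 sk] : exists2 k : R, 0 <= k < 1 & forall l, l \in D -> s l / u l <= k.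
  apply: seq_bound_lt1 => l /DL' lL; rewrite ltr_pdivrMr // mul1r /u.
  by have := s1 l lL; lra.
have [N hN] := expr_lt_eps (size D)%:R k01 (@ltr01 R).
(* The exponent must be a power of 2 for q(h^m) = q(h)^m, and nonzero because q(1) need not be at
   most 1 a priori in [csX]. *)
have [N1 leN] : exists N1, (2 ^ N = N1.+1)%N /\ (N <= N1.+1)%N.
  exists (2 ^ N).-1; rewrite prednK ?expn_gt0 //; split => //.
  by apply: ltnW; exact: ltn_expl.
pose p := \sum_(l <- D) ((u l)^-1 *: E l) ^+ N1.+1.
have [|g [gp g1]] := @phorner_inv _ _ x L sx xL p.
  move=> t tL; have [|l /= lD ut] := cov t; first by rewrite /= in_itv.
  rewrite /p horner_sum (big_rem l) //=.
  rewrite -[leLHS]addr0; apply: lerD.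
    rewrite horner_exp hornerZ; apply: exprn_ege1.
    by rewrite mulrC ler_pdivlMr // mul1r ltW.
  rewrite big_seq; apply: sumr_ge0 => m /mem_rem mD.
  rewrite horner_exp hornerZ /E horner_exp; apply: exprn_ge0; apply: mulr_ge0.
    by rewrite invr_ge0 ltW.
  by apply: exprn_ge0; apply: bump_ge0 => //; exact: DL'.
have cE l b : GRing.comm b (phorner x (E l)).
  by rewrite /E phornerXn; apply: commrX; exact: bump_comm.
have : q h ^+ N1.+1 <= \sum_(l <- D) k ^+ N1.+1 * q h ^+ N1.+1.
  rewrite -{1}leN.1 -cs_exp2 // leN.1 -[h ^+ _]mul1r -gp -mulrA.
  apply: le_trans (csM cq _ _) _.
  apply: (@le_trans _ _ (q (phorner x p * h ^+ N1.+1))).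
    rewrite ler_piMl ?cs_ge0 //; exact: le_trans (csN cq _) g1.
  rewrite /p phorner_sum mulr_suml; apply: le_trans (cs_sum cq _ _) _.
  rewrite big_seq [leRHS]big_seq; apply: ler_sum => l lD.
  have cc : GRing.comm ((u l)^-1%:C *: phorner x (E l)) h.
    by apply: commr_sym; rewrite /GRing.comm -scalerAr -scalerAl (cE l h).
  rewrite phornerXn phornerZ -(exprMn_comm _ cc).
  apply: le_trans (csX cq _ _) _; rewrite -scalerAl (csZ cq) normc_real gtr0_norm ?invr_gt0 //.
  rewrite -exprMn; apply: lerXn2r; rewrite ?nnegrE.
  - by rewrite mulr_ge0 ?invr_ge0 ?cs_ge0 // ltW.
  - by rewrite mulr_ge0 ?cs_ge0 //; case/andP: k01.
  - rewrite -ler_pdivrMr // mulrC mulrA; apply: le_trans (sk l lD).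
    by rewrite [leLHS]mulrAC /s [q (_ * _) / _]mulrC.
rewrite big_const_seq count_predT iter_addr addr0 -mulr_natl mulrA.
rewrite ler_pMl ?exprn_gt0 //; apply/negP; rewrite -ltNge; apply: le_lt_trans hN.
case/andP: k01 => k0 k1; apply: ler_wpM2l => //.
by apply: ler_wiXn2l => //; [exact: ltW|exact: leN.2].
Qed.

(** Localizing kills 1 - [bump l] evaluated at x, which is the square of (x - l)/(2L); by the
    C*-identity it kills x - l itself. *)
Lemma exists_localization a : exists (l : R) (q' : A -> R),
  [/\ cseminorm q', forall b, q' b <= q b, q' a = q a & q' (x - l%:C%:A) = 0].
Proof.
have [l lL e] := spectral_point a.
have cl := cseminorm_loc cq (bump_comm l) (bump_pos lL) (bump_pos1 l).
exists l, (cs_loc q (phorner x (bump l))); split => //.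
  by move=> b; exact: cs_loc_le_q.
have := cs_loc_eq0 cq (bump_comm l) (bump_pos lL) (bump_pos1 l).
rewrite {2}bumpE opprB addrCA subrr addr0 (cs_sqr cl) // => /eqP.
rewrite expf_eq0 /= (csZ cl) mulf_eq0 => /orP[|/eqP//].
by rewrite normc_real normr_eq0 invr_eq0 mulf_eq0 pnatr_eq0 /= gt_eqF.
Qed.

End spectral_point.

(** * The quotient by a C*-seminorm *)

Section cs_quotient.
Variables (R : realType) (A : cstarAlgType R) (q : A -> R).
Hypotheses (cq : cseminorm q) (q1 : q 1 != 0).

Definition cs_eqv (a b : A) := q (a - b) == 0.

Let eqv_refl : reflexive cs_eqv.
Proof. by move=> a; rewrite /cs_eqv subrr cs0. Qed.

Let eqv_sym : symmetric cs_eqv.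
Proof. by move=> a b; rewrite /cs_eqv -opprB csOpp. Qed.

Let le0_eqv a b : q (a - b) <= 0 -> cs_eqv a b.
Proof. by move=> h; rewrite /cs_eqv eq_le h cs_ge0. Qed.

Let eqv_trans : transitive cs_eqv.
Proof.
move=> b a c /eqP ab /eqP bc; apply: le0_eqv; rewrite -(subrKA b).
by apply: le_trans (csD cq _ _) _; rewrite ab bc addr0.
Qed.

Canonical cs_equiv := EquivRel cs_eqv eqv_refl eqv_sym eqv_trans.

(** The type carries the proof of [q 1 != 0] so that the structure of a nonzero ring can be attached
    to it. The quotient is not completed. *)
Definition cs_quot of q 1 != 0 := {eq_quot cs_equiv}.
Local Notation quotT := (cs_quot q1).
HB.instance Definition _ : EqQuotient _ cs_equiv quotT := EqQuotient.on quotT.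
HB.instance Definition _ := Choice.on quotT.

Definition cs_pi (a : A) : quotT := \pi_quotT a.

Lemma cs_piP a b : cs_pi a = cs_pi b <-> q (a - b) = 0.
Proof. by split=> [/eqmodP/eqP//|/eqP h]; apply/eqmodP. Qed.

Let rep (x : quotT) : A := repr x.

Let repK x : cs_pi (rep x) = x.
Proof. exact: reprK. Qed.

Let rep_pi a : q (rep (cs_pi a) - a) = 0.
Proof. by apply/cs_piP; rewrite repK. Qed.

Let quot_ind (P : quotT -> Prop) : (forall a, P (cs_pi a)) -> forall x, P x.
Proof. by move=> h x; rewrite -(repK x); exact: h. Qed.

Definition quot_add x y := cs_pi (rep x + rep y).
Definition quot_opp x := cs_pi (- rep x).
Definition quot_mul x y := cs_pi (rep x * rep y).
Definition quot_scale (c : R[i]) x := cs_pi (c *: rep x).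
Definition quot_star x := cs_pi (star (rep x)).

Let q0_le a : q a <= 0 -> q a = 0.
Proof. by move=> h; apply/le_anti; rewrite h cs_ge0. Qed.

Let piD a b : quot_add (cs_pi a) (cs_pi b) = cs_pi (a + b).
Proof.
apply/cs_piP/q0_le; rewrite opprD addrACA.
by apply: le_trans (csD cq _ _) _; rewrite !rep_pi addr0.
Qed.

Let piN a : quot_opp (cs_pi a) = cs_pi (- a).
Proof. by apply/cs_piP; rewrite -opprD csOpp. Qed.

Let piM a b : quot_mul (cs_pi a) (cs_pi b) = cs_pi (a * b).
Proof.
apply/cs_piP/q0_le; set a' := rep _; set b' := rep _.
have -> : a' * b' - a * b = (a' - a) * b' + a * (b' - b).
  by rewrite mulrBl mulrBr addrA subrK.
apply: le_trans (csD cq _ _) _.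
have := csM cq (a' - a) b'; have := csM cq a (b' - b).
by rewrite !rep_pi mulr0 mul0r => h1 h2; apply: le_trans (lerD h2 h1) _; rewrite addr0.
Qed.

Let piZ c a : quot_scale c (cs_pi a) = cs_pi (c *: a).
Proof. by apply/cs_piP; rewrite -scalerBr (csZ cq) rep_pi mulr0. Qed.

Let piS a : quot_star (cs_pi a) = cs_pi (star a).
Proof. by apply/cs_piP; rewrite -starB cs_star. Qed.

Let addA : associative quot_add.
Proof. by do 3![elim/quot_ind=> ?]; rewrite !piD addrA. Qed.
Let addC : commutative quot_add.
Proof. by do 2![elim/quot_ind=> ?]; rewrite !piD addrC. Qed.
Let add0 : left_id (cs_pi 0) quot_add.
Proof. by elim/quot_ind=> ?; rewrite piD add0r. Qed.
Let addN : left_inverse (cs_pi 0) quot_opp quot_add.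
Proof. by elim/quot_ind=> ?; rewrite piN piD addNr. Qed.

HB.instance Definition _ := GRing.isZmodule.Build quotT addA addC add0 addN.

Let mulA : associative quot_mul.
Proof. by do 3![elim/quot_ind=> ?]; rewrite !piM mulrA. Qed.
Let mul1 : left_id (cs_pi 1) quot_mul.
Proof. by elim/quot_ind=> ?; rewrite piM mul1r. Qed.
Let mulr1' : right_id (cs_pi 1) quot_mul.
Proof. by elim/quot_ind=> ?; rewrite piM mulr1. Qed.
Let mulDl : left_distributive quot_mul +%R.
Proof.
by do 3![elim/quot_ind=> ?]; rewrite /+%R /= !(piD, piM) mulrDl.
Qed.
Let mulDr : right_distributive quot_mul +%R.
Proof.
by do 3![elim/quot_ind=> ?]; rewrite /+%R /= !(piD, piM) mulrDr.
Qed.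
Let one_neq0 : cs_pi 1 != 0 :> quotT.
Proof.
by apply: contra q1 => /eqP/cs_piP; rewrite subr0 => ->.
Qed.

HB.instance Definition _ := GRing.Zmodule_isNzRing.Build quotT
  mulA mul1 mulr1' mulDl mulDr one_neq0.

Let scaleA a b x : quot_scale a (quot_scale b x) = quot_scale (a * b) x.
Proof. by elim/quot_ind: x => ?; rewrite !piZ scalerA. Qed.
Let scale1 : left_id 1 quot_scale.
Proof. by elim/quot_ind=> ?; rewrite piZ scale1r. Qed.
Let scaleDr : right_distributive quot_scale +%R.
Proof.
by move=> c; do 2![elim/quot_ind=> ?]; rewrite /+%R /= !(piD, piZ) scalerDr.
Qed.
Let scaleDl x : {morph quot_scale^~ x : a b / a + b}.
Proof.
by elim/quot_ind: x => ? a b; rewrite !piZ [RHS]piD scalerDl.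
Qed.

HB.instance Definition _ := GRing.Zmodule_isLmodule.Build R[i] quotT
  scaleA scale1 scaleDr scaleDl.

Let scaleAl (c : R[i]) (x y : quotT) : c *: (x * y) = (c *: x) * y.
Proof.
elim/quot_ind: x => a; elim/quot_ind: y => b.
by rewrite /*:%R /= /*%R /= !(piM, piZ) scalerAl.
Qed.

HB.instance Definition _ := GRing.Lmodule_isLalgebra.Build R[i] quotT scaleAl.

Let scaleAr (c : R[i]) (x y : quotT) : c *: (x * y) = x * (c *: y).
Proof.
elim/quot_ind: x => a; elim/quot_ind: y => b.
by rewrite /*:%R /= /*%R /= !(piM, piZ) scalerAr.
Qed.

HB.instance Definition _ := GRing.Lalgebra_isAlgebra.Build R[i] quotT scaleAr.

Let quot_starK : involutive quot_star.
Proof. by elim/quot_ind=> ?; rewrite !piS starK. Qed.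
Let quot_starD : {morph quot_star : x y / x + y}.
Proof.
by do 2![elim/quot_ind=> ?]; rewrite /+%R /= !(piD, piS) starD.
Qed.
Let quot_starZ (c : R[i]) x : quot_star (c *: x) = Num.conj c *: quot_star x.
Proof.
by elim/quot_ind: x => ?; rewrite /*:%R /= !(piZ, piS) starZ.
Qed.
Let quot_starM x y : quot_star (x * y) = quot_star y * quot_star x.
Proof.
elim/quot_ind: x => a; elim/quot_ind: y => b.
by rewrite /*%R /= !(piM, piS) starM.
Qed.

HB.instance Definition _ := Algebra_hasStar.Build R[i] quotT
  quot_starK quot_starD quot_starZ quot_starM.

Let pi_semi : nmod_morphism cs_pi.
Proof. by split=> // a b; exact/esym/piD. Qed.
HB.instance Definition _ := GRing.isNmodMorphism.Build A quotT cs_pi pi_semi.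
Let pi_mult : monoid_morphism cs_pi.
Proof. by split=> // a b; exact/esym/piM. Qed.
HB.instance Definition _ := GRing.isMonoidMorphism.Build A quotT cs_pi pi_mult.
Let pi_scale : scalable cs_pi.
Proof. by move=> c a; exact/esym/piZ. Qed.
HB.instance Definition _ := GRing.isScalable.Build R[i] A quotT *:%R cs_pi pi_scale.

Lemma cs_pi_star : star_morphism (cs_pi : A -> quotT).
Proof. by move=> a; exact/esym/piS. Qed.

Lemma cs_pi_surj (x : quotT) : exists a, x = cs_pi a.
Proof. by exists (rep x); rewrite repK. Qed.

Lemma cs_pi_eq0 a : cs_pi a = 0 <-> q a = 0.
Proof. by rewrite -[X in q X]subr0; exact: cs_piP. Qed.

End cs_quotient.

(** * Fermions and matrix units *)

Lemma sum_ord2 (V : nmodType) (F : 'I_2 -> V) : \sum_i F i = F 0 + F 1.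
Proof. by rewrite big_ord_recl big_ord1; congr (_ + F _); apply: val_inj. Qed.

Section fermion.
Variables (C : numClosedFieldType) (Q : starAlgType C).
Implicit Types (a b e w : Q) (N : 'I_2 -> 'I_2 -> Q).

Definition fermion e := e * e = 0 /\ e * star e + star e * e = 1.

Lemma fermion_star e : fermion e -> fermion (star e).
Proof.
by move=> [h1 h2]; split; [rewrite -starM h1 star0|rewrite starK addrC].
Qed.

(** The matrix units generated by a fermion, with [e] as unit (0, 1). *)
Definition munit e (i j : 'I_2) : Q :=
  if i == 0 then if j == 0 then e * star e else e
  else if j == 0 then star e else star e * e.

Lemma munitM e i j k l : fermion e ->
  munit e i j * munit e k l = (j == k)%:R *: munit e i l.
Proof.
move=> [ee es].
have ss : star e * star e = 0 by rewrite -starM ee star0.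
have ese : e * star e * e = e.
  by rewrite -mulrA -[star e * e](addKr (e * star e)) es mulrDr mulrN mulrA ee mul0r oppr0 add0r mulr1.
have ses : star e * e * star e = star e.
  by have := congr1 (@star _ Q) ese; rewrite !starM starK mulrA.
have ess : e * star e * star e = 0 by rewrite -mulrA ss mulr0.
have see : star e * e * e = 0 by rewrite -mulrA ee mulr0.
have esm a : a * e * e = 0 by rewrite -mulrA ee mulr0.
have ssm a : a * star e * star e = 0 by rewrite -mulrA ss mulr0.
have I2 (m : 'I_2) : m = 0 \/ m = 1 by case: m => -[|[|//]] h; [left|right]; apply: val_inj.
by case: (I2 i) (I2 j) (I2 k) (I2 l) => -> [] -> [] -> [] ->;
  rewrite /munit ?eqxx ?oner_eq0 ?[0 == 1]eq_sym ?oner_eq0 /= ?scale1r ?scale0r ?mulrA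
   ?(esm, ssm, ee, ss, mul0r, ese, ses).
Qed.

Lemma munit_star e i j : star (munit e i j) = munit e j i.
Proof. by rewrite /munit; case: ifP; case: ifP; rewrite ?starM ?starK. Qed.

Lemma munit_comm e i j a : GRing.comm a e -> GRing.comm a (star e) ->
  GRing.comm a (munit e i j).
Proof. by move=> h1 h2; rewrite /munit; case: ifP; case: ifP => // _ _; apply: commrM. Qed.

(** When the entries commute with [e] and [star e], this is the *-homomorphism from 2 x 2 matrices
    over the commutant, which splits off one tensor factor M_2. *)
Definition blockrep e N : Q := \sum_i \sum_j munit e i j * N i j.

Lemma blockrepD e N N' : blockrep e (fun i j => N i j + N' i j) = blockrep e N + blockrep e N'.
Proof.
rewrite /blockrep -big_split; apply: eq_bigr => i _; rewrite -big_split /=.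
by apply: eq_bigr => j _; rewrite mulrDr.
Qed.

Lemma blockrepZ e c N : blockrep e (fun i j => c *: N i j) = c *: blockrep e N.
Proof.
rewrite /blockrep scaler_sumr; apply: eq_bigr => i _; rewrite scaler_sumr.
by apply: eq_bigr => j _; rewrite scalerAr.
Qed.

Lemma blockrepM e N N' : fermion e ->
  (forall i j, GRing.comm (N i j) e) -> (forall i j, GRing.comm (N i j) (star e)) ->
  blockrep e N * blockrep e N' = blockrep e (fun i j => \sum_k N i k * N' k j).
Proof.
move=> fe c1 c2; rewrite /blockrep mulr_suml; apply: eq_bigr => i _.
under [RHS]eq_bigr do rewrite mulr_sumr.
rewrite [RHS]exchange_big mulr_suml; apply: eq_bigr => j _ /=.
rewrite mulr_sumr (bigD1 j) //= [X in _ + X]big1 ?addr0; last first.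
  move=> k kj; rewrite mulr_sumr big1 // => l _.
  rewrite mulrA -[munit e i j * _ * _]mulrA (munit_comm _ _ (c1 i j) (c2 i j)).
  by rewrite mulrA munitM // eq_sym (negbTE kj) scale0r !mul0r.
rewrite mulr_sumr; apply: eq_bigr => l _.
rewrite mulrA -[munit e i j * _ * _]mulrA (munit_comm _ _ (c1 i j) (c2 i j)).
by rewrite mulrA munitM // eqxx scale1r mulrA.
Qed.

Lemma blockrep_star e N :
  (forall i j, GRing.comm (N i j) e) -> (forall i j, GRing.comm (N i j) (star e)) ->
  star (blockrep e N) = blockrep e (fun i j => star (N j i)).
Proof.
move=> c1 c2; rewrite /blockrep exchange_big /=.
have star_sum (F : 'I_2 -> Q) : star (\sum_i F i) = \sum_i star (F i).
  by rewrite !sum_ord2 starD.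
rewrite star_sum; apply: eq_bigr => i _; rewrite star_sum; apply: eq_bigr => j _.
by rewrite -(munit_comm _ _ (c1 j i) (c2 j i)) starM munit_star.
Qed.

Lemma blockrep1 e : fermion e -> blockrep e (fun i j => (i == j)%:R) = 1.
Proof.
move=> [_ e1]; rewrite /blockrep !sum_ord2 /munit !eqxx oner_eq0 [0 == 1]eq_sym oner_eq0 /=.
by rewrite !mulr1 !mulr0 addr0 add0r e1.
Qed.

Definition mxrep e (A : 'M[C]_2) : Q := blockrep e (fun i j => (A i j)%:A).

Lemma mxrepE e A : mxrep e A = A 0 0 *: (e * star e) + A 0 1 *: e + A 1 0 *: star e
  + A 1 1 *: (star e * e).
Proof.
rewrite /mxrep /blockrep !sum_ord2 /munit !eqxx oner_eq0 /=.
by rewrite -!scalerAr !mulr1 addrA.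
Qed.

Lemma mxrepD e A B : mxrep e (A + B) = mxrep e A + mxrep e B.
Proof.
by rewrite -blockrepD; congr blockrep; apply/funext => i; apply/funext => j;
  rewrite mxE scalerDl.
Qed.

Lemma mxrepZ e c A : mxrep e (c *: A) = c *: mxrep e A.
Proof.
by rewrite -blockrepZ; congr blockrep; apply/funext => i; apply/funext => j;
  rewrite mxE scalerA.
Qed.

Lemma mxrepM e A B : fermion e -> mxrep e (A *m B) = mxrep e A * mxrep e B.
Proof.
move=> fe; rewrite /mxrep blockrepM //.
- congr blockrep; apply/funext => i; apply/funext => j; rewrite mxE scaler_suml.
  by apply: eq_bigr => k _; rewrite -scalerAl mul1r scalerA.
- by move=> i j; exact: comm_alg.
- by move=> i j; exact: comm_alg.
Qed.

Lemma mxrep_star e A : mxrep e (A ^t*) = star (mxrep e A).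
Proof.
rewrite /mxrep blockrep_star.
- congr blockrep; apply/funext => i; apply/funext => j.
  by rewrite !mxE starZ star1.
- by move=> i j; exact: comm_alg.
- by move=> i j; exact: comm_alg.
Qed.

Lemma mxrep1 e : fermion e -> mxrep e 1%:M = 1.
Proof.
move=> fe; rewrite -(blockrep1 fe); congr blockrep; apply/funext => i; apply/funext => j.
by rewrite mxE; case: eqP; rewrite ?scale1r ?scale0r.
Qed.

Lemma mxrep_comm e A a : GRing.comm a e -> GRing.comm a (star e) -> GRing.comm a (mxrep e A).
Proof.
move=> h1 h2; rewrite mxrepE; do 3?[apply: commrD];
  by rewrite /GRing.comm -scalerAr -scalerAl; congr (_ *: _) => //; apply: commrM.
Qed.

End fermion.

(** * Anticommutation relations *)

Section polar.
Variable R : realType.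
Implicit Types (c z : R[i]) (a x : R).

Lemma conj_unit z : normc z = 1 -> Num.conj z * z = 1.
Proof.
by move=> nz; rewrite -normCKC; have -> : `|z| = (normc z)%:C by []; rewrite nz expr1n.
Qed.

Lemma polar c : exists2 z, normc z = 1 & c = z * (normc c)%:C.
Proof.
have [->|c0] := eqVneq c 0; first by exists 1; rewrite ?normc1 // normc0 mulr0.
have n0 : normc c != 0 by apply: contra_neq c0; exact: eq0_normc.
exists (c * (normc c)^-1%:C).
  by rewrite normcM normc_real ger0_norm ?invr_ge0 ?normc_ge0 // divff.
by rewrite -mulrA -rmorphM mulVf // mulr1.
Qed.

(** The weight is the smaller root of x(1 - x) = a^2; the two roots meet exactly at a = 1/2. *)
Lemma weight_of_modulus a : 0 <= a <= 1 / 2 -> exists x,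
  [/\ 0 <= x <= 1 / 2, Num.sqrt x * Num.sqrt (1 - x) = a & (x < 1 / 2) = (a < 1 / 2)].
Proof.
move=> /andP[a0 a1]; pose s := Num.sqrt (1 - (2 * a) ^+ 2).
have d0 : 0 <= 1 - (2 * a) ^+ 2 by rewrite subr_ge0 expr_le1 //; lra.
have s2 : s ^+ 2 = 1 - (2 * a) ^+ 2 by rewrite sqr_sqrtr.
have s0 : 0 <= s by exact: sqrtr_ge0.
have s1 : s <= 1 by rewrite -[leRHS]sqrtr1 ler_sqrt ?ler01 // gerBl sqr_ge0.
exists ((1 - s) / 2); split; first by lra.
  rewrite -sqrtrM; last by lra.
  rewrite (_ : _ * _ = a ^+ 2) ?sqrtr_sqr ?ger0_norm //.
  by move: s2; rewrite !expr2 => s2; nra.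
have -> : (a < 1 / 2) = (0 < s) by rewrite sqrtr_gt0 subr_gt0 expr_lt1 //; lra.
by apply/idP/idP; lra.
Qed.

End polar.

Section anti.
Variables (C : numClosedFieldType) (Q : starAlgType C).
Implicit Types (a b d w : Q) (c : C).

Definition anti a b := a * b + b * a.

Lemma antiC a b : anti a b = anti b a.
Proof. by rewrite /anti addrC. Qed.
Lemma antiDl a b d : anti (a + b) d = anti a d + anti b d.
Proof. by rewrite /anti mulrDl mulrDr addrACA. Qed.
Lemma antiDr a b d : anti d (a + b) = anti d a + anti d b.
Proof. by rewrite antiC antiDl !(antiC d). Qed.
Lemma antiZl c a b : anti (c *: a) b = c *: anti a b.
Proof. by rewrite /anti -scalerAl -scalerAr scalerDr. Qed.
Lemma antiZr c a b : anti a (c *: b) = c *: anti a b.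
Proof. by rewrite antiC antiZl antiC. Qed.
Lemma anti_star a b : star (anti a b) = anti (star a) (star b).
Proof. by rewrite /anti starD !starM addrC. Qed.
Lemma anti_refl a : anti a a = 2 *: (a * a).
Proof. by rewrite /anti scaler_nat mulr2n. Qed.

Lemma anti_eqZ a c : anti a a = (2 * c)%:A -> a * a = c%:A.
Proof.
rewrite anti_refl -scalerA => /(congr1 (fun u => 2^-1 *: u)).
by rewrite ![2^-1 *: _]scalerA mulVf ?pnatr_eq0 // !scale1r.
Qed.

Lemma anti0_comm a b d : anti a d = 0 -> anti b d = 0 -> GRing.comm (a * b) d.
Proof.
move=> /eqP; rewrite addr_eq0 => /eqP ad /eqP; rewrite addr_eq0 => /eqP bd.
by rewrite /GRing.comm -mulrA bd mulrN [a * (d * b)]mulrA ad mulNr opprK mulrA.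
Qed.

End anti.

Definition anti_simp := (antiDl, antiDr, antiZl, antiZr).

(** * Weighted fermions in a *-algebra without degenerate or negative squares *)

Section proper_algebra.
Variables (R : realType) (Q : starAlgType R[i]).
Hypotheses (sqr0 : forall s : Q, star s = s -> s * s = 0 -> s = 0)
  (sqr_ge0 : forall (s : Q) (r : R), star s = s -> s * s = r%:C%:A -> 0 <= r).
Implicit Types (w e b : Q) (c z : R[i]) (k x : R).

(** For a unit t the self-adjoint element t w + conj(t) w^* has square 2 Re(t^2 c) + k. The worst
    phase makes it k - 2|c|, which must be nonnegative; if it is 0 the element vanishes and ties w^*
    to w. *)
Lemma weak_fermion_normal w c k : anti w w = (2 * c)%:A -> anti w (star w) = k%:C%:A ->
  2 * normc c <= k /\
  (2 * normc c = k -> forall z, normc z = 1 -> c = z * (normc c)%:C ->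
     star w = Num.conj z *: w).
Proof.
move=> ww ws.
have ss : anti (star w) (star w) = (2 * Num.conj c)%:A.
  by rewrite -anti_star ww starZ star1 rmorphM rmorph_nat.
have key z : normc z = 1 -> c = z * (normc c)%:C -> exists2 t : R[i],
    normc t = 1 & t * t = - Num.conj z /\
    (t *: w + Num.conj t *: star w) * (t *: w + Num.conj t *: star w) =
      (k - 2 * normc c)%:C%:A.
  move=> nz cE; have zz := conj_unit nz.
  (* The phase with t^2 z = -1, which minimizes the square. *)
  pose t := sqrtC (- Num.conj z).
  have t2 : t * t = - Num.conj z by rewrite -expr2 sqrtCK.
  have nt : normc t = 1.
    have : normc t ^+ 2 = 1 by rewrite expr2 -normcM t2 normcN normc_conj.
    by move/eqP; rewrite sqrp_eq1 ?normc_ge0 // => /eqP.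
  exists t => //; split => //; have tt := conj_unit nt.
  apply: anti_eqZ; rewrite !anti_simp [anti (star w) w]antiC ww ws ss.
  rewrite !scalerDr !scalerA -!scalerDl; congr (_%:A).
  have c2 : Num.conj t * Num.conj t = - z by rewrite -rmorphM t2 rmorphN /= conjCK.
  rewrite rmorphB rmorphM rmorph_nat /=.
  have ccE : Num.conj c = Num.conj z * (normc c)%:C by rewrite {1}cE rmorphM /= conj_real.
  transitivity (t * t * (2 * c) + Num.conj t * t * k%:C * 2
                + Num.conj t * Num.conj t * (2 * Num.conj c)); first by ring.
  rewrite t2 c2 tt ccE {1}cE.
  transitivity (2 * k%:C - 4 * (normc c)%:C * (Num.conj z * z)); first by ring.
  by rewrite zz; ring.
split.
  have [z nz cE] := polar c; have [t nt [_ e]] := key z nz cE.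
  rewrite -subr_ge0; apply: sqr_ge0 e.
  by rewrite starD !starZ starK conjCK addrC.
move=> kE z nz cE; have [t nt [t2 e]] := key z nz cE.
move: e; rewrite -kE subrr scale0r => /sqr0.
rewrite starD !starZ starK conjCK addrC => /(_ erefl)/eqP; rewrite addr_eq0 => /eqP.
move/(congr1 (fun u => t *: u)); rewrite scalerN !scalerA [t * Num.conj t]mulrC (conj_unit nt) scale1r.
by rewrite t2 scaleNr => /oppr_inj ->.
Qed.

(** A Bogoliubov transformation: with u = sqrt(1 - x) and v = sqrt x, the system formed by w = u e +
    z v e^* and its adjoint is solved for e. Its determinant u^2 - v^2 = 1 - 2x is nonzero because x
    < 1/2. *)
Lemma normalized_fermion w x z : anti w (star w) = 1 -> normc z = 1 -> 0 <= x < 1 / 2 ->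
  anti w w = (2 * (z * (Num.sqrt x * Num.sqrt (1 - x))%:C))%:A ->
  exists e, [/\ fermion e,
    w = (Num.sqrt (1 - x))%:C *: e + (z * (Num.sqrt x)%:C) *: star e &
    exists c1 c2, e = c1 *: w + c2 *: star w].
Proof.
move=> ws nz /andP[x0 x1] ww.
set u := Num.sqrt (1 - x) in ww *; set v := Num.sqrt x in ww *.
have u2 : u ^+ 2 = 1 - x by rewrite sqr_sqrtr //; lra.
have v2 : v ^+ 2 = x by rewrite sqr_sqrtr.
have cz := conj_unit nz.
have ss : anti (star w) (star w) = (2 * (Num.conj z * (v * u)%:C))%:A.
  by rewrite -anti_star ww starZ star1 !rmorphM /= rmorph_nat !conj_real.
pose d := 1 - 2 * x; have d0 : 0 < d by rewrite /d; lra.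
have dC : d%:C != 0 :> R[i] by rewrite fmorph_eq0 gt_eqF.
pose U : R[i] := u%:C; pose V : R[i] := v%:C.
have UV : U ^+ 2 + V ^+ 2 = 1.
  by rewrite -!rmorphXn -rmorphD u2 v2 /= subrK.
have dE : d%:C = U ^+ 2 - V ^+ 2.
  by rewrite -!rmorphXn -rmorphB u2 v2 /d /=; congr (_%:C); ring.
have dU : U ^+ 2 - V ^+ 2 != 0 by rewrite -dE.
pose p : R[i] := U / d%:C; pose q z : R[i] := - (z * V) / d%:C.
pose e := p *: w + q z *: star w.
have se : star e = p *: star w + q (Num.conj z) *: w.
  rewrite starD !starZ starK /p /q; congr (_ *: _ + _ *: _).
    by rewrite rmorphM fmorphV /= !conj_real.
  by rewrite rmorphM rmorphN rmorphM fmorphV /= !conj_real.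
have UV' : V ^+ 2 = 1 - U ^+ 2 by rewrite -UV addrC addKr.
exists e; split; last by exists p, (q z).
- split.
    apply/eqP; rewrite -[X in _ == X](scale0r 1); apply/eqP; apply: anti_eqZ.
    rewrite mulr0 /e !anti_simp [anti (star w) w]antiC ww ws ss.
    rewrite !scalerA -!scalerDl; congr (_%:A).
    transitivity (2 * U * V * z / d%:C ^+ 2 * (U ^+ 2 + V ^+ 2 * (Num.conj z * z) - 1)).
      by rewrite /p /q !rmorphM -/U -/V /=; field.
    by rewrite cz mulr1 UV subrr mulr0.
  rewrite -[LHS]/(anti e (star e)) se /e !anti_simp [anti (star w) w]antiC ww ws ss.
  rewrite -[RHS]scale1r.
  rewrite !scalerA -!scalerDl; congr (_%:A).
  transitivity ((U ^+ 2 + V ^+ 2 * (Num.conj z * z) - 2 * U ^+ 2 * V ^+ 2 * (Num.conj z * z) * 2) / d%:C ^+ 2).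
    by rewrite /p /q !rmorphM -/U -/V /=; field.
  rewrite cz !mulr1 UV dE; apply: (mulIf (expf_neq0 2 dU)).
  by rewrite divfK ?expf_neq0 // mul1r UV'; ring.
- rewrite se /e !scalerDr !scalerA [X in _ = _ + X]addrC addrACA -!scalerDl.
  have -> : U * p + z * V * q (Num.conj z) = 1.
    transitivity ((U ^+ 2 - V ^+ 2 * (Num.conj z * z)) / d%:C).
      by rewrite /p /q; field.
    by rewrite cz mulr1 -dE divff.
  have -> : U * q z + z * V * p = 0 by rewrite /p /q; field.
  by rewrite scale1r scale0r addr0.
Qed.

End proper_algebra.

(** * Fibres over D_y x T^2 *)

Section generators.
Variable R : realType.
Implicit Types (x : R) (y z : R[i]).

Definition wt x : R[i] := (Num.sqrt x)%:C.

(** A weighted fermion: nilpotent at x = 0, where the phase is lost, and a unitary divided by sqrt 2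
    at x = 1/2. *)
Definition alphamx x z : 'M[R[i]]_2 := \matrix_(i, j)
  (if i == 0 then if j == 0 then 0 else wt (1 - x)
   else if j == 0 then z * wt x else 0).

Definition signmx : 'M[R[i]]_2 :=
  \matrix_(i, j) (if i == j then if i == 0 then 1 else -1 else 0).

(** With c the scalar square of the first generator a, the conditions {a, g} = y and {a^*, g} = 0 on
    g = r a + s a^* + ... read 2 r c + s = y and r + 2 s conj(c) = 0. Since 1 - 4|c|^2 = (1 - 2x)^2,
    they give [scoef] and [rcoef]; [kcoef] is then fixed by {g, g^*} = 1. *)
Definition scoef y x : R[i] := y / ((1 - 2 * x) ^+ 2)%:C.
Definition rcoef y x z : R[i] := - 2 * scoef y x * Num.conj (z * (wt x * wt (1 - x))).
Definition kcoef y x : R[i] := wt (1 - normc y ^+ 2 / (1 - 2 * x) ^+ 2).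

Definition gen1 x z : 'M[R[i]]_4 := alphamx x z *t (1%:M : 'M[R[i]]_2).
(* [r gen1 + s gen1^* ] is the part of the second generator that does not
   anticommute with [gen1] and [gen1^* ]. *)
Definition gen2 y x1 x2 z1 z2 : 'M[R[i]]_4 :=
  (rcoef y x1 z1 *: alphamx x1 z1 + scoef y x1 *: (alphamx x1 z1) ^t*)
    *t (1%:M : 'M[R[i]]_2)
  + signmx *t (kcoef y x1 *: (alphamx x2 z2)^T).

Definition blk (i j : 'I_2) (F : 'M[R[i]]_4) : 'M[R[i]]_2 :=
  \matrix_(k, l) F (@mxtens_index 2 2 (i, k)) (@mxtens_index 2 2 (j, l)).

Lemma blk_tens i j (A B : 'M[R[i]]_2) : blk i j (A *t B) = A i j *: B.
Proof. by apply/matrixP => k l; rewrite !mxE !mxtens_indexK. Qed.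

Lemma blkD i j F G : blk i j (F + G) = blk i j F + blk i j G.
Proof. by apply/matrixP => k l; rewrite !mxE. Qed.

Lemma blkZ i j c F : blk i j (c *: F) = c *: blk i j F.
Proof. by apply/matrixP => k l; rewrite !mxE. Qed.

Lemma blk_star i j F : blk i j (F ^t*) = (blk j i F) ^t*.
Proof. by apply/matrixP => k l; rewrite !mxE. Qed.

Lemma sum_mxtens (V : nmodType) (f : 'I_4 -> V) :
  \sum_m f m = \sum_(i < 2) \sum_(k < 2) f (@mxtens_index 2 2 (i, k)).
Proof.
rewrite pair_big /= (reindex (fun p : 'I_2 * 'I_2 => @mxtens_index 2 2 p : 'I_4)) /=.
  by apply: eq_bigr => -[].
by exists (@mxtens_unindex 2 2) => [p _|m _]; [exact: (@mxtens_indexK 2 2)|exact: (@mxtens_unindexK 2 2)].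
Qed.

Lemma blkM i j F G : blk i j (F *m G) = \sum_k blk i k F *m blk k j G.
Proof.
apply/matrixP => k l; rewrite mxE summxE mxE sum_mxtens.
by apply: eq_bigr => m _; rewrite mxE; apply: eq_bigr => n _; rewrite !mxE.
Qed.

Lemma blk1 i j : blk i j 1%:M = (i == j)%:R.
Proof.
apply/matrixP => k l; rewrite !mxE (can_eq (@mxtens_indexK 2 2)) xpair_eqE.
by case: eqP; rewrite ?mxE //= ?mulr1n ?mulr0n ?mxE.
Qed.

End generators.

(* A *-homomorphism on the *-algebra [S] of admissible boundary values, extended
   linearly to all matrices. *)
Record partial_rep (C : numClosedFieldType) (Q : starAlgType C) n
  (S : 'M[C]_n.+1 -> Prop) (f : 'M[C]_n.+1 -> Q) : Prop := {
  prS1 : S 1%:M;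
  pr1 : f 1%:M = 1;
  prSD : forall F G, S F -> S G -> S (F + G);
  prD : forall F G, f (F + G) = f F + f G;
  prSZ : forall c F, S F -> S (c *: F);
  prZ : forall c F, f (c *: F) = c *: f F;
  prSM : forall F G, S F -> S G -> S (F *m G);
  prM : forall F G, S F -> S G -> f (F *m G) = f F * f G;
  prSstar : forall F, S F -> S (F ^t*);
  prStar : forall F, S F -> f (F ^t*) = star (f F)
}.

Section fibre.
Variables (R : realType) (Q : starAlgType R[i]).
Hypotheses (sqr0 : forall s : Q, star s = s -> s * s = 0 -> s = 0)
  (sqr_ge0 : forall (s : Q) (r : R), star s = s -> s * s = r%:C%:A -> 0 <= r).
Implicit Types (w e b : Q) (c z : R[i]) (k x : R).

Lemma mxrep_partial e : fermion e -> partial_rep (fun=> True) (mxrep e).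
Proof.
move=> fe; split=> //; [exact: mxrep1|exact: mxrepD|exact: mxrepZ|..].
  by move=> F G _ _; exact: mxrepM.
by move=> F _; exact: mxrep_star.
Qed.

Lemma partial_rep0 n S f : @partial_rep R[i] Q n S f -> f 0 = 0.
Proof. by move=> pf; rewrite -(scale0r 0) (prZ pf) scale0r. Qed.

(** The fermion represents the first tensor factor and [f] the second one; they multiply because the
    range of [f] commutes with [e] and [star e]. *)
Lemma partial_rep_tens e S f : fermion e -> @partial_rep R[i] Q 1 S f ->
  (forall G, GRing.comm (f G) e) -> (forall G, GRing.comm (f G) (star e)) ->
  @partial_rep R[i] Q 3 (fun F => forall i j, S (blk i j F))
    (fun F => blockrep e (fun i j => f (blk i j F))).
Proof.
move=> fe pf c1 c2.
have S0 : S 0 by rewrite -(scale0r 1%:M); apply: (prSZ pf); exact: prS1 pf.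
have fsum (F : 'I_2 -> 'M[R[i]]_2) : f (\sum_i F i) = \sum_i f (F i).
  by rewrite !sum_ord2 (prD pf).
split.
- move=> i j; rewrite blk1; case: eqP => _; first exact: prS1 pf.
  exact: S0.
- rewrite -(blockrep1 fe); congr blockrep; apply/funext => i; apply/funext => j.
  by rewrite blk1; case: eqP => _; [exact: pr1 pf|exact: partial_rep0 pf].
- by move=> F G SF SG i j; rewrite blkD; apply: (prSD pf).
- move=> F G; rewrite -blockrepD; congr blockrep.
  by apply/funext => i; apply/funext => j; rewrite blkD (prD pf).
- by move=> c F SF i j; rewrite blkZ; apply: (prSZ pf).
- move=> c F; rewrite -blockrepZ; congr blockrep.
  by apply/funext => i; apply/funext => j; rewrite blkZ (prZ pf).
- move=> F G SF SG i j; rewrite blkM sum_ord2.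
  by apply: (prSD pf); apply: (prSM pf).
- move=> F G SF SG; rewrite blockrepM //; congr blockrep.
  apply/funext => i; apply/funext => j; rewrite blkM fsum.
  by apply: eq_bigr => k _; rewrite (prM pf).
- by move=> F SF i j; rewrite blk_star; apply: (prSstar pf).
- move=> F SF; rewrite blockrep_star //; congr blockrep.
  by apply/funext => i; apply/funext => j; rewrite blk_star (prStar pf).
Qed.

Lemma blockrep_tens e S f (A B : 'M[R[i]]_2) : @partial_rep R[i] Q 1 S f ->
  blockrep e (fun i j => f (blk i j (A *t B))) = mxrep e A * f B.
Proof.
move=> pf; rewrite /mxrep /blockrep mulr_suml; apply: eq_bigr => i _.
rewrite mulr_suml; apply: eq_bigr => j _.
by rewrite blk_tens (prZ pf) -!scalerAr mulr1 -scalerAl.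
Qed.

Lemma mul_mx2 (A B : 'M[R[i]]_2) i j : (A *m B) i j = A i 0 * B 0 j + A i 1 * B 1 j.
Proof. by rewrite mxE sum_ord2. Qed.

(** The second factor on the face x1 = [xmax y], where only scalars survive. *)
Lemma scalar_partial : @partial_rep R[i] Q 1
  (fun G => [/\ G 0 1 = 0, G 1 0 = 0 & G 0 0 = G 1 1]) (fun G => (G 0 0)%:A).
Proof.
split.
- by rewrite !mxE.
- by rewrite mxE eqxx scale1r.
- by move=> F G [a b c] [d e f]; rewrite !mxE a b c d e f !addr0.
- by move=> F G; rewrite mxE scalerDl.
- by move=> c F [a b d]; rewrite !mxE a b d !mulr0.
- by move=> c F; rewrite mxE scalerA.
- by move=> F G [a b c] [d e f]; rewrite !mul_mx2 a b c d e f !mulr0 !mul0r !addr0 add0r.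
- by move=> F G [a b c] [d e f]; rewrite mul_mx2 a mul0r addr0 -scalerAl mul1r scalerA.
- by move=> F [a b c]; rewrite !mxE a b c rmorph0.
- by move=> F _; rewrite !mxE starZ star1.
Qed.

Lemma reflection_partial w z : normc z = 1 -> w * w = z%:A -> star w = Num.conj z *: w ->
  @partial_rep R[i] Q 1 (fun G => G 0 0 = G 1 1 /\ G 0 1 = z * G 1 0)
    (fun G => (G 0 0)%:A + G 1 0 *: w).
Proof.
move=> nz ww sw; have cz := conj_unit nz; split.
- by rewrite !mxE /= mulr0.
- by rewrite !mxE /= scale0r addr0 scale1r.
- by move=> F G [a b] [c d]; rewrite !mxE a b c d mulrDr.
- by move=> F G; rewrite !mxE !scalerDl addrACA.
- by move=> c F [a b]; rewrite !mxE a b mulrCA.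
- by move=> c F; rewrite !mxE scalerDr !scalerA.
- by move=> F G [a b] [c d]; rewrite !mul_mx2 a b c d; split; ring.
- move=> F G [a b] [c d]; rewrite !mul_mx2 b a c.
  move: (F 1 1) (F 1 0) (G 1 1) (G 1 0) => p t p' t'.
  rewrite [RHS]mulrDr ![in RHS]mulrDl !mulr_algl !mulr_algr.
  have -> : (t *: w) * (t' *: w) = (z * t * t')%:A.
    by rewrite -scalerAl -scalerAr ww !scalerA mulrC mulrA.
  by rewrite !scalerA !scalerDl [p' * t]mulrC [LHS]addrACA; congr (_ + _); exact: addrC.
- move=> F [a b]; rewrite !mxE a b rmorphM /=; split => //.
  by rewrite mulrA mulrC [z * _]mulrC cz mulr1.
- move=> F [a b]; rewrite !mxE starD !starZ star1 sw b scalerA rmorphM /=.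
  by rewrite mulrC.
Qed.

(** Three cases: k = 0 forces w = 0; otherwise the normalized w is built from a genuine fermion if x
    < 1/2, and is a multiple of a unitary if x = 1/2. The commutation clause is what allows gluing
    with the first factor. *)
Lemma second_factor w c k : anti w w = (2 * c)%:A -> anti w (star w) = k%:C%:A ->
  0 <= k /\ exists x z S f,
  [/\ 0 <= x <= 1 / 2, normc z = 1, @partial_rep R[i] Q 1 S f &
      [/\ S (wt k *: (alphamx x z)^T), f (wt k *: (alphamx x z)^T) = w &
      forall a, GRing.comm a w -> GRing.comm a (star w) -> forall G, GRing.comm (f G) a]].
Proof.
move=> ww ws; have [ck eqk] := weak_fermion_normal sqr0 sqr_ge0 ww ws.
have k0 : 0 <= k by apply: le_trans ck; rewrite mulr_ge0 ?normc_ge0.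
split => //; move: k0; rewrite le_eqVlt => /predU1P[k0|k0].
  have c0 : normc c = 0 by apply/le_anti; rewrite normc_ge0 andbT -(pmulr_rle0 _ (ltr0n R 2)) k0.
  have w0 : w = 0.
    (* As c = 0, every phase is a phase of c; z = 1 and z = -1 together give w^* = w and w^* =
       -w. *)
    have cE := eq0_normc c0.
    have sw z : normc z = 1 -> star w = Num.conj z *: w.
      by move=> nz; apply: eqk => //; rewrite cE normc0 mulr0.
    have := sw (- 1); rewrite normcN (sw 1) ?normc1 // rmorph1 scale1r => /(_ erefl).
    rewrite rmorphN rmorph1 scaleN1r => /eqP; rewrite -subr_eq0 opprK -mulr2n -scaler_nat.
    by rewrite scaler_eq0 pnatr_eq0 => /eqP.
  exists 0, 1, (fun G => [/\ G 0 1 = 0, G 1 0 = 0 & G 0 0 = G 1 1]), (fun G => (G 0 0)%:A).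
  split; [|exact: normc1|exact: scalar_partial|split].
  - by rewrite lexx divr_ge0.
  - by rewrite -k0 /wt sqrtr0 scale0r !mxE.
  - by rewrite -k0 /wt sqrtr0 scale0r mxE scale0r w0.
  - by move=> a _ _ G; exact: comm_alg.
pose w' := (Num.sqrt k)^-1%:C *: w.
have sk : 0 < Num.sqrt k by rewrite sqrtr_gt0.
have wE : w = wt k *: w'.
  by rewrite scalerA -rmorphM divff ?gt_eqF // scale1r.
have sw' : star w' = (Num.sqrt k)^-1%:C *: star w by rewrite starZ conj_real.
have i2 : (Num.sqrt k)^-1%:C * (Num.sqrt k)^-1%:C = k^-1%:C :> R[i].
  by rewrite -rmorphM -invfM -expr2 sqr_sqrtr ?ltW.
have ws' : anti w' (star w') = 1.
  by rewrite sw' !anti_simp ws !scalerA i2 -rmorphM mulVf ?gt_eqF // scale1r.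
have ww' : anti w' w' = (2 * (k^-1%:C * c))%:A.
  by rewrite !anti_simp ww !scalerA i2 mulrCA.
have [z nz zc] := polar (k^-1%:C * c); set a := normc _ in zc.
have aE : a = k^-1 * normc c.
  by rewrite /a normcM normc_real gtr0_norm // invr_gt0.
have ha : 0 <= a <= 1 / 2.
  rewrite normc_ge0 /= aE mulrC ler_pdivrMr //; lra.
have [x [x0 xa xlt]] := weight_of_modulus ha.
have commw d : GRing.comm d w -> GRing.comm d w'.
  by move=> h; rewrite /GRing.comm -scalerAr -scalerAl h.
have commsw d : GRing.comm d (star w) -> GRing.comm d (star w').
  by move=> h; rewrite sw' /GRing.comm -scalerAr -scalerAl h.
clearbody w'; exists x, z; have [alt|age] := boolP (a < 1 / 2).
  have x1 : 0 <= x < 1 / 2 by case/andP: x0 => -> _; rewrite xlt.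
  have ww2 : anti w' w' = (2 * (z * (Num.sqrt x * Num.sqrt (1 - x))%:C))%:A.
    by rewrite ww' zc xa.
  have [e [fe w'E [c1 [c2 eE]]]] := normalized_fermion ws' nz x1 ww2.
  have fs := fermion_star fe.
  (* The matrix is transposed, so [star e] takes the place of [e]. The transpose is imposed by
     [reflection_blk], where the phase sits in entry (0, 1). *)
  exists (fun=> True), (mxrep (star e)); split => //; first exact: mxrep_partial.
  split => //.
    rewrite mxrepZ [RHS]wE; congr (_ *: _).
    by rewrite mxrepE !mxE /= !scale0r add0r addr0 starK w'E addrC.
  move=> d dw ds G; apply: commr_sym.
  have de : GRing.comm d e.
    rewrite eE; apply: commrD; rewrite /GRing.comm -scalerAr -scalerAl; congr (_ *: _).
      exact: commw.
    exact: commsw.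
  have dse : GRing.comm d (star e).
    rewrite eE starD !starZ starK.
    apply: commrD; rewrite /GRing.comm -scalerAr -scalerAl; congr (_ *: _).
      exact: commsw.
    exact: commw.
  by apply: mxrep_comm; rewrite ?starK.
have xh : x = 1 / 2.
  by move: x0 xlt; rewrite (negbTE age) => x0 /negbT; rewrite -leNgt; lra.
have hE : a = 1 / 2 by move: ha age; rewrite -leNgt; lra.
have ws1 : anti w' (star w') = (1 : R)%:C%:A by rewrite rmorph1 scale1r.
have W : star w' = Num.conj z *: w'.
  have [_] := weak_fermion_normal sqr0 sqr_ge0 ww' ws1.
  rewrite -/a hE => h; apply: h => //; last by rewrite zc hE.
  lra.
pose h := (Num.sqrt 2)%:C : R[i].
have h2 : h * h = 2 by rewrite /h -rmorphM -expr2 sqr_sqrtr // rmorph_nat.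
have hw : wt (1 / 2) * h = 1.
  by rewrite /wt /h -rmorphM -sqrtrM ?divr_ge0 // mul1r mulVf ?pnatr_eq0 // sqrtr1.
have wtE : wt (1 - x) = wt x by rewrite xh; congr wt; lra.
exists (fun G => G 0 0 = G 1 1 /\ G 0 1 = z * G 1 0), (fun G => (G 0 0)%:A + G 1 0 *: (h *: w')).
split => //.
  apply: reflection_partial => //.
    rewrite -scalerAl -scalerAr scalerA h2 (anti_eqZ ww') scalerA zc hE; congr (_%:A).
    have -> : (1 / 2 : R)%:C = 2^-1 :> R[i] by rewrite mul1r fmorphV rmorph_nat.
    by field.
  by rewrite starZ conj_real W !scalerA mulrC.
split.
- by rewrite !mxE /= wtE !mulr0; split => //; rewrite mulrCA.
- by rewrite !mxE /= mulr0 scale0r add0r wtE xh scalerA -mulrA hw mulr1.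
- move=> d dw ds G; apply: commr_sym; apply: commrD; first exact: commr_alg.
  by rewrite /GRing.comm -!scalerAr -!scalerAl commw.
Qed.

(** The point (x1, z1) is read off from b1^2, and (x2, z2) from the square of the part of b2 that
    anticommutes with b1 and b1^*, made commuting with the first fermion by a grading operator. *)
Lemma fibre_rep y b1 b2 c1 c2 : y != 0 -> enveloping_relations y b1 b2 ->
  b1 * b1 = c1%:A -> b2 * b2 = c2%:A ->
  exists p S f, [/\ DT y p, @partial_rep R[i] Q 3 S f &
    [/\ S (gen1 p.1.1.1 p.1.2), f (gen1 p.1.1.1 p.1.2) = b1,
        S (gen2 y p.1.1.1 p.1.1.2 p.1.2 p.2) &
        f (gen2 y p.1.1.1 p.1.1.2 p.1.2 p.2) = b2]].
Proof.
move=> y0 [r1 r2 r3 r4] q1 q2.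
have a11 : anti b1 b1 = (2 * c1)%:A by rewrite anti_refl q1 scalerA.
have a22 : anti b2 b2 = (2 * c2)%:A by rewrite anti_refl q2 scalerA.
have a1s : anti b1 (star b1) = 1 by rewrite antiC.
have a2s : anti b2 (star b2) = 1 by rewrite antiC.
have as2 : anti (star b1) b2 = 0 by rewrite /anti r3 addNr.
have a1s2 : anti b1 (star b2) = 0 by rewrite -[b1]starK -anti_star as2 star0.
have a12 : anti b1 b2 = y%:A by [].
have as12 : anti (star b1) (star b2) = (Num.conj y)%:A.
  by rewrite -anti_star a12 starZ star1.
have ass : anti (star b1) (star b1) = (2 * Num.conj c1)%:A.
  by rewrite -anti_star a11 starZ star1 rmorphM rmorph_nat.
have a1s' : anti b1 (star b1) = (1 : R)%:C%:A by rewrite rmorph1 scale1r.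
have [le1 eq1] := weak_fermion_normal sqr0 sqr_ge0 a11 a1s'.
have [z1 nz1 c1E] := polar c1; have cz1 := conj_unit nz1.
(* At |c1| = 1/2 the element b1^* would be a multiple of b1, so {b1^*, b2} = 0 would contradict {b1,
   b2} = y != 0. *)
have lt1 : normc c1 < 1 / 2.
  rewrite ltNge; apply/negP => ge1.
  have sE : star b1 = Num.conj z1 *: b1 by apply: eq1 => //; lra.
  move: as2; rewrite sE antiZl a12 scalerA => /eqP.
  rewrite scaler_eq0 oner_eq0 orbF mulf_eq0 (negbTE y0) orbF => /eqP z0.
  by move/eqP: cz1; rewrite z0 mul0r eq_sym oner_eq0.
have [|x1 [x1h x1a x1lt]] := @weight_of_modulus R (normc c1).
  by rewrite normc_ge0 ltW.
have x1r : 0 <= x1 < 1 / 2 by case/andP: x1h => -> _; rewrite x1lt.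
have c1E' : c1 = z1 * (wt x1 * wt (1 - x1)) by rewrite -rmorphM x1a.
have a11' : anti b1 b1 = (2 * (z1 * (Num.sqrt x1 * Num.sqrt (1 - x1))%:C))%:A.
  by rewrite a11 x1a -c1E.
have [e [fe b1E [d1 [d2 eE]]]] := normalized_fermion a1s nz1 x1r a11'.
pose r := rcoef y x1 z1; pose s := scoef y x1.
pose d := 1 - 2 * x1; have d0 : 0 < d by rewrite /d; lra.
have dC : d%:C != 0 :> R[i] by rewrite fmorph_eq0 gt_eqF.
have rE : r = - 2 * s * Num.conj c1 by rewrite /r /rcoef -c1E'.
have sE : s = y / d%:C ^+ 2 by rewrite /s /scoef rmorphXn.
have dE : d%:C ^+ 2 = 1 - 4 * (Num.conj c1 * c1).
  have -> : Num.conj c1 * c1 = (normc c1 ^+ 2)%:C.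
    by rewrite -normCKC rmorphXn.
  rewrite -x1a exprMn !sqr_sqrtr; [|lra|lra].
  rewrite -rmorphXn -(rmorph_nat (real_complex R)) -(rmorph1 (real_complex R)).
  by rewrite -rmorphM -rmorphB /d; congr (_%:C); ring.
have rD : rcoef y x1 z1 = r by [].
have sD : scoef y x1 = s by [].
have dD : d = 1 - 2 * x1 by [].
have kD : kcoef y x1 = wt (1 - normc y ^+ 2 / d ^+ 2) by [].
clearbody r s d.
pose bt := b2 + (- r) *: b1 + (- s) *: star b1.
have sbt : star bt = star b2 + Num.conj (- r) *: star b1 + Num.conj (- s) *: b1.
  by rewrite /bt !starD !starZ starK.
have bt1 : anti bt b1 = 0.
  rewrite /bt !anti_simp [anti b2 b1]antiC a12 a11 [anti (star b1) b1]antiC a1s.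
  rewrite scalerA -!scalerDl.
  have -> : y + - r * (2 * c1) - s = y - s * (1 - 4 * (Num.conj c1 * c1)) by rewrite rE; ring.
  by rewrite -dE sE divfK ?expf_neq0 // subrr scale0r.
have bts : anti bt (star b1) = 0.
  rewrite /bt !anti_simp [anti b2 _]antiC as2 a1s ass add0r scalerA -scalerDl.
  by rewrite rE (_ : _ + _ = 0) ?scale0r //; ring.
have stbt1 : anti (star bt) b1 = 0 by rewrite -[b1]starK -anti_star bts star0.
have stbts : anti (star bt) (star b1) = 0 by rewrite -anti_star bt1 star0.
have btbt : anti bt bt = (2 * (c2 - r * y / 2))%:A.
  rewrite {2}/bt !antiDr !antiZr bt1 bts !scaler0 !addr0.
  rewrite /bt !antiDl !antiZl a22 a12 as2 scaler0 addr0 scalerA -scalerDl.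
  by congr (_%:A); field.
pose k := 1 - normc y ^+ 2 / d ^+ 2.
have kE : k%:C = 1 - s * Num.conj y.
  rewrite sE mulrAC -normCK rmorphB rmorphM fmorphV !rmorphXn rmorph1 //.
have btk : anti bt (star bt) = k%:C%:A.
  rewrite sbt !antiDr !antiZr bt1 bts !scaler0 !addr0.
  rewrite /bt !antiDl !antiZl a2s a1s2 as12 scaler0 addr0 scalerA kE.
  by rewrite -[X in X + _]scale1r -scalerDl mulNr.
have ae b : anti b b1 = 0 -> anti b (star b1) = 0 -> anti b e = 0.
  by move=> h1 h2; rewrite eE antiDr !antiZr h1 h2 !scaler0 addr0.
have aes b : anti b b1 = 0 -> anti b (star b1) = 0 -> anti b (star e) = 0.
  by move=> h1 h2; rewrite eE starD !starZ starK antiDr !antiZr h1 h2 !scaler0 addr0.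
have [ee es] := fe.
(* The Jordan-Wigner sign: g anticommutes with e and commutes with bt, while bt anticommutes with e.
   Hence g * bt commutes with e and e^*, and it has the same scalar square as bt. *)
pose g := munit e 0 0 - munit e 1 1.
have mE (i j m l : 'I_2) : munit e i j * munit e m l = (j == m)%:R *: munit e i l.
  exact: munitM.
have e01 : munit e 0 1 = e by [].
have e10 : munit e 1 0 = star e by [].
have n01 : (0 == 1 :> 'I_2) = false by [].
have n10 : (1 == 0 :> 'I_2) = false by [].
have ge : g * e = e by rewrite -[X in _ * X]e01 /g mulrBl !mE eqxx n10 scale1r scale0r subr0.
have eg : e * g = - e by rewrite -[X in X * _]e01 /g mulrBr !mE eqxx n10 scale1r scale0r sub0r.
have gs : g * star e = - star e by rewrite -[X in _ * X]e10 /g mulrBl !mE eqxx n01 scale1r scale0r sub0r.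
have sg : star e * g = star e by rewrite -[X in X * _]e10 /g mulrBr !mE eqxx n01 scale1r scale0r subr0.
have gg : g * g = 1.
  rewrite {1}/g mulrBl /g !mulrBr !mE !eqxx n01 n10 !scale1r !scale0r !subr0 sub0r opprK.
  by rewrite /munit !eqxx.
have stg : star g = g by rewrite starB !munit_star.
have cg b : anti b b1 = 0 -> anti b (star b1) = 0 -> GRing.comm b g.
  move=> h1 h2; apply: commrB; apply: commr_sym.
    by rewrite -[munit e 0 0]/(e * star e); apply: anti0_comm; rewrite antiC; [exact: ae|exact: aes].
  by rewrite -[munit e 1 1]/(star e * e); apply: anti0_comm; rewrite antiC; [exact: aes|exact: ae].
have cbt := cg _ bt1 bts; have csbt := cg _ stbt1 stbts.
pose w := g * bt.
have sw : star w = g * star bt by rewrite starM stg csbt.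
have ww : anti w w = (2 * (c2 - r * y / 2))%:A.
  rewrite -btbt /anti; have -> : w * w = bt * bt; last by [].
  by rewrite {1}/w -cbt -mulrA /w [g * (g * _)]mulrA gg mul1r.
have ws : anti w (star w) = k%:C%:A.
  rewrite -btk /anti; congr (_ + _).
    by rewrite {1}/w sw -cbt -mulrA [g * (g * _)]mulrA gg mul1r.
  by rewrite sw -csbt /w -mulrA [g * (g * _)]mulrA gg mul1r.
have nC a b : anti a b = 0 -> a * b = - (b * a).
  by move=> /eqP; rewrite addr_eq0 => /eqP.
have we : GRing.comm e w.
  by rewrite /GRing.comm /w mulrA eg -mulrA (nC _ _ (ae _ bt1 bts)) mulrN mulrA ge mulNr.
have wse : GRing.comm (star e) w.
  rewrite /GRing.comm /w mulrA sg -mulrA (nC _ _ (aes _ bt1 bts)) mulrN mulrA gs.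
  by rewrite mulNr opprK.
have swe : GRing.comm e (star w).
  by rewrite /GRing.comm sw mulrA eg -mulrA (nC _ _ (ae _ stbt1 stbts)) mulrN mulrA ge mulNr.
have swse : GRing.comm (star e) (star w).
  rewrite /GRing.comm sw mulrA sg -mulrA (nC _ _ (aes _ stbt1 stbts)) mulrN mulrA gs.
  by rewrite mulNr opprK.
have [k0 [x2 [z2 [S [f [x2h nz2 pf [Sb fb fc]]]]]]] := second_factor ww ws.
have pt := partial_rep_tens fe pf (fc _ we swe) (fc _ wse swse).
rewrite -/k -kD in Sb fb.
exists (x1, x2, z1, z2), (fun F => forall i j, S (blk i j F)),
  (fun F => blockrep e (fun i j => f (blk i j F))).
have S1 := prS1 pf.
have ralpha : mxrep e (alphamx x1 z1) = b1.
  by rewrite mxrepE !mxE /= !scale0r add0r addr0.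
split => //=.
  split => //=; rewrite /xmax; case/andP: x1h => -> _ /=.
  (* Nonnegativity of {w, w^*} gives |y| <= 1 - 2 x1, which is the upper bound on x1 in D_y. *)
  have : normc y ^+ 2 <= d ^+ 2.
    by move: k0; rewrite /k subr_ge0 ler_pdivrMr ?exprn_gt0 // mul1r.
  rewrite ler_pXn2r ?nnegrE ?normc_ge0 ?(ltW d0) // dD; lra.
split.
- by move=> i j; rewrite blk_tens; apply: (prSZ pf).
- by rewrite (blockrep_tens _ _ _ pf) (pr1 pf) mulr1.
- by move=> i j; rewrite blkD !blk_tens; apply: (prSD pf); apply: (prSZ pf).
- rewrite (prD pt) !(blockrep_tens _ _ _ pf) (pr1 pf) mulr1 mxrepD !mxrepZ mxrep_star ralpha.
  rewrite fb; have -> : mxrep e (signmx R) = g.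
    rewrite mxrepE !mxE /= !scale0r !addr0 scale1r scaleN1r.
    by rewrite /g /munit !eqxx.
  rewrite /w mulrA gg mul1r /bt rD sD !scaleNr.
  move: (r *: b1) (s *: star b1) => X Y.
  by rewrite [LHS]addrC -[b2 - X - Y]addrA -opprD subrK.
Qed.

End fibre.

(** * The operator norm *)

Lemma real_cauchy_cvg (R : realType) (u : nat -> R) :
  (forall e : R, 0 < e -> exists N, forall m n, (N <= m)%N -> (N <= n)%N -> `|u m - u n| < e) ->
  exists l, forall e : R, 0 < e -> exists N, forall n, (N <= n)%N -> `|u n - l| < e.
Proof.
move=> cu; have /cvg_ex[l ul] : cvg (u @ \oo).
  apply/cauchy_cvgP/cauchy_ballP => e e0; have [N hN] := cu e e0.
  exists (u @` [set m | (N <= m)%N], u @` [set m | (N <= m)%N]).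
    by split; exists N => // m hm; exists m.
  by move=> _ [/= [m hm <-] [n hn <-]]; exact: hN.
exists l => e e0; move/cvgrPdist_lt: ul => /(_ e e0)[N _ hN].
by exists N => n /hN /=; rewrite distrC.
Qed.

Section complex_norm.
Variable R : realType.
Implicit Types c d : R[i].

Lemma normc_le_ReIm c : normc c <= `|complex.Re c| + `|complex.Im c|.
Proof.
case: c => a b /=; have h : 0 <= `|a| + `|b| by rewrite addr_ge0.
rewrite -(ger0_norm h) -sqrtr_sqr; apply: ler_wsqrtr; rewrite sqrrD.
by rewrite -!normrX !(ger0_norm (sqr_ge0 _)) -addrA lerD2l lerDr mulrn_wge0 ?mulr_ge0.
Qed.

Lemma Re_le_normc c : `|complex.Re c| <= normc c.
Proof. by case: c => a b /=; rewrite -sqrtr_sqr ler_wsqrtr // lerDl sqr_ge0. Qed.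

Lemma Im_le_normc c : `|complex.Im c| <= normc c.
Proof. by case: c => a b /=; rewrite -sqrtr_sqr ler_wsqrtr // lerDr sqr_ge0. Qed.

Lemma normc_eq0E c : (normc c == 0) = (c == 0).
Proof. by apply/eqP/eqP => [/eq0_normc//|->]; rewrite normc0. Qed.

Lemma complex_cauchy_cvg (u : nat -> R[i]) :
  (forall e : R, 0 < e -> exists N, forall m n, (N <= m)%N -> (N <= n)%N ->
     normc (u m - u n) < e) ->
  exists l, forall e : R, 0 < e -> exists N, forall n, (N <= n)%N -> normc (u n - l) < e.
Proof.
move=> cu.
have [|a ha] := @real_cauchy_cvg R (fun n => complex.Re (u n)).
  move=> e /cu[N hN]; exists N => m n hm hn; apply: le_lt_trans (hN m n hm hn).
  by rewrite -raddfB; exact: Re_le_normc.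
have [|b hb] := @real_cauchy_cvg R (fun n => complex.Im (u n)).
  move=> e /cu[N hN]; exists N => m n hm hn; apply: le_lt_trans (hN m n hm hn).
  by rewrite -raddfB; exact: Im_le_normc.
exists (a +i* b) => e e0; have e2 : 0 < e / 2 by lra.
have [N hN] := ha _ e2; have [N' hN'] := hb _ e2.
exists (maxn N N') => n; rewrite geq_max => /andP[/hN h1 /hN' h2].
apply: le_lt_trans (normc_le_ReIm _) _; rewrite !raddfB /=; lra.
Qed.

End complex_norm.

Section operator_norm.
Variables (R : realType) (m : nat).
Let n := m.+1.
Implicit Types (u v : 'cV[R[i]]_n) (A B : 'M[R[i]]_n) (a b : 'I_n -> R).

Lemma cauchy_schwarz_sum a b :
  (\sum_i a i * b i) ^+ 2 <= (\sum_i a i ^+ 2) * (\sum_i b i ^+ 2).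
Proof.
set S := \sum_i a i * b i; set X := \sum_i a i ^+ 2; set Y := \sum_i b i ^+ 2.
have Y0 : 0 <= Y by apply: sumr_ge0 => i _; exact: sqr_ge0.
move: Y0; rewrite le_eqVlt => /predU1P[Y0|Y0].
  have b0 i : b i = 0.
    have /psumr_eq0P : forall i, true -> 0 <= b i ^+ 2 by move=> *; exact: sqr_ge0.
    by move=> /(_ (esym Y0) i isT)/eqP; rewrite sqrf_eq0 => /eqP.
  by rewrite /S big1 ?expr0n -?Y0 ?mulr0 // => i _; rewrite b0 mulr0.
have : 0 <= \sum_i (a i * Y - b i * S) ^+ 2 by apply: sumr_ge0 => i _; exact: sqr_ge0.
have -> : \sum_i (a i * Y - b i * S) ^+ 2 = Y * (X * Y - S ^+ 2).
  transitivity (\sum_i (a i ^+ 2 * Y ^+ 2 - a i * b i * (2 * Y * S) + b i ^+ 2 * S ^+ 2)).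
    by apply: eq_bigr => i _; ring.
  by rewrite big_split sumrB /= -!mulr_suml -/X -/Y -/S; ring.
by rewrite pmulr_rge0 // subr_ge0.
Qed.

Definition vnorm v : R := Num.sqrt (\sum_i normc (v i 0) ^+ 2).

Lemma vnorm_ge0 v : 0 <= vnorm v.
Proof. exact: sqrtr_ge0. Qed.

Lemma vnorm_sqr v : vnorm v ^+ 2 = \sum_i normc (v i 0) ^+ 2.
Proof. by rewrite sqr_sqrtr // sumr_ge0 // => i _; exact: sqr_ge0. Qed.

Lemma cauchy_schwarz_vnorm u v : \sum_i normc (u i 0) * normc (v i 0) <= vnorm u * vnorm v.
Proof.
have h : 0 <= vnorm u * vnorm v by rewrite mulr_ge0 ?vnorm_ge0.
rewrite -(ger0_norm h) -sqrtr_sqr exprMn !vnorm_sqr.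
apply: le_trans (ler_wsqrtr (cauchy_schwarz_sum _ _)).
by rewrite sqrtr_sqr ler_norm.
Qed.

Lemma vnormD u v : vnorm (u + v) <= vnorm u + vnorm v.
Proof.
rewrite -(ler_pXn2r (ltn0Sn 1)) ?nnegrE ?addr_ge0 ?vnorm_ge0 // sqrrD !vnorm_sqr.
have := cauchy_schwarz_vnorm u v; set S := \sum_i _ => cs.
apply: (@le_trans _ _ (\sum_i (normc (u i 0) ^+ 2 + normc (u i 0) * normc (v i 0) *+ 2
                               + normc (v i 0) ^+ 2))).
  apply: ler_sum => i _; rewrite mxE -sqrrD.
  by apply: lerXn2r; rewrite ?nnegrE ?addr_ge0 ?normc_ge0 // le_normcD.
by rewrite !big_split /= -/S lerD2r lerD2l mulr2n lerD.
Qed.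

Lemma vnormZ c v : vnorm (c *: v) = normc c * vnorm v.
Proof.
rewrite -[normc c]ger0_norm ?normc_ge0 // -sqrtr_sqr -sqrtrM ?sqr_ge0 //.
by congr Num.sqrt; rewrite mulr_sumr; apply: eq_bigr => i _; rewrite mxE normcM exprMn.
Qed.

Lemma vnorm0 : vnorm 0 = 0.
Proof. by rewrite -(scale0r 0) vnormZ normc0 mul0r. Qed.

Lemma normc_le_vnorm v i : normc (v i 0) <= vnorm v.
Proof.
rewrite -[leLHS]ger0_norm ?normc_ge0 // -sqrtr_sqr; apply: ler_wsqrtr.
by rewrite (bigD1 i) //= lerDl sumr_ge0 // => j _; exact: sqr_ge0.
Qed.

Lemma vnorm_eq0 v : vnorm v = 0 -> v = 0.
Proof.
move=> v0; apply/colP => i; rewrite [RHS]mxE; apply/eqP; rewrite -normc_eq0E.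
by rewrite eq_le normc_ge0 -v0 normc_le_vnorm.
Qed.

Lemma vnorm_delta (j : 'I_n) : vnorm (delta_mx j 0) = 1.
Proof.
rewrite /vnorm (bigD1 j) //= big1 => [|i ij]; rewrite mxE ?eqxx ?(negbTE ij) ?andbF.
  by rewrite (normc1 R) expr1n addr0 sqrtr1.
by rewrite (normc0 R) expr0n.
Qed.

Definition entry_sum A : R := \sum_i \sum_j normc (A i j).

Lemma vnorm_sum (I : Type) (r : seq I) (F : I -> 'cV[R[i]]_n) :
  vnorm (\sum_(i <- r) F i) <= \sum_(i <- r) vnorm (F i).
Proof.
elim: r => [|i r IH]; first by rewrite !big_nil vnorm0.
by rewrite !big_cons; apply: le_trans (vnormD _ _) _; rewrite lerD2l.
Qed.

(** A crude bound, used to make the supremum defining [opnorm] finite and to pass from entrywise to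
    norm convergence. *)
Lemma vnorm_mul_le A v : vnorm (A *m v) <= entry_sum A * vnorm v.
Proof.
have -> : A *m v = \sum_i \sum_j (A i j * v j 0) *: delta_mx i 0.
  apply/colP => k; rewrite summxE [RHS](bigD1 k) //= [X in _ = _ + X]big1 ?addr0.
    rewrite summxE mxE; apply: eq_bigr => j _; rewrite !mxE !eqxx /= mulr1 //.
  move=> i ik; rewrite summxE big1 // => j _.
  by rewrite !mxE eq_sym (negbTE ik) /= mulr0.
apply: le_trans (vnorm_sum _ _) _; rewrite /entry_sum mulr_suml; apply: ler_sum => i _.
apply: le_trans (vnorm_sum _ _) _; rewrite mulr_suml; apply: ler_sum => j _.
rewrite vnormZ vnorm_delta mulr1 normcM ler_wpM2l ?normc_ge0 //.
exact: normc_le_vnorm.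
Qed.

Definition opnorm A : R := sup [set vnorm (A *m v) | v in [set v | vnorm v <= 1]].

Let opset_nonempty A : [set vnorm (A *m v) | v in [set v | vnorm v <= 1]] !=set0.
Proof. by exists (vnorm (A *m 0)); exists 0 => //=; rewrite vnorm0. Qed.

Let opset_ub A : has_ubound [set vnorm (A *m v) | v in [set v | vnorm v <= 1]].
Proof.
exists (entry_sum A) => _ [v /= v1 <-]; apply: le_trans (vnorm_mul_le _ _) _.
rewrite ler_piMr //; apply: sumr_ge0 => i _; apply: sumr_ge0 => j _; exact: normc_ge0.
Qed.

Lemma opnorm_ge0 A : 0 <= opnorm A.
Proof.
apply: le_trans (vnorm_ge0 (A *m 0)) _; apply: ub_le_sup => //.
by exists 0 => //=; rewrite vnorm0.
Qed.

Lemma vnorm_mul A v : vnorm (A *m v) <= opnorm A * vnorm v.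
Proof.
have [/vnorm_eq0 ->|v0] := eqVneq (vnorm v) 0; first by rewrite mulmx0 vnorm0 mulr0.
have vp : 0 < vnorm v by rewrite lt_neqAle eq_sym v0 vnorm_ge0.
rewrite -ler_pdivrMr //; apply: ub_le_sup => //; exists ((vnorm v)^-1%:C *: v) => /=.
  by rewrite vnormZ normc_real gtr0_norm ?invr_gt0 // mulVf.
by rewrite -scalemxAr vnormZ normc_real gtr0_norm ?invr_gt0 // mulrC.
Qed.

Lemma opnorm_le A (K : R) : 0 <= K -> (forall v, vnorm (A *m v) <= K * vnorm v) -> opnorm A <= K.
Proof.
move=> K0 h; apply: ge_sup => // _ [v /= v1 <-]; apply: le_trans (h v) _.
by rewrite ler_piMr.
Qed.

Lemma opnorm_le_entry_sum A : opnorm A <= entry_sum A.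
Proof.
apply: opnorm_le; last exact: vnorm_mul_le.
by apply: sumr_ge0 => i _; apply: sumr_ge0 => j _; exact: normc_ge0.
Qed.

Lemma entry_le_opnorm A i j : normc (A i j) <= opnorm A.
Proof.
have -> : A i j = (A *m (delta_mx j 0 : 'cV_n)) i 0 by rewrite -colE mxE.
apply: le_trans (normc_le_vnorm _ _) _; apply: le_trans (vnorm_mul _ _) _.
by rewrite vnorm_delta mulr1.
Qed.

Lemma opnorm_eq0 A : opnorm A = 0 -> A = 0.
Proof.
move=> A0; apply/matrixP => i j; rewrite [RHS]mxE; apply/eqP; rewrite -normc_eq0E.
by rewrite eq_le normc_ge0 -A0 entry_le_opnorm.
Qed.

Lemma opnormD A B : opnorm (A + B) <= opnorm A + opnorm B.
Proof.
apply: opnorm_le => [|v]; first by rewrite addr_ge0 ?opnorm_ge0.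
by rewrite mulmxDl mulrDl; apply: le_trans (vnormD _ _) _; rewrite lerD // vnorm_mul.
Qed.

Lemma opnormM A B : opnorm (A *m B) <= opnorm A * opnorm B.
Proof.
apply: opnorm_le => [|v]; first by rewrite mulr_ge0 ?opnorm_ge0.
rewrite -mulmxA -mulrA; apply: le_trans (vnorm_mul _ _) _.
by rewrite ler_wpM2l ?opnorm_ge0 // vnorm_mul.
Qed.

Lemma opnormZ c A : opnorm (c *: A) = normc c * opnorm A.
Proof.
have le d B : opnorm (d *: B) <= normc d * opnorm B.
  apply: opnorm_le => [|v]; first by rewrite mulr_ge0 ?opnorm_ge0 ?normc_ge0.
  by rewrite -scalemxAl vnormZ -mulrA ler_wpM2l ?normc_ge0 // vnorm_mul.
apply/le_anti; rewrite le /=; have [->|c0] := eqVneq c 0.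
  by rewrite normc0 mul0r opnorm_ge0.
have nc : 0 < normc c by rewrite lt_neqAle normc_ge0 eq_sym normc_eq0E c0.
rewrite mulrC -ler_pdivlMr // mulrC -normcV.
have {1}-> : A = c^-1 *: (c *: A) by rewrite scalerA mulVf // scale1r.
exact: le.
Qed.

(** Write the left side as the inner product of v with A^* A v and apply Cauchy-Schwarz. *)
Lemma vnorm_inner_le A v : vnorm (A *m v) ^+ 2 <= opnorm (A ^t* *m A) * vnorm v ^+ 2.
Proof.
have key : \sum_i normc ((A *m v) i 0) ^+ 2 <=
    \sum_i normc (v i 0) * normc ((A ^t* *m A *m v) i 0).
  set w := A *m v.
  have e : (\sum_i normc (w i 0) ^+ 2)%:C = \sum_i Num.conj (v i 0) * (A ^t* *m A *m v) i 0.
    rewrite rmorph_sum /=.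
    transitivity ((w ^t* *m w) 0 0).
      rewrite mxE; apply: eq_bigr => i _; rewrite !mxE -normCKC rmorphXn //.
    have -> : w ^t* *m w = v ^t* *m (A ^t* *m A *m v).
      by rewrite /w trmx_mul map_mxM !mulmxA.
    by rewrite mxE; apply: eq_bigr => i _; congr (_ * _); rewrite !mxE.
  have : normc (\sum_i normc (w i 0) ^+ 2)%:C <=
      \sum_i normc (v i 0) * normc ((A ^t* *m A *m v) i 0).
    rewrite e; elim/big_ind2: _ => [|x a z b h1 h2|i _].
    - by rewrite normc0.
    - by apply: le_trans (le_normcD _ _) _; rewrite lerD.
    - by rewrite normcM normc_conj.
  by apply: le_trans; rewrite normc_real ler_norm.
rewrite vnorm_sqr; apply: le_trans key _; apply: le_trans (cauchy_schwarz_vnorm _ _) _.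
rewrite expr2 mulrA mulrC ler_wpM2r ?vnorm_ge0 //.
exact: vnorm_mul.
Qed.

Lemma opnorm_star_mul A : opnorm (A ^t* *m A) = opnorm A ^+ 2.
Proof.
have ge B : opnorm B ^+ 2 <= opnorm (B ^t* *m B).
  have h : 0 <= opnorm (B ^t* *m B) by exact: opnorm_ge0.
  rewrite -[leRHS]sqr_sqrtr //; apply: lerXn2r; rewrite ?nnegrE ?opnorm_ge0 ?sqrtr_ge0 //.
  apply: opnorm_le; first exact: sqrtr_ge0.
  move=> v; rewrite -(ler_pXn2r (ltn0Sn 1)) ?nnegrE ?mulr_ge0 ?sqrtr_ge0 ?vnorm_ge0 //.
  by rewrite exprMn (sqr_sqrtr h); exact: vnorm_inner_le.
have le B : opnorm B <= opnorm (B ^t*).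
  have [|B0] := leP (opnorm B) 0; first by move=> /le_trans; apply; exact: opnorm_ge0.
  suff : opnorm B * opnorm B <= opnorm (B ^t*) * opnorm B by rewrite (ler_pM2r B0).
  by rewrite -expr2; apply: le_trans (ge B) (opnormM _ _).
apply/le_anti; rewrite ge andbT expr2; apply: le_trans (opnormM _ _) _.
by apply: ler_wpM2r; [exact: opnorm_ge0|have := le (A ^t*); rewrite trmxCK].
Qed.

Lemma opnorm_complete (u : nat -> 'M[R[i]]_n) :
  (forall e : R, 0 < e -> \forall m & n \near \oo, opnorm (u m - u n) < e) ->
  exists l, opnorm (u n - l) @[n --> \oo] --> (0 : R).
Proof.
move=> cu.
have cauchy i j : exists l, forall e : R, 0 < e ->
    exists N, forall k, (N <= k)%N -> normc (u k i j - l) < e.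
  apply: complex_cauchy_cvg => e /cu[[P Q] /= [[N1 _ h1] [N2 _ h2]] hPQ].
  exists (maxn N1 N2) => k l; rewrite !geq_max => /andP[k1 _] /andP[_ l2].
  have := hPQ (k, l) (conj (h1 k k1) (h2 l l2)); apply: le_lt_trans => /=.
  by have := entry_le_opnorm (u k - u l) i j; rewrite !mxE.
have /choice[l hl] : forall p : 'I_n * 'I_n, exists l, forall e : R, 0 < e ->
    exists N, forall k, (N <= k)%N -> normc (u k p.1 p.2 - l) < e by move=> p; exact: cauchy.
exists (\matrix_(i, j) l (i, j)); apply/cvgrPdist_lt => e e0.
have e1 : 0 < e / (n * n).+1%:R by rewrite divr_gt0.
have /choice[N hN] : forall p, exists N, forall k, (N <= k)%N ->
  normc (u k p.1 p.2 - l p) < e / (n * n).+1%:R by move=> p; exact: hl.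
exists (\max_p N p)%N => // k /= kN; rewrite sub0r normrN ger0_norm ?opnorm_ge0 //.
apply: le_lt_trans (opnorm_le_entry_sum _) _.
apply: (@le_lt_trans _ _ (\sum_(i < n) \sum_(j < n) e / (n * n).+1%:R)).
  apply: ler_sum => i _; apply: ler_sum => j _; rewrite !mxE ltW // (hN (i, j)) //.
  by apply: leq_trans kN; exact: (@leq_bigmax _ N (i, j)).
rewrite !sumr_const !card_ord -mulrnA -[ltLHS]mulr_natl mulrA ltr_pdivrMr //.
by rewrite mulrC ltr_pM2l // ltr_nat.
Qed.

HB.instance Definition _ := StarAlgebra_isCStar.Build R 'M[R[i]]_n
  opnorm_eq0 opnormD opnormZ opnormM opnorm_star_mul opnorm_complete.

End operator_norm.

(** * Boundary conditions at a point *)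

Section boundary_blocks.
Variable R : realType.
Implicit Types (G : 'M[R[i]]_2) (F : 'M[R[i]]_4) (z : R[i]) (phi : R).
Local Notation idx := (@mxtens_index 2 2).

Definition scalar_blk G := [/\ G 0 1 = 0, G 1 0 = 0 & G 0 0 = G 1 1].
Definition reflection_blk z G := G 0 0 = G 1 1 /\ G 0 1 = z * G 1 0.

Lemma I2P (i : 'I_2) : i = 0 \/ i = 1.
Proof. by case: i => -[|[|//]] h; [left|right]; apply: val_inj. Qed.

Lemma blk_inj F F' : (forall i j, blk i j F = blk i j F') -> F = F'.
Proof.
move=> h; apply/matrixP => m n; rewrite -[m](@mxtens_unindexK 2 2) -[n](@mxtens_unindexK 2 2).
case: (@mxtens_unindex 2 2 m) (@mxtens_unindex 2 2 n) => i k [j l].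
by have /matrixP/(_ k l) := h i j; rewrite !mxE.
Qed.

Lemma tens1P F : (exists A : 'M[R[i]]_2, F = A *t (1%:M : 'M[R[i]]_2)) <->
  forall i j, scalar_blk (blk i j F).
Proof.
split=> [[A ->] i j|h].
  by rewrite blk_tens; split; rewrite !mxE /= ?mulr0.
exists (\matrix_(i, j) blk i j F 0 0); apply: blk_inj => i j; rewrite blk_tens mxE.
have [h1 h2 h3] := h i j; apply/matrixP => k l; rewrite [RHS]mxE [_%:M k l]mxE.
by case: (I2P k) (I2P l) => -> [] ->; rewrite /= ?mulr1 ?mulr0 ?h1 ?h2 ?h3.
Qed.

Lemma nu2E phi (i k a l : 'I_2) : nu2 phi (idx (i, k)) (idx (a, l)) = Vmx phi k a * (i == l)%:R.
Proof.
rewrite /nu2 mxE (bigD1 (idx (k, i))) //= big1 => [|m mk].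
  by rewrite !mxE !mxtens_indexK /= eqxx mul1r addr0.
rewrite [flipmx _ _ _]mxE mxtens_indexK.
case: eqP => [h|]; last by rewrite mul0r.
case/eqP: mk; rewrite -[m](@mxtens_unindexK 2 2); congr idx.
by move: h; case: (@mxtens_unindex 2 2 m) => p q [-> ->].
Qed.

(** The flip exchanges the tensor factors, so conjugating by [nu2] lets [Vmx] act on the second
    factor of F, and the two diagonal blocks are indexed by the columns of [Vmx]. *)
Lemma nu2_conjE phi F (a k b l : 'I_2) :
  ((nu2 phi) ^t* *m F *m nu2 phi) (idx (a, k)) (idx (b, l)) =
  ((Vmx phi) ^t* *m blk k l F *m Vmx phi) a b.
Proof.
have e1 (f : 'I_2 -> 'I_2 -> R[i]) (m : 'I_2) :
    \sum_i \sum_j f i j * (i == m)%:R = \sum_j f m j.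
  rewrite (bigD1 m) //= [X in _ + X]big1 ?addr0; last first.
    by move=> i im; rewrite big1 // => j _; rewrite (negbTE im) mulr0.
  by apply: eq_bigr => j _; rewrite eqxx mulr1.
rewrite mxE sum_mxtens.
under eq_bigr do under eq_bigr do rewrite nu2E mulrA.
rewrite e1 [RHS]mxE; apply: eq_bigr => n _; congr (_ * _).
rewrite mxE sum_mxtens.
under eq_bigr do under eq_bigr do rewrite 2!mxE nu2E rmorphM rmorph_nat mulrAC.
rewrite e1 [RHS]mxE; apply: eq_bigr => j _; by rewrite !mxE.
Qed.

Lemma expi_half phi : expi (phi / 2) * expi (phi / 2) = expi phi :> R[i].
Proof.
transitivity (expi (phi / 2 + phi / 2)); last by congr expi; lra.
by apply/eqP; rewrite eq_complex /= cosD sinD; apply/andP; split; apply/eqP; ring.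
Qed.

Lemma offdiagE phi G (a b : 'I_2) : a != b ->
  2 * ((Vmx phi) ^t* *m G *m Vmx phi) a b =
  G 1 1 - G 0 0 + (if a == 0 then 1 else -1) *
    (Num.conj (expi (phi / 2)) * G 0 1 - expi (phi / 2) * G 1 0).
Proof.
move=> ab; set e := expi (phi / 2); pose s : R[i] := (Num.sqrt 2)^-1%:C.
have ce := conj_expi (phi / 2); rewrite -/e in ce.
have s2 : 2 * (s * s) = 1.
  rewrite /s -rmorphM -invfM -expr2 sqr_sqrtr // fmorphV rmorph_nat mulfV ?pnatr_eq0 //.
have V00 : Vmx phi 0 0 = s * e by rewrite !mxE.
have V01 : Vmx phi 0 1 = - (s * e) by rewrite !mxE /= mulrN.
have V10 : Vmx phi 1 0 = s by rewrite !mxE /= mulr1.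
have V11 : Vmx phi 1 1 = s by rewrite !mxE /= mulr1.
have cs : Num.conj s = s by exact: conj_real.
have St i j : ((Vmx phi) ^t*) i j = Num.conj (Vmx phi j i) by rewrite !mxE.
rewrite mxE sum_ord2 !mul_mx2 !St.
case: (I2P a) (I2P b) ab => -> [] -> //= _; rewrite ?V00 ?V01 ?V10 ?V11 ?rmorphN ?rmorphM /= ?cs.
  transitivity (2 * (s * s) * (G 1 1 - (Num.conj e * e) * G 0 0 + Num.conj e * G 0 1 - e * G 1 0)).
    by ring.
  by rewrite s2 ce; ring.
transitivity (2 * (s * s) * (G 1 1 - (Num.conj e * e) * G 0 0 - Num.conj e * G 0 1 + e * G 1 0)).
  by ring.
by rewrite s2 ce; ring.
Qed.

Lemma block_diagP (X : 'M[R[i]]_4) :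
  (exists A B : 'M[R[i]]_2, X = block_mx A 0 0 B) <->
  (forall k l a b : 'I_2, a != b -> X (idx (a, k)) (idx (b, l)) = 0).
Proof.
have iL (k : 'I_2) : idx (0, k) = lshift 2 k by apply: val_inj.
have iR (k : 'I_2) : idx (1, k) = rshift 2 k by apply: val_inj.
split=> [[A [B ->]] k l a b|h].
  by case: (I2P a) (I2P b) => -> [] -> // _; rewrite iL iR
    ?(block_mxEur A 0 0 B) ?(block_mxEdl A 0 0 B) mxE.
exists (@ulsubmx _ 2 2 2 2 X), (@drsubmx _ 2 2 2 2 X).
rewrite -[LHS](@submxK _ 2 2 2 2 X).
have -> : @ursubmx _ 2 2 2 2 X = 0.
  by apply/matrixP => k l; rewrite [LHS]mxE [LHS]mxE -iL -iR h ?mxE.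
have -> // : @dlsubmx _ 2 2 2 2 X = 0.
by apply/matrixP => k l; rewrite [LHS]mxE [LHS]mxE -iL -iR h ?mxE.
Qed.

(** The columns of [Vmx phi] are eigenvectors of the matrix with rows (0, z) and (1, 0), z =
    [expi phi]. A 2 x 2 block is diagonal in this basis exactly when it is a combination of 1 and
    that matrix. *)
Lemma nu2_blockP phi F :
  (exists A B : 'M[R[i]]_2, (nu2 phi) ^t* *m F *m nu2 phi = block_mx A 0 0 B) <->
  forall i j, reflection_blk (expi phi) (blk i j F).
Proof.
have ce := conj_expi (phi / 2); set e := expi (phi / 2) in ce *.
have ee : e * e = expi phi := expi_half phi.
split=> [/block_diagP h i j|h].
  set G := blk i j F.
  have k1 := @offdiagE phi G 0 1 isT; have k2 := @offdiagE phi G 1 0 isT.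
  move: k1 k2; rewrite -!nu2_conjE !h // !mulr0 /= -/e mul1r mulN1r => k1 k2.
  have p1 : G 1 1 - G 0 0 = 0.
    apply: (@mulfI _ 2); first by rewrite pnatr_eq0.
    by rewrite mulr0 -[RHS](addr0 0) {1}k1 k2; ring.
  move: k1; rewrite p1 add0r => /esym/eqP; rewrite subr_eq0 => /eqP k1.
  move/eqP: p1; rewrite subr_eq0 => /eqP p1; split; first by rewrite p1.
  by rewrite -ee -mulrA -k1 mulrA [e * _]mulrC ce mul1r.
apply/block_diagP => k l a b ab; rewrite nu2_conjE.
apply: (@mulfI _ 2); first by rewrite pnatr_eq0.
have [h1 h2] := h k l; rewrite offdiagE // h1 h2 -/e -ee subrr add0r mulr0.
by rewrite -[e * e * _]mulrA [Num.conj e * _]mulrA ce mul1r subrr mulr0.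
Qed.

End boundary_blocks.

(** * Topology of D_y x T^2 *)

Section complex_topology.
Variable R : realType.
Implicit Types (T : topologicalType) (z c : R[i]).

Lemma complex_continuousP T (f : T -> R[i]) :
  continuous f <-> forall p (e : R), 0 < e -> \forall q \near p, normc (f p - f q) < e.
Proof.
split=> [cf p e e0|h p].
  have e0' : (0 : R[i]) < e%:C by rewrite ltcR.
  have /cvgrPdist_lt/(_ _ e0') := cf p.
  by apply: filterS => q; by rewrite -ltcR.
apply/cvgrPdist_lt => -[a b] /=; rewrite ltcE /= => /andP[/eqP -> a0].
have := h p a a0; apply: filterS => q.
by rewrite -ltcR.
Qed.

Lemma continuous_real_complex : continuous (real_complex R).
Proof.
apply/complex_continuousP => p e e0; have /cvgrPdist_lt/(_ _ e0) : id @ p --> p by [].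
by apply: filterS => q; rewrite -rmorphB normc_real.
Qed.

Lemma continuous_conj : continuous (@Num.conj R[i]).
Proof.
apply/complex_continuousP => p e e0.
have /complex_continuousP/(_ p e e0) : continuous (@id R[i]) by move=> ?.
by apply: filterS => q; rewrite -rmorphB normc_conj.
Qed.

Lemma continuous_expi : continuous (@expi R).
Proof.
apply/complex_continuousP => p e e0; have e2 : 0 < e / 2 by lra.
have /cvgrPdist_lt/(_ _ e2) := @continuous_cos R p.
have /cvgrPdist_lt/(_ _ e2) := @continuous_sin R p.
apply: filterS2 => q h1 h2; apply: le_lt_trans (normc_le_ReIm _) _ => /=.
lra.
Qed.

Lemma expi_surj z : normc z = 1 -> exists2 phi, 0 <= phi <= 2 * pi & z = expi phi.
Proof.
case: z => a b /= nz; have ab : a ^+ 2 + b ^+ 2 = 1.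
  by rewrite -[LHS]sqr_sqrtr ?nz ?expr1n // addr_ge0 ?sqr_ge0.
have b2 : b ^+ 2 = 1 - a ^+ 2 by rewrite -ab addrC addKr.
have ha : -1 <= a <= 1.
  by rewrite -ler_norml -(@expr_le1 _ 2) // real_normK ?num_real // -ab lerDl sqr_ge0.
have hs : sin (acos a) = `|b| by rewrite sin_acos // -b2 sqrtr_sqr.
have hc : cos (acos a) = a by rewrite acosK // in_itv /= ha.
have h0 := acos_ge0 ha; have h1 := acos_lepi ha.
have pi2 : pi *+ 2 = 2 * pi :> R by rewrite mulr_natl.
have [b0|b0] := leP 0 b.
  by exists (acos a); [lra|rewrite /expi hc hs ger0_norm].
exists (2 * pi - acos a); first by lra.
by rewrite /expi cosB sinB -pi2 cos2pi sin2pi hc hs ltr0_norm // !mul0r !mul1r addr0 sub0r opprK.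
Qed.

Lemma matrix_continuousP T n (f : T -> 'M[R[i]]_n.+1) :
  (forall i j, continuous (fun p => f p i j)) <->
  forall p (e : R), 0 < e -> \forall q \near p, opnorm (f p - f q) < e.
Proof.
split=> [cf p e e0|h i j].
  have e1 : 0 < e / (n.+1 * n.+1).+1%:R by rewrite divr_gt0.
  have : \forall q \near p, forall i j, normc (f p i j - f q i j) < e / (n.+1 * n.+1).+1%:R.
    apply: filter_forall => i; apply: filter_forall => j.
    by have /complex_continuousP := cf i j; apply.
  apply: filterS => q hq; apply: le_lt_trans (opnorm_le_entry_sum _) _.
  apply: (@le_lt_trans _ _ (\sum_(i < n.+1) \sum_(j < n.+1) e / (n.+1 * n.+1).+1%:R)).
    by apply: ler_sum => i _; apply: ler_sum => j _; rewrite !mxE ltW.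
  rewrite !sumr_const !card_ord -mulrnA -[ltLHS]mulr_natl mulrA ltr_pdivrMr //.
  by rewrite mulrC ltr_pM2l // ltr_nat.
apply/complex_continuousP => p e /(h p); apply: filterS => q; apply: le_lt_trans.
by have := entry_le_opnorm (f p - f q) i j; rewrite !mxE.
Qed.

Lemma continuous_opnormP T (f : T -> 'M[R[i]]_4) :
  continuous f <-> forall p (e : R), 0 < e -> \forall q \near p, opnorm (f p - f q) < e.
Proof. by rewrite entry_continuous; exact: (@matrix_continuousP T 3 f). Qed.

End complex_topology.

Section DT_compact.
Variables (R : realType) (y : R[i]) (y1 : normc y < 1).

Lemma circle_compact : compact [set z : R[i] | normc z = 1].
Proof.
have -> : [set z : R[i] | normc z = 1] = (@expi R) @` [set` `[0, 2 * pi]].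
  apply/seteqP; split=> [z /expi_surj[phi hp ->]|_ [phi _ <-]]; last exact: normc_expi.
  by exists phi => //=; rewrite in_itv.
apply: continuous_compact; last exact: segment_compact.
by apply: continuous_subspaceT; exact: continuous_expi.
Qed.

Lemma DT_compact : compact (DT y).
Proof.
have -> : DT y = ((([set` `[0, xmax y]] `*` [set` `[0, 1 / 2]])
    `*` [set z : R[i] | normc z = 1]) `*` [set z : R[i] | normc z = 1]).
  apply/seteqP; split=> -[[[x1 x2] z1] z2] /=; rewrite !in_itv /=.
    by case=> /= h1 h2 h3 h4.
  by case=> -[[h1 h2] h3] h4.
apply: compact_setX; last exact: circle_compact.
apply: compact_setX; last exact: circle_compact.
by apply: compact_setX; exact: segment_compact.
Qed.

Lemma xmax_ge0 : 0 <= xmax y.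
Proof. by rewrite /xmax divr_ge0 // subr_ge0 ltW. Qed.

Lemma DT0 : DT y (0, 0, 1, 1).
Proof.
by split=> /=; rewrite ?lexx ?xmax_ge0 ?divr_ge0 //; exact: normc1.
Qed.

Definition DT_base : DT y := SigSub (mem_set DT0).

Lemma DT_type_compact : compact [set: DT y].
Proof.
have -> : [set: DT y] = (valL_ DT_base (@id (DT y))) @` DT y.
  apply/seteqP; split=> // p _; exists (\val p); first by apply: set_mem; exact: valP.
  by rewrite /valL_ /= oinv_set_val valK.
apply: continuous_compact; last exact: DT_compact.
by apply/subspace_valL_continuousP' => p.
Qed.

End DT_compact.

(** * The model as a C*-algebra *)

Section model_boundary.
Variables (R : realType) (y : R[i]).
Implicit Types (p q : DT y) (f g : DT y -> 'M[R[i]]_4).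

Definition px1 p : R := (\val p).1.1.1.
Definition px2 p : R := (\val p).1.1.2.
Definition pz1 p : R[i] := (\val p).1.2.
Definition pz2 p : R[i] := (\val p).2.

Lemma DT_pointP p : [/\ 0 <= px1 p <= xmax y, 0 <= px2 p <= 1 / 2,
  normc (pz1 p) = 1 & normc (pz2 p) = 1].
Proof. by have := set_mem (valP p). Qed.

Lemma at_pt_val f p : at_pt f (px1 p) (px2 p) (pz1 p) (pz2 p) = f p.
Proof.
rewrite /at_pt /valL_ /= oinv_set_val.
have -> : (px1 p, px2 p, pz1 p, pz2 p) = \val p.
  by rewrite /px1 /px2 /pz1 /pz2; case: (\val p) => [[[? ?] ?] ?].
by rewrite valK.
Qed.

Lemma DT_point x1 x2 z1 z2 : 0 <= x1 <= xmax y -> 0 <= x2 <= 1 / 2 ->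
  normc z1 = 1 -> normc z2 = 1 ->
  exists p, [/\ px1 p = x1, px2 p = x2, pz1 p = z1 & pz2 p = z2].
Proof.
move=> h1 h2 h3 h4; have h : DT y (x1, x2, z1, z2) by split.
by exists (SigSub (mem_set h)).
Qed.

Hypothesis y1 : normc y < 1.

(** Angles are eliminated because [expi] covers the circle, already on [0, 2 pi]. What remains are
    equalities between values at two points and linear conditions on the blocks, both of which
    survive uniform limits. *)
Lemma boundaryP f : boundary_conditions f <->
  [/\ forall p q, px1 p = 0 -> px1 q = 0 -> px2 p = px2 q -> pz2 p = pz2 q -> f p = f q,
      forall p q, px2 p = 0 -> px2 q = 0 -> px1 p = px1 q -> pz1 p = pz1 q -> f p = f q,
      forall p q, px1 p = xmax y -> px1 q = xmax y -> pz1 p = pz1 q -> f p = f q,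
      forall p, px1 p = xmax y -> forall i j, scalar_blk (blk i j (f p)) &
      forall p, px2 p = 1 / 2 -> forall i j, reflection_blk (pz2 p) (blk i j (f p))].
Proof.
have xm := xmax_ge0 y1; have q0 : (0 : R) <= 1 / 2 by rewrite divr_ge0.
have n1 : normc (1 : R[i]) = 1 by exact: normc1.
have Xmax : 0 <= xmax y <= xmax y by rewrite xm lexx.
split=> [[h1 h2 h3 h4]|[h1 h2 h3 h3' h4]].
- split.
  + have key p : px1 p = 0 -> f p = at_pt f 0 (px2 p) 1 (pz2 p).
      have [_ b c d] := DT_pointP p; move=> p0; rewrite -at_pt_val p0.
      have [t1 _ ->] := expi_surj c; have [t2 _ ->] := expi_surj d; exact: h1.
    by move=> p q /key -> /key -> -> ->.
  + have key p : px2 p = 0 -> f p = at_pt f (px1 p) 0 (pz1 p) 1.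
      have [a _ c d] := DT_pointP p; move=> p0; rewrite -at_pt_val p0.
      have [t1 _ ->] := expi_surj c; have [t2 _ ->] := expi_surj d; exact: h2.
    by move=> p q /key -> /key -> -> ->.
  + have key p : px1 p = xmax y -> f p = at_pt f (xmax y) 0 (pz1 p) 1.
      have [_ b c d] := DT_pointP p; move=> p0; rewrite -at_pt_val p0.
      have [t1 _ ->] := expi_surj c; have [t2 _ ->] := expi_surj d.
      by have [] := h3 _ t1 t2 b.
    by move=> p q /key -> /key -> ->.
  + move=> p p0; apply/tens1P; have [_ b c d] := DT_pointP p; rewrite -at_pt_val p0.
    have [t1 _ ->] := expi_surj c; have [t2 _ ->] := expi_surj d.
    by have [-> ?] := h3 _ t1 t2 b.
  + move=> p p0; have [a _ c d] := DT_pointP p; rewrite -at_pt_val p0.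
    have [t1 _ ->] := expi_surj c; have [t2 t2h ->] := expi_surj d.
    by apply/nu2_blockP; exact: h4.
- have H0 : 0 <= (0 : R) <= 1 / 2 by rewrite lexx.
  split.
  + move=> x2 t1 t2 hx; have X0 : 0 <= (0 : R) <= xmax y by rewrite lexx.
    have [p [p1 p2 p3 p4]] := DT_point X0 hx (normc_expi t1) (normc_expi t2).
    have [q [q1 q2 q3 q4]] := DT_point X0 hx n1 (normc_expi t2).
    rewrite -{1}p1 -{1}p2 -{1}p3 -{1}p4 at_pt_val -q1 -q2 -q3 -q4 at_pt_val.
    by apply: h1; rewrite ?p1 ?p2 ?p4.
  + move=> x1 t1 t2 hx.
    have [p [p1 p2 p3 p4]] := DT_point hx H0 (normc_expi t1) (normc_expi t2).
    have [q [q1 q2 q3 q4]] := DT_point hx H0 (normc_expi t1) n1.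
    rewrite -{1}p1 -{1}p2 -{1}p3 -{1}p4 at_pt_val -q1 -q2 -q3 -q4 at_pt_val.
    by apply: h2; rewrite ?p1 ?p2 ?p3.
  + move=> x2 t1 t2 hx.
    have [p [p1 p2 p3 p4]] := DT_point Xmax hx (normc_expi t1) (normc_expi t2).
    have [q [q1 q2 q3 q4]] := DT_point Xmax H0 (normc_expi t1) n1.
    have -> : at_pt f (xmax y) x2 (expi t1) (expi t2) = f p by rewrite -at_pt_val p1 p2 p3 p4.
    have -> : at_pt f (xmax y) 0 (expi t1) 1 = f q by rewrite -at_pt_val q1 q2 q3 q4.
    by split; [apply: h3; rewrite ?p3|apply/tens1P; exact: h3'].
  + move=> x1 t1 t2 hx ht; have Hh : 0 <= (1 / 2 : R) <= 1 / 2 by rewrite lexx q0.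
    have [p [p1 p2 p3 p4]] := DT_point hx Hh (normc_expi t1) (normc_expi t2).
    have -> : at_pt f x1 (1 / 2) (expi t1) (expi t2) = f p by rewrite -at_pt_val p1 p2 p3 p4.
    by apply/nu2_blockP; rewrite -p4; exact: h4.
Qed.

Lemma opnormB_sym n (A B : 'M[R[i]]_n.+1) : opnorm (A - B) = opnorm (B - A).
Proof. exact: (@cnormBC R 'M[R[i]]_n.+1). Qed.

Lemma opnormB_tri n (A B C : 'M[R[i]]_n.+1) :
  opnorm (A - B) <= opnorm (A - C) + opnorm (C - B).
Proof. by rewrite -[A - B](subrKA C); exact: opnormD. Qed.

Lemma continuous_opnorm (T : topologicalType) (f : T -> 'M[R[i]]_4) :
  continuous f -> continuous (fun t => opnorm (f t)).
Proof.
move=> /continuous_opnormP cf p; apply/cvgrPdist_lt => e /(cf p); apply: filterS => q.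
have tri (A B : 'M[R[i]]_4) : opnorm A - opnorm B <= opnorm (A - B).
  by rewrite lerBlDr -{1}[A](subrK B); exact: opnormD.
by apply: le_lt_trans; rewrite ler_norml tri andbT lerNl opprB opnormB_sym tri.
Qed.

Lemma opnorm_small_eq0 n (A : 'M[R[i]]_n.+1) : (forall e : R, 0 < e -> opnorm A < e) -> A = 0.
Proof.
move=> h; apply: opnorm_eq0; apply/le_anti; rewrite opnorm_ge0 andbT.
by apply/ler_addgt0Pl => e e0; rewrite addr0 ltW // h.
Qed.

Lemma normc_small_eq0 (c : R[i]) : (forall e : R, 0 < e -> normc c < e) -> c = 0.
Proof.
move=> h; apply/eqP; rewrite -normc_eq0E eq_le normc_ge0 andbT.
by apply/ler_addgt0Pl => e e0; rewrite addr0 ltW // h.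
Qed.

Lemma model_pred_closed f :
  (forall e : R, 0 < e -> exists2 g, g \in @model_pred R y & forall p, opnorm (f p - g p) < e) ->
  f \in @model_pred R y.
Proof.
move=> cl.
have entry (A : 'M[R[i]]_4) i j k l : normc (blk i j A k l) <= opnorm A.
  by rewrite mxE; exact: entry_le_opnorm.
apply/model_predP; split.
  apply/continuous_opnormP => p e e0; have e3 : 0 < e / 3 by rewrite divr_gt0.
  have [g /model_predP[/continuous_opnormP cg _] fg] := cl _ e3.
  apply: filterS (cg p _ e3) => q hq; apply: le_lt_trans (opnormB_tri _ _ (g p)) _.
  have -> : e = e / 3 + (e / 3 + e / 3) by field.
  apply: ltrD; first exact: fg.
  apply: le_lt_trans (opnormB_tri _ _ (g q)) _; apply: ltrD; first exact: hq.
  rewrite opnormB_sym; exact: fg.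
have eqpt p q : (forall g, g \in @model_pred R y -> g p = g q) -> f p = f q.
  move=> h; apply/eqP; rewrite -subr_eq0; apply/eqP/opnorm_small_eq0 => e e0.
  have e2 : 0 < e / 2 by rewrite divr_gt0.
  have [g mg fg] := cl _ e2; apply: le_lt_trans (opnormB_tri _ _ (g p)) _.
  rewrite [e]splitr; apply: ltrD; first exact: fg.
  rewrite (h g mg) opnormB_sym; exact: fg.
(* Each linear condition is the vanishing of one entry, or of a combination of two entries with unit
   coefficients; hence the constant 2. *)
have lin p (L : 'M[R[i]]_4 -> R[i]) :
    (forall A B, L (A - B) = L A - L B) -> (forall A, normc (L A) <= 2 * opnorm A) ->
    (forall g, g \in @model_pred R y -> L (g p) = 0) -> L (f p) = 0.
  move=> LB Ln L0; apply: normc_small_eq0 => e e0; have e2 : 0 < e / 2 by rewrite divr_gt0.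
  have [g mg fg] := cl _ e2; have := Ln (f p - g p); rewrite LB (L0 g mg) subr0 => h.
  apply: le_lt_trans h _; rewrite mulrC -ltr_pdivlMr ?ltr0n //; exact: fg.
have le2 (A : 'M[R[i]]_4) i j k l : normc (blk i j A k l) <= 2 * opnorm A.
  apply: le_trans (entry A i j k l) _; rewrite mulrC mulr_natr mulr2n lerDr.
  exact: opnorm_ge0.
have le2B (A : 'M[R[i]]_4) i j k l k' l' (z : R[i]) : normc z = 1 ->
    normc (blk i j A k l - z * blk i j A k' l') <= 2 * opnorm A.
  move=> nz; apply: le_trans (le_normcD _ _) _; rewrite normcN normcM nz mul1r.
  by rewrite mulrC mulr_natr mulr2n; apply: lerD; exact: entry.
apply/boundaryP; split.
- move=> p q a b c d; apply: eqpt => g /model_predP[_ /boundaryP[h _ _ _ _]]; exact: h.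
- move=> p q a b c d; apply: eqpt => g /model_predP[_ /boundaryP[_ h _ _ _]]; exact: h.
- move=> p q a b c; apply: eqpt => g /model_predP[_ /boundaryP[_ _ h _ _]]; exact: h.
- move=> p a i j; split.
  + apply: (lin p (fun A => blk i j A 0 1)).
    * by move=> A B; rewrite !mxE.
    * by move=> A; exact: le2.
    * by move=> g /model_predP[_ /boundaryP[_ _ _ h _]]; case: (h p a i j).
  + apply: (lin p (fun A => blk i j A 1 0)).
    * by move=> A B; rewrite !mxE.
    * by move=> A; exact: le2.
    * by move=> g /model_predP[_ /boundaryP[_ _ _ h _]]; case: (h p a i j).
  + apply/eqP; rewrite -subr_eq0; apply/eqP.
    apply: (lin p (fun A => blk i j A 0 0 - blk i j A 1 1)).
    * by move=> A B; rewrite !mxE; ring.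
    * by move=> A; rewrite -[blk i j A 1 1]mul1r; apply: le2B; exact: normc1.
    * move=> g /model_predP[_ /boundaryP[_ _ _ h _]]; case: (h p a i j) => _ _ ->.
      by rewrite subrr.
- move=> p a i j; split.
  + apply/eqP; rewrite -subr_eq0; apply/eqP.
    apply: (lin p (fun A => blk i j A 0 0 - blk i j A 1 1)).
    * by move=> A B; rewrite !mxE; ring.
    * by move=> A; rewrite -[blk i j A 1 1]mul1r; apply: le2B; exact: normc1.
    * move=> g /model_predP[_ /boundaryP[_ _ _ _ h]]; case: (h p a i j) => -> _.
      by rewrite subrr.
  + apply/eqP; rewrite -subr_eq0; apply/eqP.
    apply: (lin p (fun A => blk i j A 0 1 - pz2 p * blk i j A 1 0)).
    * by move=> A B; rewrite !mxE; ring.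
    * by move=> A; apply: le2B; have [] := DT_pointP p.
    * move=> g /model_predP[_ /boundaryP[_ _ _ _ h]]; case: (h p a i j) => _ ->.
      by rewrite subrr.
Qed.

End model_boundary.

Section model_norm.
Variables (R : realType) (y : R[i]) (y01 : 0 < normc y < 1).
Local Notation M := (model y01).
Implicit Types (f g : M) (p : DT y).

Let y1 : normc y < 1. Proof. by case/andP: y01. Qed.

Definition mnorm f : R := sup (range (fun p : DT y => opnorm (f p))).

Let mrange0 f : range (fun p : DT y => opnorm (f p)) !=set0.
Proof. by exists (opnorm (f (DT_base y1))); exists (DT_base y1). Qed.

Let mrange_ub f : has_ubound (range (fun p : DT y => opnorm (f p))).
Proof.
have /model_predP[cf _] := model_valP f.
have [||c _ hc] := @compact_EVT_max (DT y) R (fun p => opnorm (f p)) setT _ (DT_type_compact y1).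
- by exists (DT_base y1).
- by apply: continuous_subspaceT; exact: continuous_opnorm.
by exists (opnorm (f c)) => _ [p _ <-]; apply: hc; rewrite inE.
Qed.

Lemma opnorm_le_mnorm f p : opnorm (f p) <= mnorm f.
Proof. by apply: ub_le_sup => //; exists p. Qed.

Lemma mnorm_le f (K : R) : (forall p, opnorm (f p) <= K) -> mnorm f <= K.
Proof. by move=> h; apply: ge_sup => // _ [p _ <-]. Qed.

Lemma mnorm_ge0 f : 0 <= mnorm f.
Proof. exact: le_trans (opnorm_ge0 _) (opnorm_le_mnorm f (DT_base y1)). Qed.

Lemma mnorm_eq0 f : mnorm f = 0 -> f = 0.
Proof.
move=> f0; apply: val_inj; apply/funext => p; apply: opnorm_eq0; apply/le_anti.
by rewrite opnorm_ge0 -f0 opnorm_le_mnorm.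
Qed.

Lemma mnormD f g : mnorm (f + g) <= mnorm f + mnorm g.
Proof.
apply: mnorm_le => p; apply: le_trans (opnormD _ _) _.
by rewrite lerD ?opnorm_le_mnorm.
Qed.

Lemma mnormZ c f : mnorm (c *: f) = normc c * mnorm f.
Proof.
have le d g : mnorm (d *: g) <= normc d * mnorm g.
  by apply: mnorm_le => p; rewrite opnormZ ler_wpM2l ?normc_ge0 ?opnorm_le_mnorm.
apply/le_anti; rewrite le /=; have [->|c0] := eqVneq c 0.
  by rewrite normc0 mul0r mnorm_ge0.
have nc : 0 < normc c by rewrite lt_neqAle normc_ge0 eq_sym normc_eq0E c0.
rewrite mulrC -ler_pdivlMr // mulrC -normcV.
have {1}-> : f = c^-1 *: (c *: f) by rewrite scalerA mulVf // scale1r.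
exact: le.
Qed.

Lemma mnormM f g : mnorm (f * g) <= mnorm f * mnorm g.
Proof.
apply: mnorm_le => p; apply: le_trans (opnormM _ _) _.
by apply: ler_pM; rewrite ?opnorm_ge0 ?opnorm_le_mnorm.
Qed.

Lemma mnorm_star_mul f : mnorm (star f * f) = mnorm f ^+ 2.
Proof.
apply/le_anti/andP; split.
  apply: mnorm_le => p; rewrite [opnorm _]opnorm_star_mul.
  by apply: lerXn2r; rewrite ?nnegrE ?opnorm_ge0 ?mnorm_ge0 ?opnorm_le_mnorm.
rewrite -[leRHS]sqr_sqrtr ?mnorm_ge0 //; apply: lerXn2r; rewrite ?nnegrE ?sqrtr_ge0 ?mnorm_ge0 //.
apply: mnorm_le => p; rewrite -[leLHS]ger0_norm ?opnorm_ge0 // -sqrtr_sqr ler_wsqrtr //.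
by rewrite -opnorm_star_mul; exact: (opnorm_le_mnorm (star f * f)).
Qed.

Lemma mnorm_complete (u : nat -> M) :
  (forall e : R, 0 < e -> \forall m & n \near \oo, mnorm (u m - u n) < e) ->
  exists l, mnorm (u n - l) @[n --> \oo] --> (0 : R).
Proof.
move=> cu; have cuN (e : R) : 0 < e -> exists N, forall m n, (N <= m)%N -> (N <= n)%N ->
    mnorm (u m - u n) < e.
  move=> /cu[[P Q] /= [[N1 _ h1] [N2 _ h2]] hPQ]; exists (maxn N1 N2) => m n.
  rewrite !geq_max => /andP[m1 _] /andP[_ n2].
  exact: hPQ (m, n) (conj (h1 m m1) (h2 n n2)).
have /choice[l hl] : forall p : DT y, exists l, @clim R 'M[R[i]]_4 (fun n => u n p) l.
  move=> p; apply: cauchy_clim => e /cuN[N hN]; exists N => m n hm hn.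
  exact: le_lt_trans (opnorm_le_mnorm (u m - u n) p) (hN m n hm hn).
have unif (e : R) : 0 < e -> exists N, forall n p, (N <= n)%N -> opnorm (u n p - l p) <= e.
  move=> /cuN[N hN]; exists N => n p Nn.
  apply: (@clim_le R 'M[R[i]]_4 (fun m => u n p - u (N + m)%N p)).
    move=> m; apply: le_trans (opnorm_le_mnorm (u n - u (N + m)%N) p) (ltW (hN _ _ Nn _)).
    exact: leq_addr.
  apply: climD; first exact: clim_cst.
  apply: climN => e' e'0; have [N' hN'] := hl p e' e'0; exists N' => m h; apply: hN'.
  exact: leq_trans h (leq_addl _ _).
have ml : l \in @model_pred R y.
  apply: (model_pred_closed y1) => e e0; have e2 : 0 < e / 2 by rewrite divr_gt0.
  have [N hN] := unif _ e2; exists (u N); first exact: model_valP.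
  move=> p; have := hN N p (leqnn N).
  have -> : opnorm (l p - u N p) = opnorm (u N p - l p).
    exact: opnormB_sym.
  by move=> /le_lt_trans; apply; rewrite [ltRHS]splitr ltrDl.
exists (Model y01 ml); apply/cvgrPdist_lt => e e0; have e2 : 0 < e / 2 by rewrite divr_gt0.
have [N hN] := unif _ e2; exists N => // n /= Nn.
rewrite sub0r normrN ger0_norm ?mnorm_ge0 //.
apply: (@le_lt_trans _ _ (e / 2)); last by rewrite [ltRHS]splitr ltrDl.
by apply: mnorm_le => p; exact: hN.
Qed.

HB.instance Definition _ := StarAlgebra_isCStar.Build R M
  mnorm_eq0 mnormD mnormZ mnormM mnorm_star_mul mnorm_complete.

End model_norm.

(** * The generators of the model *)

Section generator_identities.
Variable R : realType.
Implicit Types (x : R) (y z c : R[i]).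
Local Notation one2 := (1%:M : 'M[R[i]]_2).

Definition halfsq x z : R[i] := z * (wt x * wt (1 - x)).

Lemma wt_sqr x : 0 <= x -> wt x * wt x = x%:C.
Proof. by move=> x0; rewrite -rmorphM -expr2 sqr_sqrtr. Qed.

Lemma conj_wt x : Num.conj (wt x) = wt x.
Proof. exact: conj_real. Qed.

Lemma alpha_star_mul x z : 0 <= x <= 1 -> normc z = 1 ->
  (alphamx x z) ^t* *m alphamx x z + alphamx x z *m (alphamx x z) ^t* = 1%:M.
Proof.
move=> /andP[x0 x1] nz; have cz := conj_unit nz.
have h1 : wt (1 - x) * wt (1 - x) = 1 - x%:C by rewrite wt_sqr ?subr_ge0 // rmorphB rmorph1.
have h2 := wt_sqr x0.
apply/matrixP => i j; rewrite mxE [_%:M _ _]mxE !mul_mx2.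
case: (I2P i) (I2P j) => -> [] ->; rewrite !mxE /= ?rmorph0 ?rmorphM /= ?conj_wt ?mul0r ?mulr0 ?addr0 ?add0r //.
  transitivity (Num.conj z * z * (wt x * wt x) + wt (1 - x) * wt (1 - x)); first by ring.
  by rewrite cz h1 h2; ring.
transitivity (Num.conj z * z * (wt x * wt x) + wt (1 - x) * wt (1 - x)); first by ring.
by rewrite cz h1 h2; ring.
Qed.

Lemma alpha_sqr x z : alphamx x z *m alphamx x z = (halfsq x z)%:M.
Proof.
apply/matrixP => i j; rewrite [_%:M _ _]mxE mul_mx2.
case: (I2P i) (I2P j) => -> [] ->; rewrite !mxE /= ?mul0r ?mulr0 ?addr0 ?add0r //;
  by rewrite /halfsq mulr1n; ring.
Qed.

Lemma sign_alpha x z : signmx R *m alphamx x z = - (alphamx x z *m signmx R).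
Proof.
apply/matrixP => i j; rewrite [RHS]mxE !mul_mx2.
by case: (I2P i) (I2P j) => -> [] ->; rewrite !mxE /= ?mul0r ?mulr0 ?addr0 ?add0r ?oppr0 //; ring.
Qed.

Lemma sign_star : (signmx R) ^t* = signmx R.
Proof.
apply/matrixP => i j.
by case: (I2P i) (I2P j) => -> [] ->; rewrite !mxE /= ?rmorphN ?rmorph0 ?rmorph1.
Qed.

Lemma sign_sqr : signmx R *m signmx R = 1%:M.
Proof.
apply/matrixP => i j; rewrite [RHS]mxE mul_mx2.
by case: (I2P i) (I2P j) => -> [] ->; rewrite !mxE /= ?mul0r ?mulr0 ?addr0 ?add0r ?mulr1 ?mulrNN ?mulr1.
Qed.

Lemma mx_star_tr (A : 'M[R[i]]_2) : (A^T) ^t* = (A ^t*)^T.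
Proof. by apply/matrixP => i j; rewrite !mxE. Qed.

Lemma tens_starE (A B : 'M[R[i]]_2) : (A *t B) ^t* = (A ^t*) *t (B ^t*).
Proof.
rewrite trmx_tens; apply/matrixP => i j; rewrite !mxE rmorphM //.
Qed.

Lemma tens_mul (A B A' B' : 'M[R[i]]_2) : (A *t B) *m (A' *t B') = (A *m A') *t (B *m B').
Proof. exact: (@tensmx_mul R[i] 2 2 2 2 2 2). Qed.

Lemma tens_mulr (A B A' B' : 'M[R[i]]_2) :
  (A *t B : 'M[R[i]]_4) * (A' *t B' : 'M[R[i]]_4) = (A *m A') *t (B *m B').
Proof. exact: tens_mul. Qed.

Lemma tens1 c : (c%:M : 'M[R[i]]_2) *t one2 = c *: (1 : 'M[R[i]]_4).
Proof.
apply: blk_inj => i j; rewrite blk_tens blkZ blk1 mxE.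
by case: eqP => _; rewrite ?mulr1n ?mulr0n ?scale0r ?scaler0.
Qed.

Lemma tens1r c : one2 *t (c%:M : 'M[R[i]]_2) = c *: (1 : 'M[R[i]]_4).
Proof.
apply: blk_inj => i j; rewrite blk_tens blkZ blk1 mxE.
case: eqP => _; rewrite ?mulr1n ?mulr0n ?scale0r ?scaler0 ?scale1r //.
by apply/matrixP => k l; rewrite !mxE; case: eqP => _; rewrite ?mulr1 ?mulr0.
Qed.

Lemma tensDl (A A' B : 'M[R[i]]_2) : (A + A') *t B = A *t B + A' *t B.
Proof. by apply: blk_inj => i j; rewrite blkD !blk_tens mxE scalerDl. Qed.

Lemma tensDr (A B B' : 'M[R[i]]_2) : A *t (B + B') = A *t B + A *t B'.
Proof. by apply: blk_inj => i j; rewrite blkD !blk_tens scalerDr. Qed.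

Lemma tensZl c (A B : 'M[R[i]]_2) : (c *: A) *t B = c *: (A *t B).
Proof. by apply: blk_inj => i j; rewrite blkZ !blk_tens mxE scalerA. Qed.

Lemma tensZr c (A B : 'M[R[i]]_2) : A *t (c *: B) = c *: (A *t B).
Proof. by apply: blk_inj => i j; rewrite blkZ !blk_tens !scalerA mulrC. Qed.

Lemma tensNl (A B : 'M[R[i]]_2) : (- A) *t B = - (A *t B).
Proof. by rewrite -[in LHS]scaleN1r tensZl scaleN1r. Qed.

Lemma gen1_star x z : star (gen1 x z) = (alphamx x z) ^t* *t one2.
Proof. by rewrite -tens_star. Qed.

Lemma gen1_anti_star x z : 0 <= x <= 1 -> normc z = 1 ->
  anti (gen1 x z) (star (gen1 x z)) = 1.
Proof.
move=> hx nz; rewrite antiC gen1_star /anti !tens_mulr.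
by rewrite -tensDl alpha_star_mul // !mulmx1 tens1 scale1r.
Qed.

Lemma gen1_sqr x z : gen1 x z * gen1 x z = (halfsq x z)%:A.
Proof. by rewrite tens_mulr alpha_sqr mulmx1 tens1. Qed.

(** A weighted fermion in the second factor; the sign matrix makes it anticommute with [gen1] and
    its adjoint instead of commuting. *)
Definition pgen x z : 'M[R[i]]_4 := signmx R *t (alphamx x z)^T.

Lemma pgen_sqr x z : pgen x z * pgen x z = (halfsq x z)%:A.
Proof.
rewrite tens_mulr sign_sqr -trmx_mul alpha_sqr tr_scalar_mx.
exact: tens1r.
Qed.

Lemma pgen_star x z : star (pgen x z) = signmx R *t ((alphamx x z) ^t*)^T.
Proof. by rewrite -[star _]/((pgen x z) ^t*) /pgen tens_starE sign_star mx_star_tr. Qed.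

Lemma pgen_anti_star x z : 0 <= x <= 1 -> normc z = 1 ->
  anti (pgen x z) (star (pgen x z)) = 1.
Proof.
move=> hx nz; rewrite pgen_star /anti !tens_mulr.
rewrite -tensDr -!trmx_mul -linearD /= alpha_star_mul // trmx1 sign_sqr.
by rewrite tens1r scale1r.
Qed.

Lemma pgen_anti_gen1 x z x' z' : anti (pgen x z) (gen1 x' z') = 0.
Proof.
rewrite /anti !tens_mulr mulmx1 mul1mx.
by rewrite sign_alpha tensNl addNr.
Qed.

Lemma sign_alpha_star x z : signmx R *m (alphamx x z) ^t* = - ((alphamx x z) ^t* *m signmx R).
Proof.
have := congr1 (fun A : 'M[R[i]]_2 => A ^t*) (sign_alpha x z).
rewrite trmx_mul map_mxM sign_star => ->.
have -> : (- (alphamx x z *m signmx R)) ^t* = - ((alphamx x z *m signmx R) ^t*).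
  by apply/matrixP => i j; rewrite !mxE rmorphN.
by rewrite trmx_mul map_mxM sign_star opprK.
Qed.

Lemma pgen_anti_gen1_star x z x' z' : anti (pgen x z) (star (gen1 x' z')) = 0.
Proof.
rewrite gen1_star /anti !tens_mulr mulmx1 mul1mx.
by rewrite sign_alpha_star tensNl addNr.
Qed.

Lemma gen2E y x1 x2 z1 z2 : gen2 y x1 x2 z1 z2 =
  rcoef y x1 z1 *: gen1 x1 z1 + scoef y x1 *: star (gen1 x1 z1) + kcoef y x1 *: pgen x2 z2.
Proof. by rewrite /gen2 tensDl !tensZl tensZr gen1_star. Qed.

Definition gen2sq y x1 x2 z1 z2 : R[i] :=
  rcoef y x1 z1 ^+ 2 * halfsq x1 z1 + scoef y x1 ^+ 2 * Num.conj (halfsq x1 z1)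
  + rcoef y x1 z1 * scoef y x1 + kcoef y x1 ^+ 2 * halfsq x2 z2.

Section two_fermions.
Variables (Q : starAlgType R[i]) (a b : Q) (c1 c2 y r s k : R[i]).
Hypotheses (aas : anti a (star a) = 1) (a2 : a * a = c1%:A)
  (ba : anti b a = 0) (bs : anti b (star a) = 0)
  (bbs : anti b (star b) = 1) (b2 : b * b = c2%:A)
  (rE : r = - 2 * s * Num.conj c1) (sd : s * (1 - 4 * (Num.conj c1 * c1)) = y)
  (sy : Num.conj s * y = s * Num.conj y)
  (kR : Num.conj k = k) (kk : k * k = 1 - s * Num.conj y).

Let aa : anti a a = (2 * c1)%:A.
Proof. by rewrite anti_refl a2 scalerA. Qed.
Let ss : anti (star a) (star a) = (2 * Num.conj c1)%:A.
Proof. by rewrite -anti_star aa starZ star1 rmorphM rmorph_nat. Qed.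
Let sba : anti (star b) a = 0. Proof. by rewrite -[a]starK -anti_star bs star0. Qed.
Let sbs : anti (star b) (star a) = 0. Proof. by rewrite -anti_star ba star0. Qed.
Let bb : anti b b = (2 * c2)%:A.
Proof. by rewrite anti_refl b2 scalerA. Qed.

Let g := r *: a + s *: star a + k *: b.

Lemma two_fermions_relations : enveloping_relations y a g.
Proof.
split.
- by rewrite -[LHS]/(anti (star a) a) antiC aas.
- rewrite -[LHS]/(anti (star g) g) antiC.
  rewrite /g !starD !starZ starK kR !anti_simp.
  rewrite [anti (star a) a]antiC [anti a (star b)]antiC [anti (star a) (star b)]antiC.
  rewrite aas aa ss ba bs sba sbs bbs !scaler0 !addr0 ?add0r ?scalerDr !scalerA -!scalerDl.
  rewrite -[RHS]scale1r; congr (_ *: _); rewrite kk rE !rmorphM rmorphN rmorph_nat /= conjCK.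
  transitivity (1 + Num.conj s * (s * (1 - 4 * (Num.conj c1 * c1))) - s * Num.conj y).
    by ring.
  by rewrite sd sy addrK.
- apply/eqP; rewrite -addr_eq0; apply/eqP; rewrite -[LHS]/(anti (star a) g) /g !anti_simp.
  rewrite [anti (star a) a]antiC [anti (star a) b]antiC aas ss bs scaler0 addr0 scalerA -scalerDl.
  by rewrite rE (_ : _ + _ = 0) ?scale0r //; ring.
- rewrite -[LHS]/(anti a g) /g !anti_simp.
  rewrite [anti a b]antiC aas aa ba scaler0 addr0 scalerA -scalerDl; congr (_ *: _).
  by rewrite -[RHS]sd rE; ring.
Qed.

Lemma two_fermions_sqr : g * g =
  (r ^+ 2 * c1 + s ^+ 2 * Num.conj c1 + r * s + k ^+ 2 * c2)%:A.
Proof.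
apply: anti_eqZ; rewrite /g !anti_simp.
rewrite [anti (star a) a]antiC [anti a b]antiC [anti (star a) b]antiC.
rewrite aas aa ss ba bs bb !scaler0 !addr0 !add0r ?scalerDr !scalerA -!scalerDl.
by congr (_ *: _); ring.
Qed.

End two_fermions.

Section relations.
Variables (y : R[i]) (x1 x2 : R) (z1 z2 : R[i]).
Hypotheses (y01 : 0 < normc y < 1) (hx1 : 0 <= x1 <= xmax y) (hx2 : 0 <= x2 <= 1 / 2)
  (nz1 : normc z1 = 1) (nz2 : normc z2 = 1).

Let d : R := 1 - 2 * x1.

Lemma delta_ge : normc y <= d.
Proof. by move: hx1; rewrite /d /xmax; lra. Qed.

Lemma delta_gt0 : 0 < d.
Proof. by case/andP: y01 => h _; apply: lt_le_trans h delta_ge. Qed.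

Lemma kcoef_arg_ge0 : 0 <= 1 - normc y ^+ 2 / d ^+ 2.
Proof.
rewrite subr_ge0 ler_pdivrMr ?exprn_gt0 ?delta_gt0 // mul1r.
by apply: lerXn2r; rewrite ?nnegrE ?normc_ge0 ?delta_ge // ltW // delta_gt0.
Qed.

(** The coefficient of the second fermion dies exactly on this face, which explains why the boundary
    condition there erases x2 and z2. *)
Lemma kcoef_eq0 : (kcoef y x1 == 0) = (x1 == xmax y).
Proof.
rewrite /kcoef /wt fmorph_eq0 sqrtr_eq0 le_eqVlt ltNge kcoef_arg_ge0 orbF -/d.
rewrite subr_eq0 eq_sym -[1](divff (expf_neq0 2 (lt0r_neq0 delta_gt0))).
rewrite (can_eq (mulfVK (expf_neq0 2 (lt0r_neq0 delta_gt0)))).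
rewrite eqrXn2 ?normc_ge0 ?ltW ?delta_gt0 // /d /xmax.
by apply/eqP/eqP; lra.
Qed.

Let a := gen1 x1 z1.
Let b := pgen x2 z2.

Let hx1' : 0 <= x1 <= 1.
Proof. by have := delta_gt0; move: hx1; rewrite /d; lra. Qed.
Let hx2' : 0 <= x2 <= 1. Proof. by move: hx2; lra. Qed.
Let c1 := halfsq x1 z1.
Let r := rcoef y x1 z1.
Let s := scoef y x1.
Let k := kcoef y x1.

Let dC : d%:C != 0 :> R[i].
Proof. by rewrite fmorph_eq0 lt0r_neq0 // delta_gt0. Qed.

Let dE : d%:C ^+ 2 = 1 - 4 * (Num.conj c1 * c1).
Proof.
rewrite /c1 /halfsq !rmorphM /= !conj_wt.
have -> : Num.conj z1 * (wt x1 * wt (1 - x1)) * (z1 * (wt x1 * wt (1 - x1))) =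
  (Num.conj z1 * z1) * (wt x1 * wt x1) * (wt (1 - x1) * wt (1 - x1)) by ring.
case/andP: hx1' => h0 h1; rewrite conj_unit // !wt_sqr ?subr_ge0 // /d.
by rewrite !(rmorphB, rmorphM, rmorph1, rmorph_nat); ring.
Qed.

Let sE : s = y / d%:C ^+ 2. Proof. by rewrite /s /scoef rmorphXn. Qed.
Let sd : s * (1 - 4 * (Num.conj c1 * c1)) = y.
Proof. by rewrite -dE sE divfK // expf_neq0. Qed.

Let kk : k * k = 1 - s * Num.conj y.
Proof.
have yy : y * Num.conj y = (normc y ^+ 2)%:C.
  by rewrite rmorphXn; exact/esym/normCK.
rewrite wt_sqr ?kcoef_arg_ge0 // sE [y / _ * _]mulrAC yy rmorphB rmorphM /= fmorphV /= !rmorphXn rmorph1 -/d.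
reflexivity.
Qed.

Let sy : Num.conj s * y = s * Num.conj y.
Proof. by rewrite sE rmorphM fmorphV rmorphXn /= conj_real mulrAC [RHS]mulrAC [y * _]mulrC. Qed.

Lemma gen_relations : enveloping_relations y (gen1 x1 z1) (gen2 y x1 x2 z1 z2).
Proof.
rewrite gen2E; apply: (@two_fermions_relations _ _ _ c1) => //.
- exact: gen1_anti_star.
- exact: gen1_sqr.
- exact: pgen_anti_gen1.
- exact: pgen_anti_gen1_star.
- exact: pgen_anti_star.
- exact: conj_wt.
Qed.

Lemma gen2_sqr : gen2 y x1 x2 z1 z2 * gen2 y x1 x2 z1 z2 = (gen2sq y x1 x2 z1 z2)%:A.
Proof.
rewrite gen2E; apply: two_fermions_sqr.
- exact: gen1_anti_star.
- exact: gen1_sqr.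
- exact: pgen_anti_gen1.
- exact: pgen_anti_gen1_star.
- exact: pgen_sqr.
Qed.

End relations.

End generator_identities.

Section model_generators.
Variables (R : realType) (y : R[i]) (y01 : 0 < normc y < 1).
Implicit Types (p q : DT y) (x : R) (z : R[i]).
Local Notation M := (model y01).

Let y1 : normc y < 1. Proof. by case/andP: y01. Qed.

Lemma DT_ext p q : px1 p = px1 q -> px2 p = px2 q -> pz1 p = pz1 q -> pz2 p = pz2 q -> p = q.
Proof.
move=> a b c d; apply: val_inj; move: a b c d; rewrite /px1 /px2 /pz1 /pz2.
by case: (\val p) (\val q) => [[[? ?] ?] ?] [[[? ?] ?] ?] /= -> -> -> ->.
Qed.

(** The squared modulus x(1 - x) is injective on [0, 1/2]; once x is known, the phase can be divided
    out unless x = 0. *)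
Lemma halfsq_inj x x' z z' : 0 <= x <= 1 / 2 -> 0 <= x' <= 1 / 2 ->
  normc z = 1 -> normc z' = 1 -> halfsq x z = halfsq x' z' -> x = x' /\ (x = 0 \/ z = z').
Proof.
move=> hx hx' nz nz' e.
have nE (t : R) (w : R[i]) : 0 <= t <= 1 / 2 -> normc w = 1 -> normc (halfsq t w) ^+ 2 = t * (1 - t).
  move=> ht nw; rewrite normcM nw mul1r normcM !normc_real !ger0_norm ?sqrtr_ge0 //.
  by rewrite exprMn !sqr_sqrtr //; move: ht; lra.
have xx : x = x'.
  have := nE x z hx nz; rewrite e nE // => h.
  have /eqP : (x - x') * (1 - x - x') = 0.
    by transitivity (x * (1 - x) - x' * (1 - x')); [ring|rewrite h subrr].
  by rewrite mulf_eq0 => /orP[] /eqP; move: hx hx'; lra.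
split=> //; have [x0|x0] := eqVneq x 0; [by left|right].
move: e; rewrite -xx /halfsq; apply: mulIf.
case/andP: hx => h0 h1.
by rewrite mulf_neq0 // fmorph_eq0 sqrtr_eq0 -ltNge; [rewrite lt0r x0|lra].
Qed.

Let px1_half p : 0 <= px1 p <= 1 / 2.
Proof.
have [] := DT_pointP p; rewrite /xmax => h _ _ _; have := normc_ge0 y; move: h; lra.
Qed.

Lemma model_separation p q :
  halfsq (px1 p) (pz1 p) = halfsq (px1 q) (pz1 q) ->
  gen2sq y (px1 p) (px2 p) (pz1 p) (pz2 p) = gen2sq y (px1 q) (px2 q) (pz1 q) (pz2 q) ->
  forall f : M, f p = f q.
Proof.
move=> e1 e2 f; have [a b c d] := DT_pointP p; have [a' b' c' d'] := DT_pointP q.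
have /model_predP[_ /(boundaryP y1)[h1 h2 h3 _ _]] := model_valP f.
have [xx z1E] := halfsq_inj (px1_half p) (px1_half q) c c' e1.
(* The mixed point takes its first coordinates from p and its second ones from q, so the two
   boundary identifications are used one at a time. *)
have [q' [q1 q2 q3 q4]] := DT_point a b' c d'.
have -> : f q = f q'.
  case: z1E => [x0|zz]; first by apply: h1; rewrite ?q1 ?q2 ?q4 -?xx.
  by congr (f _); apply: DT_ext; rewrite ?q1 ?q2 ?q3 ?q4 -?xx -?zz.
have : kcoef y (px1 p) ^+ 2 * (halfsq (px2 p) (pz2 p) - halfsq (px2 q) (pz2 q)) = 0.
  rewrite mulrBr; apply/eqP; rewrite subr_eq0; apply/eqP.
  by move: e2; rewrite /gen2sq /rcoef -![_ * (wt _ * wt _)]/(halfsq _ _) -e1 -xx => /addrI.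
move/eqP; rewrite mulf_eq0 expf_eq0 /= kcoef_eq0 // => /orP[/eqP k0|].
  by apply: h3; rewrite ?q1 ?q3.
rewrite subr_eq0 => /eqP /(halfsq_inj b b' d d')[x2E z2E].
case: z2E => [x0|zz]; first by apply: h2; rewrite ?q1 ?q2 ?q3 -?x2E.
by congr (f _); apply: DT_ext; rewrite ?q1 ?q2 ?q3 ?q4.
Qed.

Lemma alphamx0 z z' : alphamx 0 z = alphamx 0 z'.
Proof. by apply/matrixP => i j; rewrite !mxE /wt sqrtr0 !mulr0. Qed.

Lemma scalar_blk_gen1 x z i j : scalar_blk (blk i j (gen1 x z)).
Proof. by rewrite blk_tens; split; rewrite !mxE /= ?mulr0. Qed.

Lemma scalar_reflection z (G : 'M[R[i]]_2) : scalar_blk G -> reflection_blk z G.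
Proof. by move=> [a b c]; split; rewrite ?a ?b ?mulr0. Qed.

Lemma blk_gen2 x1 x2 z1 z2 i j : exists c,
  blk i j (gen2 y x1 x2 z1 z2) = c%:M + (signmx R i j * kcoef y x1) *: (alphamx x2 z2)^T.
Proof.
eexists; rewrite blkD !blk_tens scalerA; congr (_ + _).
by rewrite scalemx1.
Qed.

Lemma boundary_gen1 : boundary_conditions (fun p => gen1 (px1 p) (pz1 p)).
Proof.
apply/(boundaryP y1); split=> [p q -> -> _ _|p q _ _ -> ->|p q -> -> ->|p _ i j|p _ i j] //.
- by rewrite /gen1 (alphamx0 _ (pz1 q)).
- exact: scalar_blk_gen1.
- exact: scalar_reflection (scalar_blk_gen1 _ _ _ _).
Qed.

Lemma boundary_gen2 : boundary_conditions (fun p => gen2 y (px1 p) (px2 p) (pz1 p) (pz2 p)).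
Proof.
have k0 p : px1 p = xmax y -> kcoef y (px1 p) = 0.
  have [a b c d] := DT_pointP p.
  by move=> e; apply/eqP; rewrite kcoef_eq0 //; apply/eqP.
apply/(boundaryP y1); split.
- move=> p q -> -> -> ->; rewrite /gen2 (alphamx0 (pz1 p) (pz1 q)) /rcoef.
  by rewrite /wt sqrtr0 !mul0r !mulr0.
- by move=> p q -> -> -> ->; rewrite /gen2 (alphamx0 (pz2 p) (pz2 q)).
- move=> p q /[dup] /k0 kp e /[dup] /k0 kq e' ezz; rewrite /gen2 kp kq !scale0r ezz.
  by rewrite e e'.
- move=> p /k0 kp i j; have [c ->] := blk_gen2 (px1 p) (px2 p) (pz1 p) (pz2 p) i j.
  by rewrite kp mulr0 scale0r addr0; split; rewrite !mxE.
- move=> p e i j; have [c ->] := blk_gen2 (px1 p) (px2 p) (pz1 p) (pz2 p) i j; rewrite e.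
  have half : 1 - 1 / 2 = 1 / 2 :> R by field.
  by split; rewrite !mxE /= ?half ?mulr0 ?mulr0n ?add0r ?addr0 //; ring.
Qed.

Section continuity.
Variable T : topologicalType.
Implicit Types (f g : T -> R[i]) (r : T -> R).

Lemma continuous_cM f g : continuous f -> continuous g -> continuous (fun t => f t * g t).
Proof. by move=> cf cg t; exact: (cvgM (cf t) (cg t)). Qed.

Lemma continuous_ccst (c : R[i]) : continuous (fun _ : T => c).
Proof. by move=> t; exact: cvg_cst. Qed.

Lemma continuous_cD f g : continuous f -> continuous g -> continuous (fun t => f t + g t).
Proof. by move=> cf cg t; exact: (cvgD (cf t) (cg t)). Qed.

Lemma continuous_rsub1 r : continuous r -> continuous (fun t => 1 - r t).
Proof. by move=> cr t; apply: cvgB (cr t); exact: cvg_cst. Qed.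

Lemma continuous_rM r r' : continuous r -> continuous r' -> continuous (fun t => r t * r' t).
Proof. by move=> cr cr' t; exact: (cvgM (cr t) (cr' t)). Qed.

Lemma continuous_rcst (c : R) : continuous (fun _ : T => c).
Proof. by move=> t; exact: cvg_cst. Qed.

Lemma continuous_rV r : (forall t, r t != 0) -> continuous r -> continuous (fun t => (r t)^-1).
Proof. by move=> r0 cr t; apply: cvgV => //; exact: cr. Qed.

Lemma continuous_cV f : (forall t, f t != 0) -> continuous f -> continuous (fun t => (f t)^-1).
Proof. by move=> f0 cf t; apply: cvgV => //; exact: cf. Qed.

Lemma continuous_rC r : continuous r -> continuous (fun t => (r t)%:C).
Proof. by move=> cr t; apply: continuous_comp (cr t) _; exact: continuous_real_complex. Qed.

Lemma continuous_cconj f : continuous f -> continuous (fun t => Num.conj (f t)).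
Proof. by move=> cf t; apply: continuous_comp (cf t) _; exact: continuous_conj. Qed.

Lemma continuous_wt r : continuous r -> continuous (fun t => wt (r t)).
Proof.
move=> cr t; apply: (@continuous_comp _ _ _ (fun t => Num.sqrt (r t)) (real_complex R)).
  by apply: continuous_comp (cr t) _; exact: sqrt_continuous.
exact: continuous_real_complex.
Qed.

Lemma continuous_tens (A B : T -> 'M[R[i]]_2) :
  (forall i j, continuous (fun t => A t i j)) -> (forall i j, continuous (fun t => B t i j)) ->
  continuous (fun t => A t *t B t).
Proof.
move=> cA cB; apply/entry_continuous => i j.
rewrite (_ : (fun _ => _) = fun t =>
   A t (@mxtens_unindex 2 2 i).1 (@mxtens_unindex 2 2 j).1 *
   B t (@mxtens_unindex 2 2 i).2 (@mxtens_unindex 2 2 j).2).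
  exact: continuous_cM.
by apply/funext => t; rewrite !mxE.
Qed.

Lemma continuous_alphamx r f : continuous r -> continuous f ->
  forall i j, continuous (fun t => alphamx (r t) (f t) i j).
Proof.
move=> cr cf i j.
have cr' := continuous_rsub1 cr.
case: (I2P i) (I2P j) => -> [] ->; under eq_fun do rewrite mxE /=.
- by move=> t; exact: cvg_cst.
- exact: (continuous_wt cr').
- by apply: continuous_cM; [exact: cf|exact: continuous_wt cr].
- by move=> t; exact: cvg_cst.
Qed.

End continuity.

Lemma continuous_px1 : continuous (@px1 R y).
Proof.
move=> p; apply: (@continuous_comp _ _ _ (\val : DT y -> _) (fun u => u.1.1.1)).
  exact: initial_continuous.
apply: (@continuous_comp _ _ _ (fun u => u.1.1) fst); last exact: cvg_fst.
by apply: (@continuous_comp _ _ _ fst fst); exact: cvg_fst.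
Qed.

Lemma continuous_px2 : continuous (@px2 R y).
Proof.
move=> p; apply: (@continuous_comp _ _ _ (\val : DT y -> _) (fun u => u.1.1.2)).
  exact: initial_continuous.
apply: (@continuous_comp _ _ _ (fun u => u.1.1) snd); last exact: cvg_snd.
by apply: (@continuous_comp _ _ _ fst fst); exact: cvg_fst.
Qed.

Lemma continuous_pz1 : continuous (@pz1 R y).
Proof.
move=> p; apply: (@continuous_comp _ _ _ (\val : DT y -> _) (fun u => u.1.2)).
  exact: initial_continuous.
by apply: (@continuous_comp _ _ _ fst snd); [exact: cvg_fst|exact: cvg_snd].
Qed.

Lemma continuous_pz2 : continuous (@pz2 R y).
Proof.
move=> p; apply: (@continuous_comp _ _ _ (\val : DT y -> _) snd).
  exact: initial_continuous.
exact: cvg_snd.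
Qed.

Lemma continuous_gen1 : continuous (fun p => gen1 (px1 p) (pz1 p)).
Proof.
apply: continuous_tens => [|i j]; last exact: continuous_ccst.
by apply: continuous_alphamx; [exact: continuous_px1|exact: continuous_pz1].
Qed.

Let delta p : 1 - 2 * px1 p != 0.
Proof. by have [a _ _ _] := DT_pointP p; apply: lt0r_neq0; exact: delta_gt0 y01 a. Qed.

Let continuous_delta2 : continuous (fun p => (1 - 2 * px1 p) ^+ 2).
Proof.
have c : continuous (fun p => 1 - 2 * px1 p).
  apply: continuous_rsub1; apply: continuous_rM; [exact: continuous_rcst|exact: continuous_px1].
by under eq_fun do rewrite expr2; exact: continuous_rM.
Qed.

Lemma continuous_gen2 : continuous (fun p => gen2 y (px1 p) (px2 p) (pz1 p) (pz2 p)).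
Proof.
have ca i j := @continuous_alphamx _ _ _ continuous_px1 continuous_pz1 i j.
have cb i j := @continuous_alphamx _ _ _ continuous_px2 continuous_pz2 i j.
have cs : continuous (fun p => scoef y (px1 p)).
  apply: continuous_cM; first exact: continuous_ccst.
  apply: continuous_cV => [p|]; first by rewrite fmorph_eq0 expf_neq0.
  exact: continuous_rC continuous_delta2.
have cx1 := continuous_rsub1 continuous_px1.
have cr : continuous (fun p => rcoef y (px1 p) (pz1 p)).
  apply: continuous_cM.
    apply: continuous_cM; [exact: continuous_ccst|exact: cs].
  apply: continuous_cconj; apply: continuous_cM; first exact: continuous_pz1.
  apply: continuous_cM; [exact: continuous_wt continuous_px1|exact: continuous_wt cx1].
have ck : continuous (fun p => kcoef y (px1 p)).
  apply: continuous_wt; apply: continuous_rsub1; apply: continuous_rM; first exact: continuous_rcst.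
  by apply: continuous_rV continuous_delta2 => p; rewrite expf_neq0.
have cA : continuous (fun p =>
    (rcoef y (px1 p) (pz1 p) *: alphamx (px1 p) (pz1 p)
     + scoef y (px1 p) *: (alphamx (px1 p) (pz1 p)) ^t*) *t (1%:M : 'M[R[i]]_2)).
  apply: continuous_tens => i j; last exact: continuous_ccst.
  rewrite (_ : (fun _ => _) = fun p => rcoef y (px1 p) (pz1 p) * alphamx (px1 p) (pz1 p) i j
      + scoef y (px1 p) * Num.conj (alphamx (px1 p) (pz1 p) j i)).
    apply: continuous_cD; apply: continuous_cM; [exact: cr|exact: ca|exact: cs|].
    exact: continuous_cconj (ca j i).
  by apply/funext => p; rewrite !mxE.
have cB : continuous (fun p => signmx R *t (kcoef y (px1 p) *: (alphamx (px2 p) (pz2 p))^T)).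
  apply: continuous_tens => i j; first exact: continuous_ccst.
  rewrite (_ : (fun _ => _) = fun p => kcoef y (px1 p) * alphamx (px2 p) (pz2 p) j i).
    exact: continuous_cM ck (cb j i).
  by apply/funext => p; rewrite !mxE.
move=> p; exact: (@cvgD R[i] 'M[R[i]]_4 _ (nbhs p) _ _ _ _ _ (cA p) (cB p)).
Qed.

Let modgen1P : (fun p => gen1 (px1 p) (pz1 p)) \in @model_pred R y.
Proof. by apply/model_predP; split; [exact: continuous_gen1|exact: boundary_gen1]. Qed.

Let modgen2P : (fun p => gen2 y (px1 p) (px2 p) (pz1 p) (pz2 p)) \in @model_pred R y.
Proof. by apply/model_predP; split; [exact: continuous_gen2|exact: boundary_gen2]. Qed.

Definition modgen1 : M := Model y01 modgen1P.
Definition modgen2 : M := Model y01 modgen2P.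

Lemma model_eq (f g : M) : (forall p, f p = g p) -> f = g.
Proof. by move=> h; apply: val_inj; apply/funext. Qed.

Lemma modgen_relations : enveloping_relations y modgen1 modgen2.
Proof.
have rel p : enveloping_relations y (modgen1 p) (modgen2 p).
  by have [a b c d] := DT_pointP p; exact: gen_relations.
split; apply: model_eq => p; have [r1 r2 r3 r4] := rel p;
  [exact: r1|exact: r2|exact: r3|exact: r4].
Qed.

End model_generators.

(** * Density of the generated *-algebra *)

Record star_closed (C : numClosedFieldType) (A : starAlgType C) (S : A -> Prop) : Prop := {
  sc1 : S 1;
  scD : forall a b, S a -> S b -> S (a + b);
  scM : forall a b, S a -> S b -> S (a * b);
  scZ : forall c a, S a -> S (c *: a);
  scS : forall a, S a -> S (star a)
}.

Section star_closed_theory.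
Variables (C : numClosedFieldType) (A : starAlgType C) (S : A -> Prop).
Hypothesis cS : star_closed S.

Lemma sc0 : S 0.
Proof. by rewrite -(scale0r 1); apply: (scZ cS); exact: sc1 cS. Qed.

Lemma scB a b : S a -> S b -> S (a - b).
Proof. by move=> ha hb; rewrite -scaleN1r; apply: (scD cS) => //; exact: (scZ cS). Qed.

Lemma sc_sum (I : Type) (r : seq I) (F : I -> A) : (forall i, S (F i)) -> S (\sum_(i <- r) F i).
Proof.
move=> h; elim: r => [|i r IH]; first by rewrite big_nil; exact: sc0.
by rewrite big_cons; exact: (scD cS).
Qed.

End star_closed_theory.

(** * The generators span every admissible value at a point *)

Section fibre_span.
Variable R : realType.
Implicit Types (x : R) (y z : R[i]).

(* [sqrt (1 - x) alpha - z sqrt x alpha^* = (1 - 2 x) E_01] *)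
Lemma alphamx_generates (P : 'M[R[i]]_2 -> Prop) x z : star_closed P ->
  0 <= x < 1 / 2 -> normc z = 1 -> P (alphamx x z) -> forall A, P A.
Proof.
move=> cP /andP[x0 x1] nz Pa A; have cz := conj_unit nz.
have PE : P (delta_mx 0 1).
  have -> : delta_mx 0 1 = ((1 - 2 * x)^-1)%:C *:
      (wt (1 - x) *: alphamx x z - (z * wt x) *: star (alphamx x z)).
    have d0 : 1 - 2 * x != 0 by apply: lt0r_neq0; lra.
    have h1 : wt (1 - x) * wt (1 - x) = (1 - x)%:C by rewrite wt_sqr //; lra.
    have h2 := wt_sqr x0.
    apply/matrixP => i j; case: (I2P i) (I2P j) => -> [] ->; rewrite !mxE /= ?rmorphM /= ?conj_wt.
    - by rewrite conjC0 !mulr0 subrr mulr0.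
    - transitivity (((1 - 2 * x)^-1)%:C * (wt (1 - x) * wt (1 - x) - Num.conj z * z * (wt x * wt x))).
        rewrite cz h1 h2 mul1r -rmorphB -rmorphM /=.
        by rewrite (_ : _ * _ = 1) ?rmorph1 //; field.
      by ring.
    - by ring.
    - by rewrite conjC0 !mulr0 subrr mulr0.
  by apply: (scZ cP); apply: (scB cP); apply: (scZ cP) => //; apply: (scS cP).
have E (i j k : 'I_2) : delta_mx i j *m delta_mx j k = delta_mx i k :> 'M[R[i]]_2.
  by rewrite mul_delta_mx.
have PE' : P (delta_mx 1 0).
  have -> : delta_mx 1 0 = star (delta_mx 0 1 : 'M[R[i]]_2).
    apply/matrixP => i j; rewrite !mxE; case: (I2P i) (I2P j) => -> [] ->;
    by rewrite /= ?rmorph0 ?rmorph1.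
  exact: (scS cP).
have PEE (i j : 'I_2) : P (delta_mx i j).
  case: (I2P i) (I2P j) => -> [] -> //.
    by rewrite -(E 0 1 0); exact: (scM cP).
  by rewrite -(E 1 0 1); exact: (scM cP).
rewrite [A]matrix_sum_delta; apply: (sc_sum cP) => i; apply: (sc_sum cP) => j.
by apply: (scZ cP).
Qed.

Lemma sum_delta_tens (F : 'M[R[i]]_4) :
  F = \sum_i \sum_j (delta_mx i j : 'M[R[i]]_2) *t blk i j F.
Proof.
apply: blk_inj => k l; rewrite !sum_ord2 !blkD !blk_tens !mxE.
by case: (I2P k) (I2P l) => -> [] ->; rewrite /= !scale0r scale1r ?addr0 ?add0r.
Qed.

(** Since |y| > 0, x1 stays below 1/2, so the first generator yields the full first factor. On x1 =
    [xmax y] that is all that is allowed; elsewhere the second fermion is recovered from [gen2], and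
    it yields either the span of 1 and itself (x2 = 1/2) or the full second factor. *)
Lemma gen_span (P : 'M[R[i]]_4 -> Prop) y x1 x2 z1 z2 F : star_closed P ->
  0 < normc y < 1 -> 0 <= x1 <= xmax y -> 0 <= x2 <= 1 / 2 -> normc z1 = 1 -> normc z2 = 1 ->
  (x1 = xmax y -> forall i j, scalar_blk (blk i j F)) ->
  (x2 = 1 / 2 -> forall i j, reflection_blk z2 (blk i j F)) ->
  P (gen1 x1 z1) -> P (gen2 y x1 x2 z1 z2) -> P F.
Proof.
move=> cP y01 hx1 hx2 nz1 nz2 hmax hhalf P1 P2.
have Pl (A : 'M[R[i]]_2) : P (A *t (1%:M : 'M[R[i]]_2)).
  pose PL (D : 'M[R[i]]_2) : Prop := P (D *t (1%:M : 'M[R[i]]_2)).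
  suff h : star_closed PL /\ 0 <= x1 < 1 / 2.
    by case: h => h h'; exact: (@alphamx_generates PL x1 z1 h h' nz1 P1 A).
  rewrite {}/PL; split.
  - split.
    + by rewrite tens1 scale1r; exact: sc1 cP.
    + by move=> B D hB hD; rewrite tensDl; exact: (scD cP).
    + move=> B D hB hD.
      have -> : (B * D) *t (1%:M : 'M[R[i]]_2) = (B *t 1%:M) *m (D *t 1%:M).
        by rewrite tens_mul mulmx1.
      exact: (scM cP).
    + by move=> c B hB; rewrite tensZl; exact: (scZ cP).
    + by move=> B hB; rewrite -[star B]/(B ^t* ) -tens_star; exact: (scS cP).
  - have := delta_gt0 y01 hx1; move: hx1; lra.
have Pr (B : 'M[R[i]]_2) : P ((1%:M : 'M[R[i]]_2) *t B) -> forall A : 'M[R[i]]_2, P (A *t B).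
  by move=> h A; rewrite -[A]mulmx1 -[B]mul1mx -tens_mul; exact: (scM cP).
have [x1E|x1N] := eqVneq x1 (xmax y).
  rewrite [F]sum_delta_tens; apply: (sc_sum cP) => i; apply: (sc_sum cP) => j.
  have [a b c] := hmax x1E i j.
  have -> : blk i j F = blk i j F 0 0 *: 1%:M.
    apply/matrixP => k l; rewrite [RHS]mxE [1%:M _ _]mxE.
    by case: (I2P k) (I2P l) => -> [] ->; rewrite /= ?a ?b ?c ?mulr1 ?mulr0.
  by rewrite tensZr; exact: (scZ cP).
have Pb : P ((1%:M : 'M[R[i]]_2) *t (alphamx x2 z2)^T).
  have k0 : kcoef y x1 != 0 by rewrite kcoef_eq0.
  have -> : (1%:M : 'M[R[i]]_2) *t (alphamx x2 z2)^T =
     (signmx R *t (1%:M : 'M[R[i]]_2)) *m ((kcoef y x1)^-1 *: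
       (gen2 y x1 x2 z1 z2 - rcoef y x1 z1 *: gen1 x1 z1 - scoef y x1 *: star (gen1 x1 z1))).
    rewrite gen2E.
    have -> (a b c : 'M[R[i]]_4) : a + b + c - a - b = c.
      by rewrite -addrA -opprD addrC addKr.
    by rewrite scalerA mulVf // scale1r tens_mul sign_sqr mul1mx.
  apply: (scM cP) => //; apply: (scZ cP); apply: (scB cP); last first.
    by apply: (scZ cP); exact: (scS cP).
  by apply: (scB cP) => //; exact: (scZ cP).
rewrite [F]sum_delta_tens; apply: (sc_sum cP) => i; apply: (sc_sum cP) => j; apply: Pr.
have [x2E|x2N] := eqVneq x2 (1 / 2).
  have [a b] := hhalf x2E i j.
  have s0 : wt (1 / 2 : R) != 0 by rewrite fmorph_eq0 sqrtr_eq0 -ltNge; lra.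
  have -> : blk i j F = blk i j F 0 0 *: 1%:M + (blk i j F 1 0 / wt (1 / 2)) *: (alphamx x2 z2)^T.
    have half : 1 - 1 / 2 = 1 / 2 :> R by field.
    move: (blk i j F) a b => G a b.
    apply/matrixP => k l; rewrite x2E [RHS]mxE [(_ *: 1%:M) _ _]mxE [1%:M _ _]mxE.
    case: (I2P k) (I2P l) => -> [] ->;
      rewrite !mxE /= ?half ?a ?b ?mulr1 ?mulr0 ?addr0 ?add0r ?divfK //.
    by rewrite mulrCA divfK // mulrC.
  rewrite tensDr !tensZr; by apply: (scD cP); apply: (scZ cP).
suff : P ((1%:M : 'M[R[i]]_2) *t ((blk i j F)^T)^T) by rewrite trmxK.
pose PR (D : 'M[R[i]]_2) : Prop := P ((1%:M : 'M[R[i]]_2) *t D^T).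
suff h : star_closed PR /\ 0 <= x2 < 1 / 2.
  by case: h => h h'; exact: (@alphamx_generates PR x2 z2 h h' nz2 Pb).
rewrite {}/PR; split.
- split.
  + by rewrite trmx1; exact: Pl.
  + by move=> B D hB hD; rewrite linearD /= tensDr; exact: (scD cP).
  + move=> B D hB hD; rewrite -[B * D]/(B *m D) trmx_mul -[X in X *t _]mul1mx -tens_mul.
    exact: (scM cP).
  + by move=> c B hB; rewrite linearZ /= tensZr; exact: (scZ cP).
  + move=> B hB; rewrite -[star B]/(B ^t* ).
    have -> : (1%:M : 'M[R[i]]_2) *t (B ^t* )^T = ((1%:M : 'M[R[i]]_2) *t B^T) ^t*.
      rewrite tens_starE -mx_star_tr; congr (_ *t _).
      by apply/matrixP => k l; rewrite !mxE rmorph_nat eq_sym.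
    exact: (scS cP).
- by case/andP: hx2 => -> h /=; rewrite lt_neqAle x2N.
Qed.

End fibre_span.

Lemma continuous_dominated (R : realType) (T : topologicalType) (h : T -> 'M[R[i]]_4)
    (w : T -> R) : (forall p q, `|w p - w q| <= opnorm (h p - h q)) -> continuous h -> continuous w.
Proof.
move=> hw /continuous_opnormP ch p; apply/cvgrPdist_lt => e e0.
by apply: filterS (ch p e e0) => q; apply: le_lt_trans; exact: hw.
Qed.

Lemma compact_strict_bound (R : realType) (T : topologicalType) (u e : T -> R) (eps : R) :
  compact [set: T] -> continuous u -> continuous e -> (forall q, 0 <= e q) ->
  (forall q, eps <= u q -> e q < 1) ->
  exists2 t, 0 <= t < 1 & forall q, eps <= u q -> e q <= t.
Proof.
move=> cT cu ce e0 e1; pose K := [set q | eps <= u q].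
have [[q0 Kq0]|K0] := pselect (K !=set0); last first.
  exists 0; first by rewrite lexx ltr01.
  by move=> q Kq; case: K0; exists q.
have clK : closed K by move/continuous_closedP: cu => /(_ [set r | eps <= r]); apply; exact: closed_ge.
have cK : compact K by exact: (subclosed_compact clK cT).
have [||c] := @compact_EVT_max T R e K _ cK.
- by exists q0.
- exact: continuous_subspaceT.
move=> /set_mem Kc hc; exists (e c); last by move=> q Kq; apply: hc; exact: mem_set.
by rewrite e0 e1.
Qed.

Lemma compact_finite_cover (T : topologicalType) (U : T -> set T) :
  compact [set: T] -> (forall p, open (U p)) -> (forall p, U p p) ->
  exists s : seq T, forall q, exists2 p, p \in s & U p q.
Proof.
move=> /compact_near_coveringP cT oU Up.
(* Finite lists directed by inclusion: a property true locally for all large enough lists is, by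
   compactness, true everywhere for one list. *)
pose F := filter_from [set: seq T] (fun s => [set s' : seq T | {subset s <= s'}]).
have FF : Filter F.
  apply: filter_from_filter => [|s s' _ _]; first by exists [::].
  exists (s ++ s') => // t st; split=> x xs; apply: st; rewrite mem_cat xs ?orbT //.
have [q _|s _ hs] := cT (seq T) F (fun s q => exists2 p, p \in s & U p q) FF.
  exists (U q, [set s : seq T | q \in s]) => /=.
    split; first by exact: open_nbhs_nbhs (conj (oU q) (Up q)).
    by exists [:: q] => // s; apply; rewrite mem_head.
  by move=> [q' s] /= [Uq' qs]; exists q.
by exists s => q; apply: (hs s) => //.
Qed.

Section density.
Variables (R : realType) (y : R[i]) (y01 : 0 < normc y < 1).
Local Notation M := (model y01).
Variable S : M -> Prop.
Hypotheses (cS : star_closed S) (S1 : S (modgen1 y01)) (S2 : S (modgen2 y01)).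
Implicit Types (f g : M) (p q : DT y) (e w : DT y -> R).

Let y1 : normc y < 1. Proof. by case/andP: y01. Qed.

Lemma gen_value f p : exists2 g, S g & g p = f p.
Proof.
have [a b c d] := DT_pointP p; have /model_predP[_ /(boundaryP y1)[_ _ _ h3 h4]] := model_valP f.
pose P (F : 'M[R[i]]_4) := exists2 g, S g & g p = F.
apply: (@gen_span R P y (px1 p) (px2 p) (pz1 p) (pz2 p)) => //.
- split.
  + by exists 1 => //; exact: sc1 cS.
  + by move=> _ _ [g hg <-] [h hh <-]; exists (g + h) => //; exact: (scD cS).
  + by move=> _ _ [g hg <-] [h hh <-]; exists (g * h) => //; exact: (scM cS).
  + by move=> k _ [g hg <-]; exists (k *: g) => //; exact: (scZ cS).
  + by move=> _ [g hg <-]; exists (star g) => //; exact: (scS cS).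
- exact: h3.
- exact: h4.
- by exists (modgen1 y01).
- by exists (modgen2 y01).
Qed.

(** The real functions whose scalar multiples of 1 lie in S; they supply the weights of the
    partition of unity. *)
Definition real_span w := exists2 h : M, S h & forall p, h p = (w p)%:C%:A.

Lemma opnorm_scalar (r : R) : opnorm (r%:C%:A : 'M[R[i]]_4) = `|r|.
Proof. by have := @cnormZr R 'M[R[i]]_4 r 1; rewrite cnorm1 mulr1. Qed.

Lemma opnorm0 : opnorm (0 : 'M[R[i]]_4) = 0.
Proof. exact: (@cnorm0 R 'M[R[i]]_4). Qed.

Lemma real_span_bound w : real_span w -> exists2 K, 0 < K & forall p, `|w p| < K.
Proof.
move=> [h _ hw]; exists (mnorm h + 1) => [|p]; first by rewrite ltr_wpDl ?mnorm_ge0.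
by rewrite -opnorm_scalar -hw ltr_pwDr // opnorm_le_mnorm.
Qed.

Lemma real_span_continuous w : real_span w -> continuous w.
Proof.
move=> [h _ hw]; have /model_predP[ch _] := model_valP h.
apply: continuous_dominated ch => p q.
by rewrite -[model_val h]/(h : DT y -> _) !hw -scalerBl -rmorphB opnorm_scalar.
Qed.

Lemma real_span_cst (r : R) : real_span (fun=> r).
Proof. by exists r%:C%:A => //; apply: (scZ cS); exact: sc1 cS. Qed.

Lemma real_spanD w e : real_span w -> real_span e -> real_span (fun p => w p + e p).
Proof.
move=> [h hh hw] [g hg ge]; exists (h + g) => [|p]; first exact: (scD cS).
by rewrite model_addE hw ge rmorphD scalerDl.
Qed.

Lemma real_spanM w e : real_span w -> real_span e -> real_span (fun p => w p * e p).
Proof.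
move=> [h hh hw] [g hg ge]; exists (h * g) => [|p]; first exact: (scM cS).
by rewrite model_mulE hw ge rmorphM -scalerAl mul1r scalerA.
Qed.

Lemma real_spanX w n : real_span w -> real_span (fun p => w p ^+ n).
Proof.
move=> hw; elim: n => [|n IH]; first exact: real_span_cst.
by under eq_fun do rewrite exprS; exact: real_spanM.
Qed.

Lemma real_span_sum (I : Type) (r : seq I) (F : I -> DT y -> R) :
  (forall i, real_span (F i)) -> real_span (fun p => \sum_(i <- r) F i p).
Proof.
move=> hF; elim: r => [|i r IH].
  by under eq_fun do rewrite big_nil; exact: real_span_cst.
by under eq_fun do rewrite big_cons; exact: real_spanD.
Qed.

(** Take 1 - d/L with d the sum of the squared distances of the two scalar squares from their values
    at p, and L a bound of d. The value 1 forces both squares to agree with those at p. *)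
Lemma separator p : exists e, [/\ real_span e, forall q, 0 <= e q <= 1, e p = 1 &
  forall q, e q = 1 -> forall f, f q = f p].
Proof.
pose c1 q := halfsq (px1 q) (pz1 q).
pose c2 q := gen2sq y (px1 q) (px2 q) (pz1 q) (pz2 q).
pose d q := normc (c1 q - c1 p) ^+ 2 + normc (c2 q - c2 p) ^+ 2.
have sq (t : M) (c : DT y -> R[i]) : S t -> (forall q, t q = (c q)%:A) ->
    real_span (fun q => normc (c q) ^+ 2).
  move=> ht tc; exists (star t * t) => [|q]; first by apply: (scM cS) => //; exact: (scS cS).
  have sE : ((c q)%:A : 'M[R[i]]_4) ^t* = (Num.conj (c q))%:A.
    by have := starZ (c q) (1 : 'M[R[i]]_4); rewrite star1.
  rewrite model_mulE model_starE tc sE -scalerAl mul1r scalerA.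
  by rewrite rmorphXn; congr (_%:A); exact/esym/normCKC.
have cA (c : R[i]) : S c%:A by apply: (scZ cS); exact: sc1 cS.
have hd : real_span d.
  apply: real_spanD.
    apply: (sq (modgen1 y01 * modgen1 y01 - (c1 p)%:A)) => [|q].
      by apply: (scB cS) => //; exact: (scM cS).
    by rewrite scalerBl -[in RHS]gen1_sqr.
  apply: (sq (modgen2 y01 * modgen2 y01 - (c2 p)%:A)) => [|q].
    by apply: (scB cS) => //; exact: (scM cS).
  by have [? ? ? ?] := DT_pointP q; rewrite scalerBl -[in RHS]gen2_sqr.
have [L L0 dL] := real_span_bound hd.
have d0 q : 0 <= d q by rewrite addr_ge0 ?sqr_ge0.
exists (fun q => 1 + - L^-1 * d q); split.
- by apply: real_spanD (real_span_cst 1) _; apply: real_spanM hd; exact: real_span_cst.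
- move=> q; rewrite mulNr mulrC subr_ge0 ler_pdivrMr // mul1r.
  rewrite gerBl divr_ge0 //; last exact: ltW.
  by have := dL q; rewrite ger0_norm // andbT => /ltW.
- by rewrite /d !subrr normc0 expr0n /= addr0 mulr0 addr0.
- move=> q /eqP; rewrite -subr_eq0 addrC addKr mulf_eq0 oppr_eq0 invr_eq0 gt_eqF //=.
  rewrite paddr_eq0 ?sqr_ge0 // !expf_eq0 /= !normc_eq0E !subr_eq0 => /andP[/eqP h1 /eqP h2] f.
  exact: model_separation.
Qed.

(** The triple is an approximant g exact at p, a weight and a threshold. Where g is a bad
    approximation the separator is at most some t < 1; rescaling by s between t and 1 makes the
    weight exceed 1 at p and stay below 1 on the bad set. *)
Lemma local_approximation f (eps : R) p : 0 < eps -> exists ge : M * (DT y -> R) * R,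
  [/\ S ge.1.1, real_span ge.1.2, forall q, 0 <= ge.1.2 q, 1 < ge.1.2 p &
      0 <= ge.2 < 1 /\ forall q, eps <= opnorm (f q - ge.1.1 q) -> ge.1.2 q <= ge.2].
Proof.
move=> eps0; have [g Sg gp] := gen_value f p; have [e [he e01 ep esep]] := separator p.
have cfg : continuous (fun q => opnorm (f q - g q)).
  have /model_predP[cf _] := model_valP f; have /model_predP[cg _] := model_valP g.
  exact: (continuous_opnorm (continuous_mxB cf cg)).
suff [t /andP[t0 t1] ht] : exists2 t, 0 <= t < 1 & forall q, eps <= opnorm (f q - g q) -> e q <= t.
  pose s := (1 + t) / 2; have s0 : 0 < s by rewrite /s; lra.
  have s1 : s < 1 by rewrite /s; lra.
  have ts : t < s by rewrite /s; lra.
  exists (g, fun q => s^-1 * e q, s^-1 * t); split => //=.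
  - by apply: real_spanM he; exact: real_span_cst.
  - by move=> q; have /andP[? _] := e01 q; rewrite mulr_ge0 ?invr_ge0 // ltW.
  - by rewrite ep mulr1 invf_gt1.
  - split=> [|q /ht h]; first by rewrite mulr_ge0 ?invr_ge0 ?(ltW s0) //= mulrC ltr_pdivrMr // mul1r.
    by rewrite ler_wpM2l // invr_ge0 ltW.
apply: (compact_strict_bound (DT_type_compact y1) cfg (real_span_continuous he)).
  by move=> q; case/andP: (e01 q).
move=> q hq; have /andP[_ e1] := e01 q; rewrite lt_neqAle e1 andbT; apply/eqP => eq1.
move: hq; rewrite (esep q eq1 f) (esep q eq1 g) gp subrr.
by rewrite opnorm0 leNgt eps0.
Qed.

(** The weights add up to 1 only approximately; [eta] is the missing mass. *)
Lemma opnorm_convex (I : eqType) (s : seq I) (v : I -> R) (G : I -> 'M[R[i]]_4) (F : 'M[R[i]]_4)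
    (eta : R) : (forall i, 0 <= v i) -> 0 <= eta -> \sum_(i <- s) v i = 1 - eta ->
  opnorm (F - \sum_(i <- s) (v i)%:C *: G i)
    <= \sum_(i <- s) v i * opnorm (F - G i) + eta * opnorm F.
Proof.
move=> v0 eta0 sv.
have -> : F - \sum_(i <- s) (v i)%:C *: G i
    = \sum_(i <- s) (v i)%:C *: (F - G i) + eta%:C *: F.
  under [in RHS]eq_bigr do rewrite scalerBr.
  rewrite sumrB -scaler_suml -rmorph_sum sv rmorphB rmorph1 scalerBl scale1r.
  by rewrite addrAC subrK.
apply: le_trans (opnormD _ _) _; rewrite opnormZ normc_real (ger0_norm eta0); apply: lerD => //.
elim: s {sv} => [|i s IH]; first by rewrite !big_nil opnorm0.
rewrite !big_cons; apply: le_trans (opnormD _ _) _; apply: lerD => //.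
by rewrite opnormZ normc_real ger0_norm.
Qed.

Lemma geometric_inverse (W G : R) n : G != 0 ->
  W * (G^-1 * \sum_(i < n) (1 - W / G) ^+ i) = 1 - (1 - W / G) ^+ n.
Proof.
move=> G0; have := subrX1 (1 - W / G) n; rewrite addrAC subrr add0r => h.
by rewrite -[RHS]opprB h mulNr opprK mulrA.
Qed.

(** The functions e_p^N divided by their sum W form a partition of unity. A high power N makes the
    weight of every bad approximant at most rh^N, and 1/W is replaced by a polynomial in W. The
    three errors, good terms, bad terms and missing mass, are each at most eps/4. *)
Lemma model_density f (eps : R) : 0 < eps -> exists2 g, S g & mnorm (f - g) < eps.
Proof.
move=> eps0; have e4 : 0 < eps / 4 by rewrite divr_gt0.
have /choice[ge hge] := fun p => local_approximation f p e4.
pose g p := (ge p).1.1; pose e p := (ge p).1.2; pose rho p := (ge p).2.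
have hg p : S (g p) by case: (hge p).
have he p : real_span (e p) by case: (hge p).
have e0 p q : 0 <= e p q by have [_ _ h _ _] := hge p; exact: h.
have e1 p : 1 < e p p by case: (hge p).
have rho1 p : 0 <= rho p < 1 by case: (hge p) => _ _ _ _ [].
have bad p q : eps / 4 <= opnorm (f q - g p q) -> e p q <= rho p.
  by case: (hge p) => _ _ _ _ [_]; exact.
have [s cover_s] : exists s : seq (DT y), forall q, exists2 p, p \in s & 1 < e p q.
  apply: (compact_finite_cover (DT_type_compact y1)) => // p.
  have /continuousP := real_span_continuous (he p).
  by move=> /(_ [set r | 1 < r]); apply; exact: open_gt.
have [rh /andP[rh0 rh1] hrho] : exists2 k : R, 0 <= k < 1 & forall p, p \in s -> rho p <= k.
  by apply: seq_bound_lt1 => p _; case/andP: (rho1 p).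
pose K := \sum_(p <- s) mnorm (f - g p).
have K0 : 0 <= K by apply: sumr_ge0 => p _; exact: mnorm_ge0.
have [N hN] := expr_lt_eps K (introT andP (conj rh0 rh1)) e4.
pose W q := \sum_(p <- s) e p q ^+ N.
have hW : real_span W by apply: real_span_sum => p; exact: real_spanX.
have W1 q : 1 <= W q.
  have [p ps h] := cover_s q; rewrite /W (big_rem p) //=.
  apply: (@le_trans _ _ (e p q ^+ N)); first by rewrite exprn_ege1 // ltW.
  by rewrite lerDl; apply: sumr_ge0 => p' _; rewrite exprn_ge0.
have [G G0 WG] := real_span_bound hW.
have G1 : 1 < G.
  by apply: le_lt_trans (W1 (DT_base y1)) _; apply: le_lt_trans (ler_norm _) (WG _).
(* Since 1 <= W < G, the ratio 1 - W/G of the geometric series stays uniformly below 1 - 1/G. *)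
have k01 : 0 <= 1 - G^-1 < 1.
  by rewrite subr_ge0 invf_le1 // (ltW G1) /= gtrBl invr_gt0.
have [n hn] := expr_lt_eps (mnorm f) k01 e4.
(* [r] is a polynomial in [W], close to [1 / W]. *)
pose r q := G^-1 * \sum_(i < n) (1 + - G^-1 * W q) ^+ i.
have hr : real_span r.
  apply: real_spanM (real_span_cst _) _; apply: real_span_sum => i; apply: real_spanX.
  apply: real_spanD (real_span_cst 1) _; exact: real_spanM (real_span_cst _) hW.
pose k q := 1 - W q / G.
have kE q : 1 + - G^-1 * W q = k q by rewrite mulNr mulrC.
have k0 q : 0 <= k q.
  rewrite subr_ge0 ler_pdivrMr // mul1r ltW //; apply: le_lt_trans (ler_norm _) (WG _).
have kle q : k q <= 1 - G^-1 by rewrite lerB // -[leLHS]mul1r ler_pM2r ?invr_gt0.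
have r0 q : 0 <= r q.
  rewrite /r mulr_ge0 ?invr_ge0 ?(ltW G0) //; apply: sumr_ge0 => i _.
  by rewrite kE exprn_ge0.
have Wr q : W q * r q = 1 - k q ^+ n.
  rewrite -geometric_inverse ?gt_eqF //; congr (_ * (_ * _)).
  by apply: eq_bigr => i _; rewrite kE.
have r1 q : r q <= 1.
  apply: (@le_trans _ _ (W q * r q)); first by rewrite ler_peMl.
  by rewrite Wr gerBl exprn_ge0.
have /choice[h hh] : forall p, exists h : M, S h /\ forall q, h q = (e p q ^+ N * r q)%:C%:A.
  move=> p; have [h Sh hE] : real_span (fun q => e p q ^+ N * r q).
    by apply: real_spanM hr; exact: real_spanX.
  by exists h.
exists (\sum_(p <- s) h p * g p).
  by apply: (sc_sum cS) => p; apply: (scM cS) => //; case: (hh p).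
have sumE q (t : seq (DT y)) :
    (\sum_(p <- t) h p * g p) q = \sum_(p <- t) (e p q ^+ N * r q)%:C *: g p q.
  elim: t => [|p t IH]; first by rewrite !big_nil.
  by rewrite !big_cons model_addE IH model_mulE (hh p).2 -scalerAl mul1r.
apply: (@le_lt_trans _ _ (eps / 4 + eps / 4 + eps / 4)); last by lra.
apply: mnorm_le => q.
have -> : (f - \sum_(p <- s) h p * g p) q
    = f q - \sum_(p <- s) (e p q ^+ N * r q)%:C *: g p q by rewrite -sumE.
have v0 p : 0 <= e p q ^+ N * r q by rewrite mulr_ge0 ?exprn_ge0.
have sv : \sum_(p <- s) e p q ^+ N * r q = 1 - k q ^+ n by rewrite -mulr_suml Wr.
apply: le_trans (opnorm_convex _ _ v0 (exprn_ge0 _ (k0 q)) sv) _.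
apply: lerD; last first.
  apply: le_trans (ltW hn); rewrite mulrC; apply: ler_pM; rewrite ?opnorm_ge0 ?exprn_ge0 //.
    exact: opnorm_le_mnorm.
  by rewrite lerXn2r // nnegrE ?(le_trans (k0 q)).
apply: (@le_trans _ _ (\sum_(p <- s) (e p q ^+ N * r q * (eps / 4) + rh ^+ N * mnorm (f - g p)))).
  rewrite big_seq [leRHS]big_seq; apply: ler_sum => p ps.
  have [hlt|hge'] := ltP (opnorm (f q - g p q)) (eps / 4).
    apply: (@le_trans _ _ (e p q ^+ N * r q * (eps / 4))); first by rewrite ler_wpM2l // ltW.
    by rewrite lerDl mulr_ge0 ?exprn_ge0 ?mnorm_ge0.
  apply: (@le_trans _ _ (rh ^+ N * mnorm (f - g p))).
    apply: ler_pM => //; rewrite ?opnorm_ge0 //; last exact: (opnorm_le_mnorm (f - g p)).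
    apply: (@le_trans _ _ (e p q ^+ N)); first by rewrite ler_piMr // exprn_ge0.
    by rewrite lerXn2r ?nnegrE //; exact: le_trans (bad p q hge') (hrho p ps).
  by rewrite lerDr mulr_ge0 // ltW.
rewrite big_split /= -mulr_suml -mulr_sumr sv; apply: lerD.
  by rewrite ler_piMl ?(ltW e4) // gerBl exprn_ge0.
by rewrite mulrC ltW.
Qed.

End density.

(** * The norm of a *-polynomial in the generators *)

Section commutant.
Variables (R : realType) (B : cstarAlgType R) (X : B -> Prop)
  (sX : forall x, X x -> X (star x)).

Definition commutant_pred : pred B := fun a => `[< forall x, X x -> GRing.comm a x >].

Lemma commutantP a : reflect (forall x, X x -> GRing.comm a x) (a \in commutant_pred).
Proof. exact: asboolP. Qed.

(** The closure of X under star is a parameter of the type, so that the involution can be an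
    instance on it. *)
Record commutant (sX' : forall x, X x -> X (star x)) := Commutant {
  commutant_val :> B;
  commutant_valP : commutant_val \in commutant_pred
}.
Local Notation N := (commutant sX).

HB.instance Definition _ := [isSub of N for @commutant_val sX].
HB.instance Definition _ := [Choice of N by <:].

Let commutant_closed : GRing.subsemialg_closed commutant_pred.
Proof.
split.
- by apply/commutantP => x _; exact: commr_sym (commr1 x).
- split; first by apply/commutantP => x _; exact: commr_sym (commr0 x).
  by move=> a b /commutantP ha /commutantP hb; apply/commutantP => x Xx;
     apply: commr_sym; apply: commrD; apply: commr_sym; [exact: ha|exact: hb].
- move=> c a /commutantP ha; apply/commutantP => x Xx.
  by rewrite /GRing.comm -scalerAl -scalerAr (ha x Xx).
- move=> a b /commutantP ha /commutantP hb; apply/commutantP => x Xx.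
  by apply: commr_sym; apply: commrM; apply: commr_sym; [exact: ha|exact: hb].
Qed.

HB.instance Definition _ := GRing.SubChoice_isSubAlgebra.Build _ _ commutant_pred N commutant_closed.

Let commutant_star a : a \in commutant_pred -> star a \in commutant_pred.
Proof.
move=> /commutantP ha; apply/commutantP => x Xx.
by have := congr1 star (ha _ (sX Xx)); rewrite !starM starK => h; exact: esym h.
Qed.

Definition cstar (a : N) : N := Commutant sX (commutant_star (commutant_valP a)).

Let cstarK : involutive cstar.
Proof. by move=> a; apply: val_inj; exact: starK. Qed.
Let cstarD : {morph cstar : a b / a + b}.
Proof. by move=> a b; apply: val_inj; exact: starD. Qed.
Let cstarZ (c : R[i]) a : cstar (c *: a) = Num.conj c *: cstar a.
Proof. by apply: val_inj; exact: starZ. Qed.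
Let cstarM a b : cstar (a * b) = cstar b * cstar a.
Proof. by apply: val_inj; exact: starM. Qed.

HB.instance Definition _ := Algebra_hasStar.Build R[i] N cstarK cstarD cstarZ cstarM.

Let ccnorm (a : N) : R := cnorm (val a).

Let ccnorm_eq0 a : ccnorm a = 0 -> a = 0.
Proof. by move=> h; apply: val_inj; exact: cnorm0_eq0. Qed.
Let ccnormD a b : ccnorm (a + b) <= ccnorm a + ccnorm b.
Proof. exact: cnormD_le. Qed.
Let ccnormZ c a : ccnorm (c *: a) = normc c * ccnorm a.
Proof. exact: cnormZ. Qed.
Let ccnormM a b : ccnorm (a * b) <= ccnorm a * ccnorm b.
Proof. exact: cnormM_le. Qed.
Let ccnorm_star a : ccnorm (star a * a) = ccnorm a ^+ 2.
Proof. exact: cnorm_starM. Qed.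
Let ccnorm_complete (u : nat -> N) :
  (forall e : R, 0 < e -> \forall m & n \near \oo, ccnorm (u m - u n) < e) ->
  exists l, ccnorm (u n - l) @[n --> \oo] --> (0 : R).
Proof.
move=> /(@cnorm_complete R B (fun n => val (u n)))[l hl].
have Nl : l \in commutant_pred.
  have cl : clim (fun n => val (u n)) l.
    move=> e e0; have /cvgrPdist_lt/(_ e e0)[k _ hk] := hl; exists k => n kn.
    by have := hk n kn; rewrite sub0r normrN ger0_norm ?cnorm_ge0.
  apply/commutantP => x Xx; apply: (clim_unique (climMr x cl)).
  have -> : (fun n => val (u n) * x) = fun n => x * val (u n).
    by apply/funext => n; have /commutantP := commutant_valP (u n); exact.
  exact: climMl.
by exists (Commutant sX Nl).
Qed.

HB.instance Definition _ := StarAlgebra_isCStar.Build R N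
  ccnorm_eq0 ccnormD ccnormZ ccnormM ccnorm_star ccnorm_complete.

End commutant.

(** The values of one *-polynomial at two pairs of generators. That the first value determines the
    second is not part of the definition; it follows from the norm bound. *)
Inductive gen_pair (C : numClosedFieldType) (A B : starAlgType C) (a1 a2 : A) (b1 b2 : B) :
    A -> B -> Prop :=
| gen_pair1 : gen_pair a1 a2 b1 b2 1 1
| gen_pair_fst : gen_pair a1 a2 b1 b2 a1 b1
| gen_pair_snd : gen_pair a1 a2 b1 b2 a2 b2
| gen_pairD a b a' b' : gen_pair a1 a2 b1 b2 a b -> gen_pair a1 a2 b1 b2 a' b' ->
    gen_pair a1 a2 b1 b2 (a + a') (b + b')
| gen_pairM a b a' b' : gen_pair a1 a2 b1 b2 a b -> gen_pair a1 a2 b1 b2 a' b' ->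
    gen_pair a1 a2 b1 b2 (a * a') (b * b')
| gen_pairZ c a b : gen_pair a1 a2 b1 b2 a b -> gen_pair a1 a2 b1 b2 (c *: a) (c *: b)
| gen_pairS a b : gen_pair a1 a2 b1 b2 a b -> gen_pair a1 a2 b1 b2 (star a) (star b).

Lemma gen_pairX (C : numClosedFieldType) (A B : starAlgType C) (a1 a2 : A) (b1 b2 : B) a b n :
  gen_pair a1 a2 b1 b2 a b -> gen_pair a1 a2 b1 b2 (a ^+ n) (b ^+ n).
Proof.
move=> h; elim: n => [|n IH]; first by rewrite !expr0; exact: gen_pair1.
by rewrite !exprS; exact: gen_pairM.
Qed.

(* The usual power trick: it removes the constant from a norm bound. *)
Lemma le_of_pow2_le (R : realType) (x y K : R) : 0 <= x -> 0 <= y ->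
  (forall n, x ^+ (2 ^ n) <= K * y ^+ (2 ^ n)) -> x <= y.
Proof.
move=> x0 y0 h; rewrite leNgt; apply/negP => yx; have xp : 0 < x by exact: le_lt_trans yx.
have r01 : 0 <= y / x < 1 by rewrite divr_ge0 //= ltr_pdivrMr // mul1r.
have K0 : 0 <= K.
  rewrite leNgt; apply/negP => K0; have := h 0; rewrite expn0 !expr1 => h0.
  by have := lt_le_trans xp h0; rewrite ltNge => /negP; apply; rewrite nmulr_rle0.
have [N hN] := expr_lt_eps K r01 (@ltr01 R).
have := h N; rewrite leNgt => /negP; apply.
have xN : 0 < x ^+ (2 ^ N) by rewrite exprn_gt0.
rewrite -[ltRHS]mul1r -ltr_pdivrMr // -mulrA -exprVn -exprMn; apply: le_lt_trans hN.
case/andP: r01 => r0 r1; apply: ler_wpM2l => //; apply: ler_wiXn2l; rewrite ?(ltW r1) //.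
exact: ltnW (ltn_expl _ _).
Qed.

(** * Localization at normal central elements *)

Section joint_localization.
Variables (R : realType) (A : cstarAlgType R).
Implicit Types (a c : A) (q : A -> R).

Lemma localize_real q x a : cseminorm q -> star x = x -> (forall b, GRing.comm b x) ->
  exists l q', [/\ cseminorm q', forall b, q' b <= q b, q' a = q a & q' (x - l%:C%:A) = 0].
Proof.
move=> cq sx cx; apply: (exists_localization cq sx cx (L := cnorm x + 1)).
  by rewrite ltr_wpDl ?cnorm_ge0.
by rewrite lerDl.
Qed.

(** Real and imaginary parts are localized in turn; the second seminorm lies below the first, so the
    first value is kept. *)
Lemma localize_normal q c a : cseminorm q -> (forall b, GRing.comm b c) ->
  exists l q', [/\ cseminorm q', forall b, q' b <= q b, q' a = q a & q' (c - l%:A) = 0].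
Proof.
move=> cq cc; have cs b : GRing.comm b (star c).
  by have := congr1 star (cc (star b)); rewrite !starM starK => h; exact: esym h.
have [|b|u [q1 [cq1 q1q q1a q1u]]] := @localize_real q (c + star c) a cq.
- by rewrite starD starK addrC.
- by apply: commrD.
have [|b|v [q2 [cq2 q2q q2a q2v]]] := @localize_real q1 ('i *: (c - star c)) a cq1.
- by rewrite starZ starB starK conjCi scaleNr -scalerN opprB.
- by rewrite /GRing.comm -scalerAl -scalerAr; congr (_ *: _); apply: commrB.
pose k : R[i] := - (2^-1 * 'i).
have cE : c = 2^-1 *: (c + star c) + k *: ('i *: (c - star c)).
  rewrite scalerA /k mulNr -mulrA -expr2 sqrCi mulrN1 opprK -scalerDr addrACA subrr addr0.
  by rewrite -[c + c]mulr2n -[c *+ 2]scaler_nat scalerA mulVf ?pnatr_eq0 // scale1r.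
exists (2^-1 * u%:C + k * v%:C), q2; split=> // [b||].
- exact: le_trans (q2q b) (q1q b).
- by rewrite q2a.
have -> : c - (2^-1 * u%:C + k * v%:C)%:A =
    2^-1 *: ((c + star c) - u%:C%:A) + k *: ('i *: (c - star c) - v%:C%:A).
  by rewrite {1}cE scalerDl opprD addrACA !scalerBr !scalerA.
apply/le_anti; rewrite (cs_ge0 cq2) andbT; apply: le_trans (csD cq2 _ _) _.
rewrite !(csZ cq2) q2v mulr0 addr0.
have -> : q2 (c + star c - u%:C%:A) = 0; last by rewrite mulr0.
by apply/le_anti; rewrite (cs_ge0 cq2) andbT -q1u q2q.
Qed.

End joint_localization.

Section proper_quotient.
Variables (R : realType) (A : cstarAlgType R) (q : A -> R) (cq : cseminorm q) (q1 : q 1 != 0).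
Local Notation Q := (cs_quot cq q1).
Local Notation pi := (cs_pi cq q1).

Lemma cs_quot_selfadjoint (s : Q) : star s = s -> exists2 h, star h = h & s = pi h.
Proof.
have [a ->] := cs_pi_surj s => sa; exists (2^-1 *: (a + star a)).
  by rewrite starZ starD starK addrC fmorphV rmorph_nat.
rewrite linearZ /= raddfD /= cs_pi_star sa -[pi a + pi a]mulr2n -[pi a *+ 2]scaler_nat.
by rewrite scalerA mulVf ?pnatr_eq0 // scale1r.
Qed.

Lemma cs_quot_sqr0 (s : Q) : star s = s -> s * s = 0 -> s = 0.
Proof.
move=> /cs_quot_selfadjoint[h sh ->]; rewrite -rmorphM /= => /cs_pi_eq0 h2.
apply/cs_pi_eq0; have := csS cq h; rewrite sh h2 => /esym/eqP.
by rewrite expf_eq0 => /eqP.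
Qed.

(** For r < 0 a self-adjoint lift h has h^2 - r invertible already before the quotient, where its
    image is 0. *)
Lemma cs_quot_sqr_ge0 (s : Q) (r : R) : star s = s -> s * s = r%:C%:A -> 0 <= r.
Proof.
move=> /cs_quot_selfadjoint[h sh ->]; rewrite -rmorphM /= => h2; rewrite leNgt; apply/negP => r0.
have [|g [hg _]] := @cinvertible_sqrD R A h (- r) sh; first by rewrite oppr_gt0.
have := congr1 pi hg; rewrite rmorphM rmorphD /= expr2 h2 linearZ /= rmorph1 -scalerDl.
rewrite -rmorphD subrr scale0r mul0r => /eqP; rewrite eq_sym; apply/negP; exact: oner_neq0.
Qed.

End proper_quotient.

Section contraction.
Variables (R : realType) (y : R[i]) (y01 : 0 < normc y < 1).
Local Notation M := (model y01).

(** Both squares become scalars in a quotient that keeps the norm of [a], and there [fibre_rep]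
    turns values of the model at one point into values in the quotient. *)
Lemma central_contraction (A : cstarAlgType R) (a1 a2 : A) : enveloping_relations y a1 a2 ->
  (forall b, GRing.comm b (a1 * a1)) -> (forall b, GRing.comm b (a2 * a2)) ->
  forall (f : M) a, gen_pair (modgen1 y01) (modgen2 y01) a1 a2 f a -> cnorm a <= mnorm f.
Proof.
move=> rel comm1 comm2 f a fa.
have [->|a0] := eqVneq a 0; first by rewrite cnorm0 mnorm_ge0.
have [l1 [q1 [cq1 q1q q1a q1c]]] := localize_normal a (cseminorm_cnorm A) comm1.
have [l2 [q [cq qq1 qa qc2]]] := localize_normal a cq1 comm2.
have qc1 : q (a1 * a1 - l1%:A) = 0.
  by apply/le_anti; rewrite (cs_ge0 cq) andbT -q1c qq1.
have qaE : q a = cnorm a by rewrite qa q1a.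
have qn1 : q 1 != 0.
  apply: contra_neq a0 => q10; apply: cnorm0_eq0; rewrite -qaE; apply/le_anti.
  by rewrite (cs_ge0 cq) andbT -[a]mulr1; apply: le_trans (csM cq _ _) _; rewrite q10 mulr0.
pose pi : {lrmorphism A -> cs_quot cq qn1} := cs_pi cq qn1.
have pi_star : star_morphism pi := cs_pi_star cq qn1.
have piD b b' : pi (b + b') = pi b + pi b' by exact: rmorphD.
have piM b b' : pi (b * b') = pi b * pi b' by exact: rmorphM.
have piZ c b : pi (c *: b) = c *: pi b by exact: linearZ.
have piA c : pi c%:A = c%:A by exact: rmorph_alg.
have rel' : enveloping_relations y (pi a1) (pi a2).
  have [r1 r2 r3 r4] := rel; split.
  - by rewrite -pi_star -!rmorphM -rmorphD r1 rmorph1.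
  - by rewrite -pi_star -!rmorphM -rmorphD r2 rmorph1.
  - by rewrite -pi_star -!rmorphM r3 rmorphN.
  - by rewrite -!rmorphM -rmorphD r4; exact: piA.
have sq b c : q (b - c%:A) = 0 -> pi b = c%:A.
  by move=> /(cs_piP cq qn1) h; rewrite -piA.
have y0 : y != 0.
  by apply: contraTneq (proj1 (andP y01)) => ->; rewrite normc0 ltxx.
have sq1 : pi a1 * pi a1 = l1%:A by rewrite -rmorphM; exact: sq.
have sq2 : pi a2 * pi a2 = l2%:A by rewrite -rmorphM; exact: sq.
have [p [S [F [hp pF [S1 F1 S2 F2]]]]] :=
  fibre_rep (@cs_quot_sqr0 _ _ _ cq qn1) (@cs_quot_sqr_ge0 _ _ _ cq qn1) y0 rel' sq1 sq2.
pose P : DT y := SigSub (mem_set hp).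
have FE g b : gen_pair (modgen1 y01) (modgen2 y01) a1 a2 g b -> S (g P) /\ F (g P) = pi b.
  elim=> {g b} [|||g b g' b' _ [s1 e1] _ [s2 e2]|g b g' b' _ [s1 e1] _ [s2 e2]
      |c g b _ [s1 e1]|g b _ [s1 e1]].
  - by split; [exact: prS1 pF|rewrite (pr1 pF) rmorph1].
  - by split.
  - by split.
  - split; [exact: (prSD pF s1 s2)|rewrite piD -e1 -e2; exact: (prD pF (g P) (g' P))].
  - split; [exact: (prSM pF s1 s2)|rewrite piM -e1 -e2; exact: (prM pF s1 s2)].
  - split; [exact: (prSZ pF c s1)|rewrite piZ -e1; exact: (prZ pF c (g P))].
  - split; [exact: (prSstar pF s1)|rewrite pi_star -e1; exact: (prStar pF s1)].
have /choice[u hu] : forall ij : 'I_4 * 'I_4, exists u, F (delta_mx ij.1 ij.2) = pi u.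
  by move=> ij; exact: cs_pi_surj.
(* Uses only linearity: F is multiplicative on admissible values alone, so contractivity is not
   immediate. The constant comes from lifts of the images of the matrix units. *)
have qF G b : F G = pi b -> q b <= (\sum_i \sum_j q (u (i, j))) * opnorm G.
  have F0 : F 0 = 0 by rewrite -(scale0r 0) (prZ pF) scale0r.
  have Fsum (I : Type) (r : seq I) (H : I -> 'M[R[i]]_4) :
      F (\sum_(i <- r) H i) = \sum_(i <- r) F (H i).
    by elim: r => [|i r IH]; rewrite ?big_nil // !big_cons (prD pF) IH.
  rewrite {1}[G]matrix_sum_delta Fsum => e.
  have : pi b = pi (\sum_i \sum_j G i j *: u (i, j)).
    rewrite -e raddf_sum; apply: eq_bigr => i _; rewrite Fsum raddf_sum.
    by apply: eq_bigr => j _; rewrite (prZ pF) (hu (i, j)) -piZ.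
  move=> /cs_piP /(cs_eqB cq) ->.
  apply: le_trans (cs_sum cq _ _) _; rewrite mulr_suml; apply: ler_sum => i _.
  apply: le_trans (cs_sum cq _ _) _; rewrite mulr_suml; apply: ler_sum => j _.
  by rewrite (csZ cq) mulrC ler_wpM2l ?(cs_ge0 cq) ?entry_le_opnorm.
rewrite -qaE -(ler_pXn2r (ltn0Sn 1)) ?nnegrE ?(cs_ge0 cq) ?mnorm_ge0 // -(csS cq).
apply: (@le_of_pow2_le _ _ _ (\sum_i \sum_j q (u (i, j)))) => [||n].
- exact: cs_ge0 cq _.
- by rewrite exprn_ge0 ?mnorm_ge0.
rewrite -(cs_exp2 cq) ?starM ?starK //.
have gn : gen_pair (modgen1 y01) (modgen2 y01) a1 a2 ((star f * f) ^+ (2 ^ n)) ((star a * a) ^+ (2 ^ n)).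
  by apply: gen_pairX; apply: gen_pairM => //; exact: gen_pairS.
have [_ /qF /le_trans] := FE _ _ gn; apply; apply: ler_wpM2l.
  by apply: sumr_ge0 => i _; apply: sumr_ge0 => j _; exact: cs_ge0 cq _.
apply: le_trans (opnorm_le_mnorm _ P) _; rewrite -mnorm_star_mul.
exact: (@cnormX R M).
Qed.

End contraction.

(** * The universal property *)

(** The commutator of d with a^2 equals the commutator of {a, d} with a, which vanishes when {a, d}
    is a scalar. *)
Lemma anti_scalar_comm (C : numClosedFieldType) (Q : starAlgType C) (a d : Q) (c : C) :
  anti a d = c%:A -> GRing.comm d (a * a).
Proof.
move=> ad; have da : d * a = c%:A - a * d by rewrite -ad addrC addKr.
rewrite /GRing.comm [LHS]mulrA da mulrBl -[a * d * a]mulrA da mulrBr mulr_algl mulr_algr.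
by rewrite opprB addrC subrK mulrA.
Qed.

Lemma squares_comm (C : numClosedFieldType) (Q : starAlgType C) (y : C) (b1 b2 : Q) :
  enveloping_relations y b1 b2 ->
  forall b c, b \in [:: b1; b2] -> c \in [:: b1 * b1; b2 * b2; star (b1 * b1); star (b2 * b2)] ->
  GRing.comm b c.
Proof.
move=> [r1 r2 r3 r4].
have a11 : anti b1 (star b1) = 1%:A by rewrite scale1r antiC.
have a22 : anti b2 (star b2) = 1%:A by rewrite scale1r antiC.
have a12 : anti b1 b2 = y%:A by [].
have a1s2 : anti (star b1) b2 = 0%:A by rewrite scale0r /anti r3 addNr.
have as21 : anti (star b2) b1 = 0%:A.
  by rewrite -[b1]starK -anti_star antiC a1s2 scale0r star0.
have conj_comm a d : GRing.comm (star d) (a * a) -> GRing.comm d (star (a * a)).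
  by move=> h; have := congr1 star h; rewrite starM [RHS]starM starK => /esym.
move=> b c; rewrite !inE => /orP[] /eqP -> /or4P[] /eqP ->.
- exact: commrM.
- by apply: (@anti_scalar_comm _ _ _ _ y); rewrite antiC.
- by apply: conj_comm; exact: anti_scalar_comm a11.
- apply: conj_comm; apply: (@anti_scalar_comm _ _ _ _ 0).
  by rewrite antiC.
- exact: anti_scalar_comm a12.
- exact: commrM.
- apply: conj_comm; apply: (@anti_scalar_comm _ _ _ _ 0).
  by rewrite antiC.
- by apply: conj_comm; exact: anti_scalar_comm a22.
Qed.

(* The squares are central only in the algebra generated by [b1] and [b2]; the
   commutant of their *-closure is a C*-algebra that contains it. *)
Lemma gen_contraction (R : realType) (y : R[i]) (y01 : 0 < normc y < 1) (B : cstarAlgType R)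
    (b1 b2 : B) : enveloping_relations y b1 b2 ->
  forall f b, gen_pair (modgen1 y01) (modgen2 y01) b1 b2 f b -> cnorm b <= cnorm f.
Proof.
move=> rel; pose cs := [:: b1 * b1; b2 * b2; star (b1 * b1); star (b2 * b2)].
have sX x : x \in cs -> star x \in cs.
  by rewrite !inE => /or4P[] /eqP ->; rewrite ?starK eqxx ?orbT.
have N1 : b1 \in commutant_pred (fun x => x \in cs).
  by apply/commutantP => x; apply: (squares_comm rel); rewrite !inE eqxx.
have N2 : b2 \in commutant_pred (fun x => x \in cs).
  by apply/commutantP => x; apply: (squares_comm rel); rewrite !inE eqxx orbT.
pose n1 := Commutant sX N1; pose n2 := Commutant sX N2.
have relN : enveloping_relations y n1 n2.
  by have [r1 r2 r3 r4] := rel; split; apply: val_inj.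
have cN (n m : commutant sX) : val m \in cs -> GRing.comm n m.
  by move=> mcs; apply: val_inj; have /commutantP := commutant_valP n; exact.
have lift f b : gen_pair (modgen1 y01) (modgen2 y01) b1 b2 f b ->
    exists2 n : commutant sX, gen_pair (modgen1 y01) (modgen2 y01) n1 n2 f n & val n = b.
  elim=> {f b} [|||f b f' b' _ [n gn <-] _ [n' gn' <-]|f b f' b' _ [n gn <-] _ [n' gn' <-]
      |c f b _ [n gn <-]|f b _ [n gn <-]].
  - by exists 1 => //; exact: gen_pair1.
  - by exists n1 => //; exact: gen_pair_fst.
  - by exists n2 => //; exact: gen_pair_snd.
  - by exists (n + n') => //; exact: gen_pairD.
  - by exists (n * n') => //; exact: gen_pairM.
  - by exists (c *: n) => //; exact: gen_pairZ.
  - by exists (star n) => //; exact: gen_pairS.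
move=> f b /lift[n gn <-]; apply: (central_contraction relN _ _ gn) => m; apply: cN.
  by rewrite !inE eqxx.
by rewrite !inE eqxx orbT.
Qed.

(** * Extension by continuity of a contractive correspondence *)

Section extension.
Variables (R : realType) (A B : cstarAlgType R) (a1 a2 : A) (b1 b2 : B).
Local Notation P := (gen_pair a1 a2 b1 b2).
Hypotheses (contr : forall a b, P a b -> cnorm b <= cnorm a)
  (dense : forall a (e : R), 0 < e -> exists a' b', P a' b' /\ cnorm (a - a') < e).

(** The closure of the graph given by [gen_pair]. Contractivity on differences makes it
    single-valued, and density with completeness makes it total. *)
Definition limit_pair a b := forall e : R, 0 < e ->
  exists a' b', [/\ P a' b', cnorm (a - a') < e & cnorm (b - b') < e].

Let gen_pairB a b a' b' : P a b -> P a' b' -> P (a - a') (b - b').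
Proof. by move=> h h'; rewrite -[- a']scaleN1r -[- b']scaleN1r; apply: gen_pairD => //; exact: gen_pairZ. Qed.

Lemma gen_pair_limit a b : P a b -> limit_pair a b.
Proof. by move=> h e e0; exists a, b; rewrite !subrr !cnorm0. Qed.

Lemma limit_pair_contr a b a' b' : limit_pair a b -> limit_pair a' b' ->
  cnorm (b - b') <= cnorm (a - a').
Proof.
move=> h h'; apply/ler_addgt0Pl => e e0; have e4 : 0 < e / 4 by rewrite divr_gt0.
have [c [d [cd ac bd]]] := h _ e4; have [c' [d' [cd' ac' bd']]] := h' _ e4.
have tri (C : cstarAlgType R) (u v u' v' : C) : cnorm (u - u') <=
    cnorm (u - v) + cnorm (u' - v') + cnorm (v - v').
  have -> : u - u' = (u - v) - (u' - v') + (v - v').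
    by rewrite (opprD u' (- v')) [u - v + _]addrACA -(opprD v (- v')) subrK.
  by apply: le_trans (cnormD_le _ _) _; rewrite lerD2r cnormB_le.
have h1 := tri B b d b' d'; have h2 := contr (gen_pairB cd cd').
have h3 := tri A c a c' a'; rewrite [cnorm (c - a)]cnormBC [cnorm (c' - a')]cnormBC in h3.
move: h1 h2 h3 ac bd ac' bd'.
move: (cnorm _) (cnorm _) (cnorm _) (cnorm _) (cnorm _) (cnorm _) (cnorm _) (cnorm _).
by move=> *; lra.
Qed.

Lemma limit_pair_exists a : exists b, limit_pair a b.
Proof.
have pos n : 0 < (2^-1 : R) ^+ n by rewrite exprn_gt0 // invr_gt0.
have /choice[u hu] : forall n : nat,
    exists cd : A * B, P cd.1 cd.2 /\ cnorm (a - cd.1) < 2^-1 ^+ n.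
  by move=> n; have [c [d [h1 h2]]] := dense a (pos n); exists (c, d).
have small (e : R) : 0 < e -> exists N, forall n, (N <= n)%N -> 2^-1 ^+ n < e.
  have h01 : 0 <= (2^-1 : R) < 1 by rewrite invr_ge0 ler0n invf_lt1 // ltr1n.
  move=> /(expr_lt_eps 1 h01)[N]; rewrite mul1r => hN; exists N => n Nn.
  apply: le_lt_trans hN; case/andP: h01 => h0 h1.
  by apply: ler_wiXn2l; rewrite ?(ltW h1).
have [|l hl] := @cauchy_clim R B (fun n => (u n).2).
  move=> e e0; have e2 : 0 < e / 2 by rewrite divr_gt0.
  have [N hN] := small _ e2; exists N => m n Nm Nn.
  have [h1 k1] := hu m; have [h2 k2] := hu n.
  apply: le_lt_trans (contr (gen_pairB h1 h2)) _.
  have -> : (u m).1 - (u n).1 = (a - (u n).1) - (a - (u m).1).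
    by rewrite opprB [RHS]addrC addrA subrK.
  rewrite [e]splitr; apply: le_lt_trans (cnormB_le _ _) _.
  by apply: ltrD; [exact: lt_trans k2 (hN n Nn)|exact: lt_trans k1 (hN m Nm)].
exists l => e e0; have [N hN] := small e e0; have [N' hN'] := hl e e0.
pose n := maxn N N'; have [h1 h2] := hu n; exists (u n).1, (u n).2; split=> //.
  by apply: lt_trans h2 (hN _ (leq_maxl _ _)).
by rewrite cnormBC; exact: hN' (leq_maxr _ _).
Qed.

Lemma limit_pair_unique a b b' : limit_pair a b -> limit_pair a b' -> b = b'.
Proof.
move=> h h'; apply/eqP; rewrite -subr_eq0; apply/eqP/cnorm0_eq0/le_anti.
by rewrite cnorm_ge0 andbT; apply: le_trans (limit_pair_contr h h') _; rewrite subrr cnorm0.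
Qed.

Lemma limit_pairD a b a' b' : limit_pair a b -> limit_pair a' b' -> limit_pair (a + a') (b + b').
Proof.
move=> h h' e e0; have e2 : 0 < e / 2 by rewrite divr_gt0.
have [c [d [p k l]]] := h _ e2; have [c' [d' [p' k' l']]] := h' _ e2.
exists (c + c'), (d + d'); split; first exact: gen_pairD.
  by rewrite opprD addrACA [e]splitr; apply: le_lt_trans (cnormD_le _ _) _; exact: ltrD.
by rewrite opprD addrACA [e]splitr; apply: le_lt_trans (cnormD_le _ _) _; exact: ltrD.
Qed.

Lemma limit_pairZ k a b : limit_pair a b -> limit_pair (k *: a) (k *: b).
Proof.
move=> h e e0; have K : 0 < normc k + 1 by rewrite ltr_wpDl ?normc_ge0.
have eK : 0 < e / (normc k + 1) by rewrite divr_gt0.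
have bound (C : cstarAlgType R) (v : C) : cnorm v < e / (normc k + 1) -> cnorm (k *: v) < e.
  rewrite ltr_pdivlMr // cnormZ => h1; apply: le_lt_trans h1; rewrite mulrC ler_wpM2l ?cnorm_ge0 //.
  by rewrite lerDl.
have [c [d [p k1 k2]]] := h _ eK; exists (k *: c), (k *: d).
by split; [exact: gen_pairZ|rewrite -scalerBr; exact: bound|rewrite -scalerBr; exact: bound].
Qed.

Lemma limit_pairS a b : limit_pair a b -> limit_pair (star a) (star b).
Proof.
move=> h e e0; have [c [d [p k1 k2]]] := h e e0; exists (star c), (star d).
by split; rewrite -?starB ?cnorm_star //; exact: gen_pairS.
Qed.

Let cnormBM (C : cstarAlgType R) (u v u' v' : C) (t : R) : t <= 1 ->
  cnorm (u - v) < t -> cnorm (u' - v') < t ->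
  cnorm (u * u' - v * v') <= t * (cnorm u + cnorm u' + 1).
Proof.
move=> t1 h h'; have -> : u * u' - v * v' = u * (u' - v') + (u - v) * v'.
  by rewrite mulrBr mulrBl addrA subrK.
apply: le_trans (cnormD_le _ _) _.
have -> : t * (cnorm u + cnorm u' + 1) = cnorm u * t + t * (cnorm u' + 1) by ring.
apply: lerD; apply: le_trans (cnormM_le _ _) _.
  by apply: ler_wpM2l; [exact: cnorm_ge0|exact: ltW].
apply: ler_pM; rewrite ?cnorm_ge0 ?(ltW h) //.
have -> : v' = u' - (u' - v') by rewrite opprB addrC subrK.
apply: le_trans (cnormB_le _ _) _; rewrite lerD2l; exact: le_trans (ltW h') t1.
Qed.

Lemma limit_pairM a b a' b' : limit_pair a b -> limit_pair a' b' -> limit_pair (a * a') (b * b').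
Proof.
move=> h h' e e0.
pose K := (cnorm a + cnorm a' + 1) + (cnorm b + cnorm b' + 1).
have A0 := cnorm_ge0 a; have A0' := cnorm_ge0 a'; have B0 := cnorm_ge0 b; have B0' := cnorm_ge0 b'.
have K0 : 0 < K by rewrite /K; lra.
pose t := Num.min 1 (e / (2 * K)).
have t1 : t <= 1 by rewrite ge_min lexx.
have t0 : 0 < t by rewrite lt_min ltr01 divr_gt0 // mulr_gt0.
have tK (x : R) : x <= K -> t * x < e.
  move=> xK; apply: (@le_lt_trans _ _ (t * K)); first by rewrite ler_wpM2l // ltW.
  apply: (@le_lt_trans _ _ (e / (2 * K) * K)).
    by rewrite ler_wpM2r ?(ltW K0) // ge_min lexx orbT.
  have -> : e / (2 * K) * K = e / 2 by field; rewrite gt_eqF.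
  by rewrite ltr_pdivrMr // ltr_pMr // ltr1n.
have [c [d [p k l]]] := h _ t0; have [c' [d' [p' k' l']]] := h' _ t0.
exists (c * c'), (d * d'); split; first exact: gen_pairM.
  by apply: le_lt_trans (cnormBM t1 k k') (tK _ _); rewrite /K; lra.
by apply: le_lt_trans (cnormBM t1 l l') (tK _ _); rewrite /K; lra.
Qed.

Definition extension a : B := projT1 (cid (limit_pair_exists a)).

Let extensionP a : limit_pair a (extension a).
Proof. exact: projT2 (cid (limit_pair_exists a)). Qed.

Let extensionE a b : limit_pair a b -> extension a = b.
Proof. exact: limit_pair_unique. Qed.

Let extension_nmod : nmod_morphism extension.
Proof.
split=> [|a b]; last by apply: extensionE; exact: limit_pairD.
by apply: extensionE; rewrite -(scale0r (1 : A)) -(scale0r (1 : B)); apply/limit_pairZ/gen_pair_limit/gen_pair1.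
Qed.

HB.instance Definition _ := GRing.isNmodMorphism.Build A B extension extension_nmod.

Let extension_monoid : monoid_morphism extension.
Proof.
split=> [|a b]; last by apply: extensionE; exact: limit_pairM.
by apply: extensionE; apply/gen_pair_limit/gen_pair1.
Qed.

HB.instance Definition _ := GRing.isMonoidMorphism.Build A B extension extension_monoid.

Let extension_scale : scalable extension.
Proof. by move=> c a; apply: extensionE; exact: limit_pairZ. Qed.

HB.instance Definition _ := GRing.isScalable.Build R[i] A B *:%R extension extension_scale.

(** Uniqueness: a competing morphism agrees with the pairs by induction and is automatically
    contractive, so its graph lies in the closure. *)
Lemma star_morphism_extension : exists f : {lrmorphism A -> B},
  [/\ star_morphism f, f a1 = b1, f a2 = b2 &
      forall g : {lrmorphism A -> B},
        star_morphism g -> g a1 = b1 -> g a2 = b2 -> g =1 f].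
Proof.
exists extension; split.
- by move=> a; apply: extensionE; exact: limit_pairS.
- by apply: extensionE; apply/gen_pair_limit/gen_pair_fst.
- by apply: extensionE; apply/gen_pair_limit/gen_pair_snd.
move=> g sg g1 g2 a; apply/esym/extensionE => e e0.
have [c [d [cd ac]]] := dense a e0; exists c, d; split=> //.
have <- : g c = d.
  elim: cd => {c d ac} [|||c d c' d' _ <- _ <-|c d c' d' _ <- _ <-|k c d _ <-|c d _ <-] //.
  - exact: rmorph1.
  - exact: rmorphD.
  - exact: rmorphM.
  - exact: linearZ.
by rewrite -rmorphB; exact: le_lt_trans (cnorm_star_morphism _ sg) ac.
Qed.

End extension.

(** * The enveloping algebras *)

Lemma model_enveloping (R : realType) (y : R[i]) (y01 : 0 < normc y < 1) :
  is_enveloping y (modgen1 y01) (modgen2 y01).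
Proof.
split; first exact: modgen_relations.
move=> B b1 b2 rel; apply: star_morphism_extension; first exact: gen_contraction rel.
pose S (f : model y01) := exists b, gen_pair (modgen1 y01) (modgen2 y01) b1 b2 f b.
have cS : star_closed S.
  split.
  - by exists 1; exact: gen_pair1.
  - by move=> f g [b hb] [c hc]; exists (b + c); exact: gen_pairD.
  - by move=> f g [b hb] [c hc]; exists (b * c); exact: gen_pairM.
  - by move=> c f [b hb]; exists (c *: b); exact: gen_pairZ.
  - by move=> f [b hb]; exists (star b); exact: gen_pairS.
have S1 : S (modgen1 y01) by exists b1; exact: gen_pair_fst.
have S2 : S (modgen2 y01) by exists b2; exact: gen_pair_snd.
move=> f e e0; have [g [b gb] fg] := model_density cS S1 S2 f e0.
by exists g, b.
Qed.

(** The two morphisms given by universality are mutually inverse, since each composite and the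
    identity fix the generators. *)
Lemma enveloping_isomorphicI (R : realType) (y : R[i]) (B : cstarAlgType R) (b1 b2 : B) :
  is_enveloping y b1 b2 -> enveloping_isomorphic y B.
Proof.
move=> envB; split=> [|E a1 a2 envE]; first by exists B, b1, b2.
have [relB uB] := envB; have [relE uE] := envE.
have [f [sf f1 f2 _]] := uE _ _ _ relB; have [g [sg g1 g2 _]] := uB _ _ _ relE.
exists f; split=> //; exists g => x.
- have [h [_ _ _ hu]] := uE _ _ _ relE.
  rewrite -[g (f x)]/((g \o f) x) (hu (g \o f : {lrmorphism E -> E})) /=.
  + by rewrite -(hu (idfun : {lrmorphism E -> E})).
  + by move=> z /=; rewrite sf sg.
  + by rewrite f1.
  + by rewrite f2.
- have [h [_ _ _ hu]] := uB _ _ _ relB.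
  rewrite -[f (g x)]/((f \o g) x) (hu (f \o g : {lrmorphism B -> B})) /=.
  + by rewrite -(hu (idfun : {lrmorphism B -> B})).
  + by move=> z /=; rewrite sg sf.
  + by rewrite g1.
  + by rewrite g2.
Qed.

Lemma normal_square_sum0 (R : realType) (B : cstarAlgType R) (v : B) :
  star v * v + v * star v = 0 -> v = 0.
Proof.
move=> vv; pose u := v + star v; pose w := 'i *: (v - star v).
have su : star u = u by rewrite /u starD starK addrC.
have sw : star w = w by rewrite /w starZ starB starK conjCi scaleNr -scalerN opprB.
have uw : w ^+ 2 = - u ^+ 2.
  apply/eqP; rewrite -addr_eq0; apply/eqP.
  have -> : w ^+ 2 = - ((v - star v) * (v - star v)).
    by rewrite expr2 /w -scalerAl -scalerAr scalerA -expr2 sqrCi scaleN1r.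
  transitivity ((star v * v + v * star v) + (star v * v + v * star v)).
    have key (p q r t : B) : - (p - q - (r - t)) + (p + q + (r + t)) = (r + q) + (r + q).
      rewrite opprB opprB [p + q + (r + t)]addrC addrACA [r + t]addrC [r - t + _]addrA subrK.
      by rewrite [q - p + _]addrA subrK addrACA.
    by rewrite expr2 /u !mulrBl !mulrBr !mulrDl !mulrDr.
  by rewrite vv addr0.
have zero (a b : B) : star a = a -> star b = b -> b ^+ 2 = - a ^+ 2 -> a = 0.
  move=> sa sb ab; apply: cnorm0_eq0; apply/le_anti; rewrite cnorm_ge0 andbT.
  apply: cnorm_le_spectral => // r r0.
  by rewrite -ab addrC; apply: cinvertible_sqrD => //; rewrite exprn_gt0.
have u0 : u = 0 by exact: zero uw.
have w0 : w = 0 by apply: (zero w u) => //; rewrite uw opprK.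
have : u + - 'i *: w = 2 *: v.
  rewrite /u /w scalerA mulNr -expr2 sqrCi opprK scale1r addrACA subrr addr0.
  by rewrite -[v + v]mulr2n -[v *+ 2]scaler_nat.
by rewrite u0 w0 scaler0 addr0 => /esym/eqP; rewrite scaler_eq0 pnatr_eq0 => /eqP.
Qed.

(** * The case |y| = 1 *)

Section unit_modulus.
Variables (R : realType) (y : R[i]) (y1 : normc y = 1).

Let yy : Num.conj y * y = 1. Proof. exact: conj_unit. Qed.

Lemma unit_relations_fermion (B : cstarAlgType R) (b1 b2 : B) :
  enveloping_relations y b1 b2 -> fermion b2 /\ b1 = y *: star b2.
Proof.
move=> [r1 r2 r3 r4]; have b1E : b1 = y *: star b2.
  apply/eqP; rewrite -subr_eq0; apply/eqP/normal_square_sum0.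
  rewrite -scaleNr -[LHS]/(anti (star _) _) antiC starD starZ starK !anti_simp.
  have a1 : anti b1 (star b1) = 1 by rewrite antiC.
  have a2 : anti (star b2) b2 = 1 by [].
  have a12 : anti b1 b2 = y%:A by [].
  have a21 : anti (star b2) (star b1) = (Num.conj y)%:A.
    by rewrite -anti_star antiC a12 starZ star1.
  rewrite a1 a2 a12 a21 rmorphN /= !scalerA.
  rewrite -[X in X + _ + _]scale1r -!scalerDl [X in X *: _](_ : _ = 0) ?scale0r //.
  transitivity (1 - Num.conj y * y - Num.conj y * y + Num.conj y * y); first by ring.
  by rewrite yy; ring.
split=> //; split; last by rewrite addrC.
(* After substituting b1^* = conj(y) b2, the third relation reads 2 conj(y) b2^2 = 0. *)
move: r3; rewrite b1E starZ starK -scalerAl -scalerAr => /eqP.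
rewrite -addr_eq0 -mulr2n -scaler_nat scalerA scaler_eq0 mulf_eq0 pnatr_eq0 /= => /orP[|/eqP//].
by move/eqP => y0; move: yy; rewrite y0 mul0r => /esym/eqP; rewrite oner_eq0.
Qed.

(** A copy of [mxrep] that carries the proof of the fermion relations, so that the morphism
    structures can be declared on it. *)
Definition fermion_rep (B : cstarAlgType R) (e : B) of fermion e : 'M[R[i]]_2 -> B := mxrep e.

Section fermion_rep.
Variables (B : cstarAlgType R) (e : B) (fe : fermion e).

Let rep_nmod : nmod_morphism (fermion_rep fe).
Proof.
split; last exact: mxrepD.
by rewrite -(scale0r 0) /fermion_rep mxrepZ scale0r.
Qed.

HB.instance Definition _ := GRing.isNmodMorphism.Build 'M[R[i]]_2 B (fermion_rep fe) rep_nmod.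

Let rep_monoid : monoid_morphism (fermion_rep fe).
Proof. by split; [exact: mxrep1|move=> a b; exact: mxrepM]. Qed.

HB.instance Definition _ := GRing.isMonoidMorphism.Build 'M[R[i]]_2 B (fermion_rep fe) rep_monoid.

Let rep_scale : scalable (fermion_rep fe).
Proof. by move=> c a; exact: mxrepZ. Qed.

HB.instance Definition _ :=
  GRing.isScalable.Build R[i] 'M[R[i]]_2 B *:%R (fermion_rep fe) rep_scale.

End fermion_rep.

Let E : 'M[R[i]]_2 := delta_mx 0 1.

Let star_delta : star E = delta_mx 1 0.
Proof. by apply/matrixP => i j; rewrite !mxE andbC; exact: rmorph_nat. Qed.

(** Writes every matrix as a *-polynomial in E, which is what uniqueness in the universal property
    requires. *)
Lemma mxrep_delta (A : 'M[R[i]]_2) : mxrep E A = A.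
Proof.
rewrite mxrepE star_delta -[E * _]/(E *m _) -[_ * E]/(_ *m E) !mul_delta_mx.
apply/matrixP => i j; case: (I2P i) (I2P j) => -> [] ->;
by rewrite !mxE /= !(mulr0, mulr1, addr0, add0r).
Qed.

Lemma fermion_delta : fermion E.
Proof.
split; rewrite ?star_delta -![_ * _]/(_ *m _) ?mul_delta_mx ?mul_delta_mx_0 //.
by apply/matrixP => i j; case: (I2P i) (I2P j) => -> [] ->; rewrite !mxE /= ?addr0 ?add0r.
Qed.

Lemma matrix_enveloping : is_enveloping y (y *: star E : 'M[R[i]]_2) E.
Proof.
have [EE E1] := fermion_delta; split.
  split.
  - rewrite starZ starK -!scalerAl -!scalerAr !scalerA [y * _]mulrC yy !scale1r.
    exact: E1.
  - by rewrite addrC.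
  - by rewrite starZ starK -scalerAl -scalerAr EE scaler0 oppr0.
  - by rewrite -scalerAl -scalerAr -scalerDr addrC E1.
move=> B b1 b2 /unit_relations_fermion[fb b1E]; exists (fermion_rep fb).
have repE : fermion_rep fb E = b2.
  by rewrite /fermion_rep mxrepE !mxE /= !scale0r scale1r ?addr0 ?add0r.
have rs : star_morphism (fermion_rep fb).
  by move=> A; exact: mxrep_star.
split=> //.
- by rewrite linearZ /= rs repE.
- move=> g sg _ g2 A; rewrite -{1}(mxrep_delta A) /fermion_rep mxrepE [RHS]mxrepE.
  by rewrite !raddfD /= !linearZ /= !rmorphM /= !sg g2.
Qed.

End unit_modulus.

Theorem theorem3p2 (R : realType) (y : R[i]) :
  (forall y01 : 0 < normc y < 1, enveloping_isomorphic y (model y01)) /\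
  (normc y = 1 -> enveloping_isomorphic y 'M[R[i]]_2).
Proof.
split=> [y01|y1]; first exact: enveloping_isomorphicI (model_enveloping y01).
exact: enveloping_isomorphicI (matrix_enveloping y1).
Qed.
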